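(* For each $n\ge1$ let $\sigma_n$ be a uniformly random element of $Sq(n)$, the set of square permutations of size $n$. Then, as $n\to\infty$, $\sigma_n$ converges in the quenched Benjamini--Schramm sense to the random measure $\nu_\infty$, and $\sigma_n$ converges in the annealed Benjamini--Schramm sense to the random infinite rooted permutation $(\mathbb Z,\preccurlyeq_\infty)$.
   Context: Square permutations. For a permutation $\sigma$ of $[n]$, a point $(i,\sigma(i))$ is a record if $\sigma(i)$ is larger than all $\sigma(j)$ with $j<i$, or smaller than all of these, or larger than all $\sigma(j)$ with $j>i$, or smaller than all of these. $\sigma$ is square if all its points are records. Rooted permutations and local distance. A finite rooted permutation $(\sigma,i)$, with $\sigma$ a permutation of size $n$ and $i\in[n]$, is identified with the pair $(A,\preccurlyeq)$ where $A=[1-i,n-i]\cap\mathbb Z$ and $\preccurlyeq$ is the total order on $A$ given by $\ell\preccurlyeq j\iff\sigma(\ell+i)\le\sigma(j+i)$. An infinite rooted permutation is a pair $(A,\preccurlyeq)$ with $A$ an infinite interval of integers containing $0$ and $\preccurlyeq$ a total order on $A$. Let $\tilde{\mathcal S}_\bullet$ be the set of all finite and infinite rooted permutations. For $h\in\mathbb N$ let $r_h(A,\preccurlyeq)=(A\cap[-h,h],\preccurlyeq)$. The local distance is $d((A_1,\preccurlyeq_1),(A_2,\preccurlyeq_2))=2^{-\sup\{h\in\mathbb N:\ r_h(A_1,\preccurlyeq_1)=r_h(A_2,\preccurlyeq_2)\}}$, with $\sup\emptyset=0$, $2^{-\infty}=0$. The space $(\tilde{\mathcal S}_\bullet,d)$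 is a compact metric space. Modes of convergence. Let $\sigma_n$ be random permutations and $i_n$ a uniform index in $[|\sigma_n|]$ (independent of $\sigma_n$ when $|\sigma_n|=n$). Annealed convergence to a random element $\sigma_\infty$ of $\tilde{\mathcal S}_\bullet$ means that $(\sigma_n,i_n)\to\sigma_\infty$ in distribution with respect to $d$. Quenched convergence to a random probability measure $\nu$ on $\tilde{\mathcal S}_\bullet$ means that the conditional laws $\mathrm{Law}((\sigma_n,i_n)\mid\sigma_n)$ converge in distribution to $\nu$, as random elements of the space of probability measures on $\tilde{\mathcal S}_\bullet$ with the weak topology induced by $d$. Limiting objects. For a labeling $\mathcal L\in\{+,-\}^{\mathbb Z}$ let $\mathcal L^{+},\mathcal L^-$ be the sets of integers with label $+$, $-$. Define four total orders $\preccurlyeq^{\mathcal L}_j$, $j=1,2,3,4$, on $\mathbb Z$: in all of them every element of $\mathcal L^-$ is below every element of $\mathcal L^+$; for $j=1$ the elements within $\mathcal L^-$ and within $\mathcal L^+$ are ordered by the usual order $<$; for $j=2$ the elements of $\mathcal L^-$ are ordered by the reversed usual order and those of $\mathcal L^+$ by the usual order; for $j=3$ the elements of $\mathcal L^-$ are ordered by the usual order and those of $\mathcal L^+$ by the reversed order; for $j=4$ both are ordered by the reversed order. Let $\mathcal L$ now be random with i.i.d. labels, each $+$ or $-$ with probability $1/2$. - $\preccurlyeq_\infty$ is the random total order $\preccurlyeq^{\mathcal L}_{K}$, where $K$ is uniform in $\{1,2,3,4\}$ and independent of $\mathcal L$. - Define $J:[0,1]^2\to\{1,2,3,4\}$ by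 $J(u,v)=1$ if $u<1/2$ and $u\le v\le1-u$; $J(u,v)=2$ if $v<\min\{u,1-u\}$; $J(u,v)=3$ if $v>\max\{u,1-u\}$; $J(u,v)=4$ if $u\ge1/2$ and $1-u\le v\le u$. Let $U,V$ be independent uniform random variables on $[0,1]$, independent of $\mathcal L$. Then $\nu_\infty=\mathrm{Law}\big((\mathbb Z,\preccurlyeq^{\mathcal L}_{J(U,V)})\,\big|\,U\big)$, a random probability measure on $\tilde{\mathcal S}_\bullet$. *)

(* Defs.v *)
From HB Require Import structures.
From mathcomp Require Import all_boot all_order all_algebra all_fingroup.
From mathcomp Require Import finmap zify.
From mathcomp Require Import all_classical all_reals all_analysis measurable_realfun.

Set Implicit Arguments.
Unset Strict Implicit.
Unset Printing Implicit Defensive.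

Import Order.TTheory GRing.Theory Num.Theory.
Import numFieldNormedType.Exports.

Local Open Scope classical_set_scope.
Local Open Scope ring_scope.

Section SquarePermutations.

Definition is_record n (s : 'S_n) (i : 'I_n) : bool :=
  [|| [forall j : 'I_n, (j < i)%N ==> (s j < s i)%N],
      [forall j : 'I_n, (j < i)%N ==> (s i < s j)%N],
      [forall j : 'I_n, (i < j)%N ==> (s j < s i)%N]
    | [forall j : 'I_n, (i < j)%N ==> (s i < s j)%N]].

Definition square_perm n (s : 'S_n) : bool := [forall i, is_record s i].

Definition Sq n : {set 'S_n} := [set s | square_perm s]%SET.

End SquarePermutations.

(* A pair (A, <=) with A an interval of integers containing 0, finite or
   infinite, and <= a total order on A. [rp_le] is required to hold only
   between elements of A, so that Leibniz equality of such records is equality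
   of the underlying pairs. *)
Record rperm := RPerm {
  rp_dom : set int;
  rp_le : int -> int -> Prop;
  rp_dom0 : rp_dom 0;
  rp_itv : forall x y z : int, rp_dom x -> rp_dom z -> x <= y <= z -> rp_dom y;
  rp_le_dom : forall x y, rp_le x y -> rp_dom x /\ rp_dom y;
  rp_anti : forall x y, rp_le x y -> rp_le y x -> x = y;
  rp_trans : forall y x z, rp_le x y -> rp_le y z -> rp_le x z;
  rp_total : forall x y, rp_dom x -> rp_dom y -> rp_le x y \/ rp_le y x
}.

Lemma rperm_ext (x y : rperm) :
  (forall a, rp_dom x a <-> rp_dom y a) ->
  (forall a b, rp_le x a b <-> rp_le y a b) -> x = y.
Proof.
case: x => D r p1 p2 p3 p4 p5 p6; case: y => D' r' q1 q2 q3 q4 q5 q6 /= eD er.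
have ED : D = D' by apply/funext => a; apply/propext.
have Er : r = r' by apply/funext => a; apply/funext => b; apply/propext.
subst D' r'.
by rewrite (Prop_irrelevance p1 q1) (Prop_irrelevance p2 q2)
  (Prop_irrelevance p3 q3) (Prop_irrelevance p4 q4) (Prop_irrelevance p5 q5)
  (Prop_irrelevance p6 q6).
Qed.

Section Restriction.
Variables (h : nat) (x : rperm).

Let dom := [set a : int | rp_dom x a /\ - h%:Z <= a <= h%:Z].
Let le (a b : int) := [/\ rp_le x a b, dom a & dom b].

Let dom0 : dom 0.
Proof. by split; [exact: rp_dom0|lia]. Qed.

Let itv (a b c : int) : dom a -> dom c -> a <= b <= c -> dom b.
Proof. by move=> [xa ?] [xc ?] abc; split; [exact: rp_itv abc|lia]. Qed.

Let le_dom a b : le a b -> dom a /\ dom b.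
Proof. by case. Qed.

Let anti a b : le a b -> le b a -> a = b.
Proof. by move=> [ab _ _] [ba _ _]; exact: rp_anti ab ba. Qed.

Let trans b a c : le a b -> le b c -> le a c.
Proof. by move=> [ab da _] [bc _ dc]; split => //; exact: rp_trans ab bc. Qed.

Let total a b : dom a -> dom b -> le a b \/ le b a.
Proof.
by move=> da db; have [ab|ba] := rp_total da.1 db.1; [left|right]; split.
Qed.

Definition rp_restr : rperm := RPerm dom0 itv le_dom anti trans total.

End Restriction.

(* With i : 'I_n counted from 0, the interval [1 - i, n - i] reads
   { l | 0 <= l + i < n }. *)
Section FiniteRooted.
Variables (n : nat) (s : 'S_n) (i : 'I_n).

Let dom := [set l : int | 0 <= l + i%:Z < n%:Z].
Let le (l j : int) := exists a b : 'I_n,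
  [/\ a%:Z = l + i%:Z, b%:Z = j + i%:Z & (s a <= s b)%N].

Let dom0 : dom 0.
Proof. by rewrite /dom /=; have := ltn_ord i; lia. Qed.

Let itv (a b c : int) : dom a -> dom c -> a <= b <= c -> dom b.
Proof. by rewrite /dom /=; lia. Qed.

Let le_dom a b : le a b -> dom a /\ dom b.
Proof.
by move=> [u [v [ua vb _]]]; rewrite /dom /= -ua -vb; have := ltn_ord u;
  have := ltn_ord v; lia.
Qed.

Let ord_inj (u v : 'I_n) (a : int) : u%:Z = a -> v%:Z = a -> u = v.
Proof. by move=> ua va; apply/val_inj => /=; lia. Qed.

Let anti a b : le a b -> le b a -> a = b.
Proof.
move=> [u [v [ua vb uv]]] [v' [u' [vb' ua' vu]]].
move: vu; rewrite (ord_inj vb' vb) (ord_inj ua' ua) => vu.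
have /perm_inj uvE : s u = s v by apply/val_inj/eqP; rewrite eqn_leq uv vu.
by move: vb; rewrite -uvE; lia.
Qed.

Let trans b a c : le a b -> le b c -> le a c.
Proof.
move=> [u [v [ua vb uv]]] [v' [t [vb' tc vt]]]; exists u, t; split => //.
by move: vt; rewrite (ord_inj vb' vb); exact: leq_trans.
Qed.

Let total a b : dom a -> dom b -> le a b \/ le b a.
Proof.
rewrite /dom /= => da db.
have ha : (absz (a + i%:Z)%R < n)%N by lia.
have hb : (absz (b + i%:Z)%R < n)%N by lia.
have [ab|/ltnW ba] := leqP (s (Ordinal ha)) (s (Ordinal hb)).
  by left; exists (Ordinal ha), (Ordinal hb); split => //=; lia.
by right; exists (Ordinal hb), (Ordinal ha); split => //=; lia.
Qed.

Definition rooted_perm : rperm := RPerm dom0 itv le_dom anti trans total.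

End FiniteRooted.

(* [true] is the label +, [false] the label -. The minus elements are in usual
   order for j = 1, 3 and the plus elements for j = 1, 2; only j = 1, 2, 3, 4
   are meaningful (any other j gives the order 4). *)
Definition label_le (j : nat) (L : int -> bool) (x y : int) : bool :=
  match L x, L y with
  | false, true => true
  | true, false => false
  | false, false => if (j == 1)%N || (j == 3)%N then x <= y else y <= x
  | true, true => if (j == 1)%N || (j == 2)%N then x <= y else y <= x
  end.

Section LabelOrder.
Variables (j : nat) (L : int -> bool).

Let dom := [set: int].
Let le (x y : int) : Prop := label_le j L x y.

Let dom0 : dom 0. Proof. by []. Qed.

Let itv (a b c : int) : dom a -> dom c -> a <= b <= c -> dom b. Proof. by []. Qed.

Let le_dom a b : le a b -> dom a /\ dom b. Proof. by []. Qed.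

Let anti a b : le a b -> le b a -> a = b.
Proof. by rewrite /le /label_le; case: (L a); case: (L b) => //; case: ifP => _; lia. Qed.

Let trans b a c : le a b -> le b c -> le a c.
Proof.
rewrite /le /label_le.
by case: (L a); case: (L b); case: (L c) => //; case: ifP => _; lia.
Qed.

Let total a b : dom a -> dom b -> le a b \/ le b a.
Proof.
move=> _ _; apply/orP; rewrite /label_le.
by case: (L a); case: (L b) => //; case: ifP => _; lia.
Qed.

Definition label_rperm : rperm := RPerm dom0 itv le_dom anti trans total.

End LabelOrder.

(* The parameter [R] only fixes the field in which distances are measured. *)
Definition rpspace (R : realType) : Type := rperm.

Section LocalDistance.
Variable R : realType.
Implicit Types x y z : rperm.

(* 2 ^ (- sup), with 2 ^ (- oo) = 0 and sup of the empty set = 0; the last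
   branch never occurs since all restrictions to h = 0 agree. *)
Definition rp_dist x y : R :=
  match ereal_sup [set (h%:R : R)%:E | h in
                    [set h | rp_restr h x = rp_restr h y]] with
  | r%:E => 2 `^ (- r)
  | +oo%E => 0
  | -oo%E => 1
  end.

Let agree x y h := rp_restr h x = rp_restr h y.

Let agree0 x y : agree x y 0.
Proof.
have E a : - 0%:Z <= a <= 0%:Z -> a = 0 by lia.
have r0 z : rp_le z 0 0 by case: (rp_total (rp_dom0 z) (rp_dom0 z)).
have d0 z : [set a : int | rp_dom z a /\ - 0%:Z <= a <= 0%:Z] 0.
  by split; [exact: rp_dom0|lia].
apply: rperm_ext => [a|a b] /=; split.
- by move=> [_ /E ->]; exact: d0.
- by move=> [_ /E ->]; exact: d0.
- by move=> [_ [_ /E ->] [_ /E ->]]; split; [exact: r0|exact: d0|exact: d0].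
- by move=> [_ [_ /E ->] [_ /E ->]]; split; [exact: r0|exact: d0|exact: d0].
Qed.

Let agreeP x y h : agree x y h ->
  (forall a, - h%:Z <= a <= h%:Z -> rp_dom x a <-> rp_dom y a) /\
  (forall a b, - h%:Z <= a <= h%:Z -> - h%:Z <= b <= h%:Z ->
     rp_le x a b <-> rp_le y a b).
Proof.
move=> xy; split=> [a ha|a b ha hb].
  have := congr1 (fun z => rp_dom z a) xy; rewrite /= => e.
  split=> za.
    by have : rp_dom x a /\ - h%:Z <= a <= h%:Z by []; rewrite e => -[].
  by have : rp_dom y a /\ - h%:Z <= a <= h%:Z by []; rewrite -e => -[].
have := congr1 (fun z => rp_le z a b) xy; rewrite /= => e.
split=> zab; have [? ?] := rp_le_dom zab.
  suff : rp_le (rp_restr h x) a b by rewrite xy => -[].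
  by split.
suff : rp_le (rp_restr h y) a b by rewrite -xy => -[].
by split.
Qed.

Let agreeW x y h k : (k <= h)%N -> agree x y h -> agree x y k.
Proof.
move=> kh /agreeP[xyd xyl]; apply: rperm_ext => [a|a b] /=; split.
- by move=> [xa ha]; split => //; apply/xyd => //; lia.
- by move=> [xa ha]; split => //; apply/xyd => //; lia.
- by move=> [ab [da ha] [db hb]]; split; [apply/xyl => //; lia|
    split => //; apply/xyd => //; lia|split => //; apply/xyd => //; lia].
- by move=> [ab [da ha] [db hb]]; split; [apply/xyl => //; lia|
    split => //; apply/xyd => //; lia|split => //; apply/xyd => //; lia].
Qed.

Let agree_all x y : (forall h, agree x y h) -> x = y.
Proof.
move=> xy; apply: rperm_ext => [a|a b].
  by have [+ _] := agreeP (xy (absz a)); apply; lia.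
by have [_ +] := agreeP (xy (absz a + absz b)%N); apply; lia.
Qed.

Let distxx x : rp_dist x x = 0.
Proof.
rewrite /rp_dist (_ : ereal_sup _ = +oo%E)//.
apply/eqyP => r r0; apply: le_trans (ereal_sup_ubound _) => /=; last first.
  by exists (Num.truncn r).+1.
by rewrite lee_fin ltW// truncnS_gt.
Qed.

Let dist_neq x y : x <> y -> exists h,
  [/\ agree x y h, ~ agree x y h.+1 & rp_dist x y = 2 `^ (- h%:R)].
Proof.
move=> xy.
have ex : exists k, `[< ~ agree x y k >].
  apply: contrapT => nex; apply: xy; apply: agree_all => h.
  by apply: contrapT => nh; apply: nex; exists h; apply/asboolP.
case: (ex_minnP ex) => -[|h] /asboolP nh minh; first by case: nh.
have ah : agree x y h.
  by apply: contrapT => /asboolP/minh; rewrite ltnn.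
exists h; split => //; rewrite /rp_dist.
rewrite (_ : ereal_sup _ = h%:R%:E)//.
apply/eqP; rewrite eq_le; apply/andP; split.
  apply: ge_ereal_sup => _ [k /= xyk <-]; rewrite lee_fin ler_nat leqNgt.
  by apply/negP => hk; apply: nh; exact: agreeW xyk.
by apply: ereal_sup_ubound; exists h.
Qed.

Let dist_ge0 x y : 0 <= rp_dist x y.
Proof. by rewrite /rp_dist; case: ereal_sup => // r; exact: powR_ge0. Qed.

Let dist_positivity x y : rp_dist x y = 0 -> x = y.
Proof.
have [//|/dist_neq[h [_ _ ->]]] := pselect (x = y).
by move/eqP; rewrite powR_eq0 pnatr_eq0.
Qed.

Let dist_sym x y : rp_dist x y = rp_dist y x.
Proof.
rewrite /rp_dist (_ : [set h | rp_restr h x = rp_restr h y] =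
                      [set h | rp_restr h y = rp_restr h x])//.
by apply/seteqP; split => h /= ->.
Qed.

Let dist_triangle y x z : rp_dist x z <= rp_dist x y + rp_dist y z.
Proof.
have [->|xz] := pselect (x = z); first by rewrite distxx addr_ge0.
have [->|/dist_neq[k [xyk _ Ek]]] := pselect (x = y).
  by rewrite distxx add0r.
have [->|/dist_neq[l [yzl _ El]]] := pselect (y = z).
  by rewrite distxx addr0.
have [h [_ nh ->]] := dist_neq xz.
have klh : (minn k l <= h)%N.
  rewrite leqNgt; apply/negP; rewrite leq_min => /andP[hk hl]; apply: nh.
  exact: etrans (agreeW hk xyk) (agreeW hl yzl).
have le_pow m : (m <= h)%N -> 2 `^ (- h%:R) <= 2 `^ (- m%:R) :> R.
  by move=> mh; rewrite ler_powR ?ler1n// lerN2 ler_nat.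
move: klh; rewrite geq_min => /orP[kh|lh].
  by rewrite -[leLHS]addr0 Ek lerD ?le_pow.
by rewrite -[leLHS]add0r El lerD ?le_pow.
Qed.

HB.instance Definition _ := gen_eqMixin (rpspace R).
HB.instance Definition _ := gen_choiceMixin (rpspace R).
HB.instance Definition _ := isPointed.Build (rpspace R)
  (label_rperm 1 (fun=> true)).
HB.instance Definition _ := isMetric.Build R (rpspace R)
  distxx dist_positivity dist_sym dist_triangle.

End LocalDistance.

Definition borel (S : ptopologicalType) := g_sigma_algebraType (@open S).

Section WeakTopology.
Variables (R : realType) (S : ptopologicalType).

Definition cont_bounded :=
  {f : S -> R | continuous f /\ exists M, forall x, `|f x| <= M}.

HB.instance Definition _ := gen_eqMixin cont_bounded.
HB.instance Definition _ := gen_choiceMixin cont_bounded.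

Definition mean (mu : probability (borel S) R) :
    prod_topology (fun _ : cont_bounded => R) :=
  fun f => Rintegral mu setT (sval f).

(* The coarsest topology making mu |-> \int f dmu continuous for every bounded
   continuous f, i.e. the topology of weak convergence. *)
Definition wprobability : Type := probability (borel S) R.

HB.instance Definition _ := Pointed.on wprobability.
HB.instance Definition _ :=
  Topological.copy wprobability (initial_topology mean).

End WeakTopology.

Section RandomElements.
Variables (R : realType) (d : measure_display) (T : measurableType d).
Variable P : probability T R.
Local Open Scope ereal_scope.

Definition uniform_on (E : finType) (X : T -> E) (A : {pred E}) : Prop :=
  forall x, measurable (X @^-1` [set x]) /\
    P (X @^-1` [set x]) = ((x \in A)%:R / #|A|%:R)%R%:E.

Definition uniform01 (U : T -> R) : Prop :=
  measurable_fun setT U /\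
  forall B, measurable B -> P (U @^-1` B) = uniform_prob (@ltr01 R) B.

Definition indep (F G : set (set T)) : Prop :=
  forall A B, F A -> G B -> P (A `&` B) = P A * P B.

Definition mutual_indep (I : choiceType) (F : I -> set (set T)) : Prop :=
  forall (J : {fset I}) (A : I -> set T), (forall i, i \in J -> F i (A i)) ->
    P (\bigcap_(i in [set` J]) A i) = \prod_(i <- J) P (A i).

(* The sigma-algebra generated by a discrete random variable. *)
Definition sigma_discrete (E : Type) (X : T -> E) : set (set T) :=
  preimage_set_system setT X setT.

Definition sigma_family (I E : Type) (X : I -> T -> E) : set (set T) :=
  <<s \bigcup_i sigma_discrete (X i) >>.

Definition sigma_rv d' (E : measurableType d') (X : T -> E) : set (set T) :=
  preimage_set_system setT X measurable.

(* nu is a (regular) version of Law(X | G), for a sub-sigma-algebra G. *)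
Definition cond_law (G : set (set T)) (S : ptopologicalType) (X : T -> S)
    (nu : T -> wprobability R S) : Prop :=
  forall B : set (borel S), measurable B ->
    (forall C : set (\bar R), measurable C ->
       G ((fun w => (nu w : probability (borel S) R) B) @^-1` C)) /\
    (forall A, G A ->
       \int[P]_(w in A) (nu w : probability (borel S) R) B =
       P (A `&` X @^-1` B)).

End RandomElements.

Definition cvg_in_law (R : realType) (S : ptopologicalType)
    (d : nat -> measure_display) (T : forall n, measurableType (d n))
    (P : forall n, probability (T n) R) (X : forall n, T n -> S)
    (d' : measure_display) (T' : measurableType d') (Q : probability T' R)
    (Y : T' -> S) : Prop :=
  [/\ forall n, measurable_fun setT (X n : T n -> borel S),
      measurable_fun setT (Y : T' -> borel S) &
      forall f : S -> R, continuous f -> (exists M, forall x, `|f x| <= M) ->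
        ('E_(P n)[f \o X n])%E @[n --> \oo] --> ('E_Q[f \o Y])%E].

Section BenjaminiSchramm.
Variables (R : realType) (d : nat -> measure_display).
Variables (T : forall n, measurableType (d n)).
Variables (P : forall n, probability (T n) R).
Variables (sigma : forall n, T n -> 'S_n.+1) (root : forall n, T n -> 'I_n.+1).
Variables (d' : measure_display) (T' : measurableType d').
Variable Q : probability T' R.

Definition rooted n (w : T n) : rpspace R := rooted_perm (sigma w) (root w).

Definition annealed_cvg (Y : T' -> rpspace R) : Prop :=
  cvg_in_law P rooted Q Y.

Definition quenched_cvg (nu : T' -> wprobability R (rpspace R)) : Prop :=
  forall mu : forall n, T n -> wprobability R (rpspace R),
    (forall n, cond_law (P n) (sigma_discrete (@sigma n)) (@rooted n) (mu n)) ->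
    cvg_in_law P mu Q nu.

End BenjaminiSchramm.

(* On [0, 1]^2 the last branch is u >= 1/2 and 1 - u <= v <= u. *)
Definition J (R : realType) (u v : R) : nat :=
  if (u < 1 / 2) && (u <= v <= 1 - u) then 1
  else if v < Num.min u (1 - u) then 2
  else if Num.max u (1 - u) < v then 3
  else 4.

(* Main.v *)
Require Import Defs.
From HB Require Import structures.
From mathcomp Require Import all_boot all_order all_algebra all_fingroup.
From mathcomp Require Import finmap zify ring lra.
From mathcomp Require Import all_classical all_reals all_analysis measurable_realfun.

(* Label each position of a square permutation s of size N by "lower record or
   not" and each value by "left record or not".  Together with the position z
   of the minimum these labels determine s, and five of them are forced, so at
   most 4^N / 32 square permutations have their minimum at a given interior z.
   Conversely, two label sequences with the forced values whose partial sums
   are close to those of a fair coin come from a square permutation whose graph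
   follows the sides of the rectangle with corners (z, 0), (0, z), (N - z, N),
   (N, N - z); hence near a position i the relative order is the order j of the
   labels, j being the side of the rectangle above i.  By Chebyshev's
   inequality almost all label sequences qualify and have the expected local
   statistics, so that s is asymptotically a uniform z together with fair
   labels, and the frequencies of local patterns are asymptotically a function
   of z / N.

   The cylinders of the local topology form a countable base of clopen sets,
   finitely many at each level, so the weak topology on probability measures is
   governed by the masses of the cylinders.  A bounded functional of the
   empirical measure, averaged over the permutations with minimum at
   z = floor (N u), converges for every u in ]0, 1[; dominated convergence in
   u = U gives the quenched limit.  The annealed limit is the same statement
   for the mass of one cylinder. *)

Set Implicit Arguments.
Unset Strict Implicit.
Unset Printing Implicit Defensive.


(** * Rebuilding a square permutation from its labels *)

(** No exact enumeration is needed, because two bounds meet. The forced labels cost exactly five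
    bits; injectivity of the labels bounds the number of permutations with minimum at an interior z
    by 4^N / 32, and rebuilding reaches almost all of these pairs. The total size of [Sq] then comes
    from averaging the constant function 1. Only linear precision is required: partial sums may
    deviate by a small fixed fraction of N. Second moments at a bounded number of grid points
    therefore suffice, and the price is a small proportion of positions near z, N - z and the two
    ends where the local order is left undetermined. Upper records are the delicate ones. A lower
    record is a left one exactly when it is not beyond z, but nothing comparable is visible for
    upper positions; this is why values carry labels too. When rebuilding, values with the same
    label are compared by exact ranks, and the others by the distance between opposite sides of the
    rectangle. The estimates are not uniform as u approaches 0 or 1; dominated convergence absorbs
    this. *)

Definition cnt (p : pred nat) i := count p (iota 0 i).

Lemma cnt0 (p : pred nat) : cnt p 0 = 0. Proof. by []. Qed.

Lemma cntS (p : pred nat) i : cnt p i.+1 = cnt p i + p i.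
Proof. by rewrite /cnt -addn1 iotaD count_cat /= addn0. Qed.

Lemma cnt_le (p : pred nat) i j : i <= j -> cnt p i <= cnt p j <= cnt p i + (j - i).
Proof.
elim: j => [|j IH]; first by rewrite leqn0 => /eqP ->; rewrite cnt0.
rewrite leq_eqVlt => /predU1P[->|]; first by lia.
by rewrite ltnS => /[dup] ij /IH; rewrite cntS; case: (p j); lia.
Qed.

Lemma cnt_lt (p : pred nat) i j : i < j -> p i -> cnt p i < cnt p j.
Proof. by move=> /(cnt_le p); rewrite cntS => /andP[+ _] pi; rewrite pi; lia. Qed.

Lemma cntC (p : pred nat) i : cnt p i + cnt (predC p) i = i.
Proof. by rewrite /cnt count_predC size_iota. Qed.

Lemma cnt_ltP (p : pred nat) i j : cnt p i < cnt p j -> i < j.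
Proof. by move=> h; rewrite ltnNge; apply/negP => /(cnt_le p); lia. Qed.

Lemma cnt_ex (p : pred nat) i j : i <= j -> cnt p i < cnt p j -> exists2 a, i <= a < j & p a.
Proof.
elim: j => [|j IH]; first by rewrite cnt0.
rewrite leq_eqVlt => /predU1P[->|ij]; first by rewrite ltnn.
rewrite cntS; case: (boolP (p j)) => pj => [_|]; first by exists j => //; lia.
by rewrite addn0 => /(IH ij)[a ? pa]; exists a => //; lia.
Qed.

(** The element of rank [t], counted from 0, among those below [N] satisfying [p]. When there is
    none, [find] returns [N]. *)
Definition sel (p : pred nat) N t :=
  find (fun v => p v && (cnt p v == t)) (iota 0 N).

Lemma selP (p : pred nat) N t : t < cnt p N ->
  [/\ sel p N t < N, p (sel p N t) & cnt p (sel p N t) = t].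
Proof.
move=> tN; have : has (fun v => p v && (cnt p v == t)) (iota 0 N).
  apply/hasP; elim: N tN => [|N IH]; first by rewrite cnt0.
  rewrite cntS; case: (ltnP t (cnt p N)) => [/IH[v]|tN tN'].
    rewrite mem_iota => vN pv _; exists v => //; rewrite mem_iota; lia.
  exists N; first by rewrite mem_iota; lia.
  by move: tN'; case: (p N); lia.
move=> hs; have := hs; rewrite has_find size_iota => sN.
by have := nth_find 0 hs; rewrite nth_iota// => /andP[? /eqP].
Qed.

Section Rebuild.
Variables (x y : pred nat) (z N : nat).

Definition low_left := cnt x z.+1.
Definition up_left := cnt y N - low_left.

(** Each record type is monotone, so ranks dictate the values. Left-to-right minima, [low_left] in
    number, take the smallest left values in decreasing order; left-to-right maxima, [up_left] in
    number, take the other left values in increasing order. Right-to-left minima take the smallest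
    right values upwards, right-to-left maxima the remaining ones downwards. *)
Definition rebuild i :=
  let r := i - cnt x i in
  if x i then
    if i <= z then sel y N (low_left - cnt x i.+1)
    else sel (predC y) N (cnt x i - low_left)
  else if r < up_left then sel y N (low_left + r)
  else sel (predC y) N (N - cnt y N - 1 - (r - up_left)).

Definition balanced (e : nat) (p : pred nat) M :=
  forall i, i <= M -> i <= (cnt p i).*2 + e /\ (cnt p i).*2 <= i + e.

Variable e : nat.

(* The factor 40 leaves room for all the rounding errors, each of which is at
   most 5 e; no attempt is made to optimize it. *)
Record typical_code : Prop := TypicalCode {
  tc_e : 0 < e;
  tc_x : balanced e x N;
  tc_y : balanced e y N;
  tc_z : 40 * e <= z;
  tc_zN : z + 40 * e <= N;
  tc_x0 : x 0;
  tc_xl : x N.-1;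
  tc_xz : x z;
  tc_y0 : y 0;
  tc_yl : y N.-1
}.

Hypothesis tc : typical_code.
Let e_gt0 : 0 < e. Proof. by case: tc. Qed.
Let bx : balanced e x N. Proof. by case: tc. Qed.
Let by_ : balanced e y N. Proof. by case: tc. Qed.
Let ze : 40 * e <= z. Proof. by case: tc. Qed.
Let zNe : z + 40 * e <= N. Proof. by case: tc. Qed.

(** Each case couples an exact rank identity, for comparing values with the same label, with the
    equation of a side of the rectangle up to O(e), for comparing values with different labels. *)
Variant rebuild_spec i (v : nat) : Prop :=
| RbLRmin of x i & i <= z & y v & cnt y v + cnt x i.+1 = low_left
    & v <= z - i + 4 * e & z - i <= v + 4 * e
| RbRLmin of x i & z < i & ~~ y v & v + low_left = cnt y v + cnt x i
    & v <= i - z + 4 * e & i - z <= v + 4 * e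
| RbLRmax of ~~ x i & i - cnt x i < up_left & y v &
    cnt y v + cnt x i = low_left + i
    & v <= i + z + 4 * e & i + z <= v + 4 * e & i + z <= N + 4 * e
| RbRLmax of ~~ x i & up_left <= i - cnt x i & ~~ y v &
    v + i + low_left + 1 = cnt y v + N + cnt x i
    & v + i + z <= N + N + 5 * e & N + N <= v + i + z + 5 * e & N <= i + z + 4 * e.

Lemma rebuildP i : i < N -> rebuild i < N /\ rebuild_spec i (rebuild i).
Proof.
move=> iN; have [b1 b2] := bx (ltnW iN); have [b3 b4] := bx iN.
have zN : z.+1 <= N by lia.
have [b5 b6] := bx zN; have [b7 b8] := by_ (leqnn N).
have [b9 b10] := bx (leqnn N).
have c1 := cntS x i.
have cC := cntC y N; have cX := cntC x i.
rewrite /rebuild.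
have L t : t < cnt y N -> exists v, [/\ sel y N t = v, v < N, y v, cnt y v = t &
    v <= t.*2 + e /\ t.*2 <= v + e].
  by move=> /(@selP y)[s1 s2 s3]; exists (sel y N t); split => //;
    have := by_ (ltnW s1); lia.
have Rr t : t < cnt (predC y) N -> exists v, [/\ sel (predC y) N t = v, v < N,
    ~~ y v, v = cnt y v + t & v <= t.*2 + e /\ t.*2 <= v + e].
  move=> /(@selP (predC y))[s1 s2 s3]; exists (sel (predC y) N t).
  have := cntC y (sel (predC y) N t); rewrite s3 => s4.
  by have := by_ (ltnW s1); split => //; lia.
case: ifP => xi; [case: (leqP i z) => iz|case: (ltnP (i - cnt x i) up_left) => r].
- have c2 : cnt x i.+1 <= low_left by have := @cnt_le x i.+1 z.+1 iz; rewrite /low_left; lia.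
  rewrite xi in c1.
  have [v [-> vN yv cv [v1 v2]]] := @L (low_left - cnt x i.+1) ltac:(rewrite /low_left in c2 *; lia).
  split=> //; rewrite /low_left in c2 cv v1 v2 *; apply: RbLRmin => //; rewrite /low_left; lia.
- have c2 : low_left <= cnt x i by have := @cnt_le x z.+1 i iz; rewrite /low_left; lia.
  rewrite xi in c1.
  have [v [-> vN yv cv [v1 v2]]] := @Rr (cnt x i - low_left) ltac:(rewrite /low_left in c2 *; lia).
  split=> //; rewrite /low_left in c2 cv v1 v2 *; apply: RbRLmin => //; rewrite /low_left; lia.
- rewrite /up_left /low_left in r.
  have [v [-> vN yv cv [v1 v2]]] := @L (low_left + (i - cnt x i)) ltac:(rewrite /low_left; lia).
  split=> //; rewrite /low_left in cv v1 v2 *; apply: RbLRmax => //; rewrite ?xi /up_left /low_left; lia.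
- rewrite /up_left /low_left in r *.
  (* Position [i] is itself one of the upper positions counted up to [N], so the descending rank
     below does not truncate at 0. *)
  have ci : i - cnt x i <= N - cnt x N - 1.
    have C1 := cntC x i; have C2 := cntC x N.
    have := @cnt_lt (predC x) i N iN; rewrite /= xi => /(_ isT); lia.
  have C2 : cnt x z.+1 <= cnt x N by have := cnt_le x zN; lia.
  have [v [-> vN yv cv [v1 v2]]] :=
    @Rr (N - cnt y N - 1 - (i - cnt x i - (cnt y N - cnt x z.+1))) ltac:(lia).
  split=> //; apply: RbRLmax => //; rewrite ?xi /up_left /low_left; lia.
Qed.

Lemma rebuild_ltN i : i < N -> rebuild i < N.
Proof. by case/rebuildP. Qed.

Lemma rank_lt v w : cnt y v < cnt y w -> v < w.
Proof. exact: cnt_ltP. Qed.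

(** The number of right values below [v] is v - cnt y v; the additive form avoids truncated
    subtraction. *)
Lemma corank_lt v w : v + cnt y w < cnt y v + w -> v < w.
Proof. by move=> h; case: (ltnP v w) => [//|wv]; have := cnt_le y wv; lia. Qed.

Lemma cnt_pair i j : i < j -> j < N ->
  [/\ cnt x i.+1 = cnt x i + x i, cnt x j.+1 = cnt x j + x j,
      cnt x i.+1 <= cnt x j <= cnt x i.+1 + (j - i.+1) &
      cnt x i <= i /\ cnt x j.+1 <= cnt x N <= cnt x j.+1 + (N - j.+1)].
Proof.
move=> ij jN; rewrite !cntS; have := @cnt_le x j.+1 N jN; have := @cnt_le x i.+1 j ij.
by rewrite !cntS => ? ?; have ? := cntC x i; split=> //; lia.
Qed.

Lemma rebuild_lt_LRmin i j : i < j -> j <= z -> x i -> x j -> rebuild j < rebuild i.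
Proof.
move=> ij jz xi xj; have jN : j < N by lia.
have [c1 c2 c3 c4] := cnt_pair ij jN.
have iN : i < N by lia.
have [_ [??? e1 _ _|? ?????|+ ??????|+ ??????]] := rebuildP iN; rewrite ?xi //; last by lia.
have [_ [??? e2 _ _|? ?????|+ ??????|+ ??????]] := rebuildP jN; rewrite ?xj //; last by lia.
by apply: rank_lt; rewrite xi xj in c1 c2; lia.
Qed.

(** [z] is the last of the left-to-right minima and gets the left value of rank 0, which is 0
    because that value has a forced left label. *)
Lemma rebuild_z : rebuild z = 0.
Proof.
have zN : z < N by lia.
have [_ [_ _ yv e1 _ _|? ?????|+ ??????|+ ??????]] := rebuildP zN; rewrite ?(tc_xz tc) //; last by lia.
apply/eqP; rewrite -leqn0 leqNgt; apply/negP => v0.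
by have := cnt_lt v0 (tc_y0 tc); rewrite cnt0; move: e1; rewrite /low_left; lia.
Qed.

Lemma rebuild_lt_RLmin i j : z <= i -> i < j -> j < N -> x i -> x j -> rebuild i < rebuild j.
Proof.
move=> zi ij jN xi xj; have iN : i < N by lia.
have [c1 c2 c3 c4] := cnt_pair ij jN.
have [_ [??? e2 _ _|_ ? y2 e2 _ _|+ ??????|+ ??????]] := rebuildP jN; rewrite ?xj //; first by lia.
(* Here [z] itself carries a left value, so ranks do not compare it with [j]; but its value is 0,
   and the right value of [j] cannot be 0. *)
move: zi; rewrite leq_eqVlt => /predU1P[<-|zi].
  by rewrite rebuild_z lt0n; apply/eqP => v0; rewrite v0 (tc_y0 tc) in y2.
have [_ [??? e1 _ _|_ ? _ e1 _ _|+ ??????|+ ??????]] := rebuildP iN; rewrite ?xi //; first by lia.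
by apply: corank_lt; rewrite xi xj in c1 c2; lia.
Qed.

Definition is_LRmax i := ~~ x i && (i - cnt x i < up_left).
Definition is_RLmax i := ~~ x i && (up_left <= i - cnt x i).

Lemma is_max i : ~~ x i -> is_LRmax i || is_RLmax i.
Proof. by rewrite /is_LRmax /is_RLmax => -> /=; case: ltnP. Qed.

Lemma rebuild_lt_LRmax i j : i < j -> j < N -> is_LRmax i -> is_LRmax j ->
  rebuild i < rebuild j.
Proof.
move=> ij jN /andP[xi ri] /andP[xj rj]; have iN : i < N by lia.
have [c1 c2 c3 c4] := cnt_pair ij jN.
have [_ [+|+|_ _ _ e1 _ _ _|]] := rebuildP iN; rewrite ?(negPf xi) //; last by lia.
have [_ [+|+|_ _ _ e2 _ _ _|]] := rebuildP jN; rewrite ?(negPf xj) //; last by lia.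
by apply: rank_lt; rewrite (negPf xi) (negPf xj) in c1 c2; lia.
Qed.

Lemma rebuild_lt_RLmax i j : i < j -> j < N -> is_RLmax i -> is_RLmax j ->
  rebuild j < rebuild i.
Proof.
move=> ij jN /andP[xi ri] /andP[xj rj]; have iN : i < N by lia.
have [c1 c2 c3 c4] := cnt_pair ij jN.
have [_ [+|+||_ _ _ e1 _ _ _]] := rebuildP iN; rewrite ?(negPf xi) //; first by lia.
have [_ [+|+||_ _ _ e2 _ _ _]] := rebuildP jN; rewrite ?(negPf xj) //; first by lia.
by apply: corank_lt; rewrite (negPf xi) (negPf xj) in c1 c2; lia.
Qed.

(** Both values are left values and the minima occupy the lowest ranks, so no proximity of [a] and
    [b] is needed. *)
Lemma rebuild_lt_LRmin_LRmax a b : a <= z -> b < N -> x a -> is_LRmax b ->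
  rebuild a < rebuild b.
Proof.
move=> az bN xa /andP[xb rb]; have aN : a < N by lia.
have [_ [_ _ _ e1 _ _||+|+]] := rebuildP aN; rewrite ?xa //; last by lia.
have [_ [+|+|_ _ _ e2 _ _ _|]] := rebuildP bN; rewrite ?(negPf xb) //; last by lia.
by apply: rank_lt; have := cntS x a; have := cntC x b; rewrite xa; lia.
Qed.

Lemma rebuild_lt_RLmin_RLmax a b : z < a -> a < N -> b < N -> x a -> is_RLmax b ->
  rebuild a < rebuild b.
Proof.
move=> az aN bN xa /andP[xb rb].
have [_ [|_ _ _ e1 _ _|+|+]] := rebuildP aN; rewrite ?xa //; first by lia.
have [_ [+|+||_ _ _ e2 _ _ _]] := rebuildP bN; rewrite ?(negPf xb) //; first by lia.
apply: corank_lt; have := cnt_lt aN xa; have := cnt_le x bN; rewrite cntS.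
by rewrite (negPf xb); lia.
Qed.

(** The two values have different labels, so ranks do not compare. The sides are opposite: under
    [b <= a + 10 * e] their heights differ by at least 2 (N - z) - 19 e, which is positive. The next
    lemma has the gap 2 z - 18 e in the same way. *)
Lemma rebuild_lt_LRmin_RLmax a b : a <= z -> b < N -> b <= a + 10 * e ->
  x a -> is_RLmax b -> rebuild a < rebuild b.
Proof.
move=> az bN ba xa /andP[xb rb]; have aN : a < N by lia.
have [_ [_ _ _ e1 v1 v2||+|+]] := rebuildP aN; rewrite ?xa //; last by lia.
have [_ [+|+||_ _ _ e2 v3 v4 v5]] := rebuildP bN; rewrite ?(negPf xb) //; first by lia.
by lia.
Qed.

Lemma rebuild_lt_RLmin_LRmax a b : z < a -> a < N -> b < N -> a <= b + 10 * e ->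
  x a -> is_LRmax b -> rebuild a < rebuild b.
Proof.
move=> az aN bN ba xa /andP[xb rb].
have [_ [|_ _ _ e1 v1 v2|+|+]] := rebuildP aN; rewrite ?xa //; first by lia.
have [_ [+|+|_ _ _ e2 v3 v4 v5|]] := rebuildP bN; rewrite ?(negPf xb) //; last by lia.
by lia.
Qed.

(** Equal values share their label and rank; within one record type the rank identity fixes the
    position, and the two types with the same label use disjoint ranks. *)
Lemma rebuild_inj i j : i < N -> j < N -> rebuild i = rebuild j -> i = j.
Proof.
wlog ij : i j / i < j => [H iN jN E|].
  case: (ltngtP i j) => // ij; [exact: H|by symmetry; apply: H].
move=> iN jN E; exfalso.
have [c1 c2 c3 c4] := cnt_pair ij jN.
have [_] := rebuildP iN; rewrite E; have [_] := rebuildP jN.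
move=> [xj ? yj ej _ _|xj ? yj ej _ _|xj ? yj ej _ _ _|xj ? yj ej _ _ _];
move=> [xi ? yi ei _ _|xi ? yi ei _ _|xi ? yi ei _ _ _|xi ? yi ei _ _ _];
rewrite ?yj ?(negPf yj) // in yi; rewrite ?xi ?xj ?(negPf xi) ?(negPf xj) in c1 c2; lia.
Qed.

End Rebuild.

(** * Labels of a square permutation *)

Section Records.
Variable n : nat.
Implicit Types (s t : 'S_n.+1) (i j : 'I_n.+1).

Definition LRmax s i := [forall j : 'I_n.+1, (j < i) ==> (s j < s i)].
Definition LRmin s i := [forall j : 'I_n.+1, (j < i) ==> (s i < s j)].
Definition RLmax s i := [forall j : 'I_n.+1, (i < j) ==> (s j < s i)].
Definition RLmin s i := [forall j : 'I_n.+1, (i < j) ==> (s i < s j)].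

Lemma is_recordE s i :
  is_record s i = [|| LRmax s i, LRmin s i, RLmax s i | RLmin s i].
Proof. by []. Qed.

Definition lower s i := LRmin s i || RLmin s i.
Definition left_rec s i := LRmin s i || LRmax s i.

Definition lowers s : {ffun 'I_n.+1 -> bool} := [ffun i => lower s i].
Definition lefts s : {ffun 'I_n.+1 -> bool} := [ffun v => left_rec s (s^-1 v)%g].

Lemma leftsE s i : lefts s (s i) = left_rec s i.
Proof. by rewrite ffunE permK. Qed.

Lemma recP (p : pred 'I_n.+1) (q : rel 'I_n.+1) i :
  reflect (forall j, p j -> q i j) [forall j, p j ==> q i j].
Proof. by apply: (iffP forallP) => H j; [move=> pj; exact: (implyP (H j))|apply/implyP/H]. Qed.

Lemma LRmaxP s i : reflect (forall j, j < i -> s j < s i) (LRmax s i).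
Proof. exact: (@recP (fun j => j < i) (fun i j => s j < s i)). Qed.
Lemma LRminP s i : reflect (forall j, j < i -> s i < s j) (LRmin s i).
Proof. exact: (@recP (fun j => j < i) (fun i j => s i < s j)). Qed.
Lemma RLmaxP s i : reflect (forall j, i < j -> s j < s i) (RLmax s i).
Proof. exact: (@recP (fun j => i < j) (fun i j => s j < s i)). Qed.
Lemma RLminP s i : reflect (forall j, i < j -> s i < s j) (RLmin s i).
Proof. exact: (@recP (fun j => i < j) (fun i j => s i < s j)). Qed.

Lemma perm_ltn_neq s i j : i != j -> (s i < s j) || (s j < s i).
Proof. by move=> ij; rewrite -neq_ltn; apply: contra ij => /eqP/val_inj/perm_inj ->. Qed.

Section Min.
Variables (s : 'S_n.+1) (z : 'I_n.+1).
Hypothesis sz : s z = 0 :> nat.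

Lemma argmin_lt j : j != z -> 0 < s j.
Proof. by move=> /(perm_ltn_neq s); rewrite sz ltn0. Qed.

Lemma LRmin_le i : LRmin s i -> i <= z.
Proof. by move=> /LRminP/(_ z); rewrite sz ltn0; case: ltnP => // _ /(_ isT). Qed.

Lemma RLmin_ge i : RLmin s i -> z <= i.
Proof. by move=> /RLminP/(_ z); rewrite sz ltn0; case: ltnP => // _ /(_ isT). Qed.

Lemma LRmin_argmin : LRmin s z.
Proof. by apply/LRminP => j jz; rewrite sz argmin_lt// -val_eqE /=; lia. Qed.

Lemma RLmin_argmin : RLmin s z.
Proof. by apply/RLminP => j jz; rewrite sz argmin_lt// -val_eqE /=; lia. Qed.

Lemma LRminE i : LRmin s i = (lower s i && (i <= z)).
Proof.
apply/idP/andP => [h|[]]; first by split; [rewrite /lower h|exact: LRmin_le].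
move=> /orP[//|h iz]; have -> : i = z by apply/val_inj/eqP; rewrite eqn_leq iz RLmin_ge.
exact: LRmin_argmin.
Qed.

Lemma RLminE i : RLmin s i = (lower s i && (z <= i)).
Proof.
apply/idP/andP => [h|[]]; first by split; [rewrite /lower h orbT|exact: RLmin_ge].
move=> /orP[h iz|//]; have -> : i = z by apply/val_inj/eqP; rewrite eqn_leq iz LRmin_le.
exact: RLmin_argmin.
Qed.

(* Left-to-right minima lie weakly below s(0), maxima weakly above. *)
Lemma left_below_LRmin i : LRmin s i ->
  [set j | left_rec s j & s j <= s i] = [set j | lower s j & i <= j <= z].
Proof.
move=> hi; apply/setP => j; rewrite !inE; apply/andP/andP => -[].
  move=> hj ji; have ij : i <= j.
    by rewrite leqNgt; apply/negP; move/LRminP: hi => h /h; lia.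
  have hj' : LRmin s j.
    case/orP: hj => // /LRmaxP hj; have [->//|ne] := eqVneq j i.
    have i0 : i < j by rewrite ltn_neqAle ij andbT eq_sym; exact: ne.
    by have := hj i i0; lia.
  by move: hj'; rewrite LRminE => /andP[-> ->]; rewrite ij.
move=> lj /andP[ij jz]; have hj : LRmin s j by rewrite LRminE lj.
split; first by rewrite /left_rec hj.
have [->//|ne] := eqVneq i j; move/LRminP: hj => /(_ i) H; apply/ltnW/H.
by rewrite ltn_neqAle ij andbT; exact: ne.
Qed.

Lemma left_below_LRmax i : LRmax s i ->
  [set j | left_rec s j & s j <= s i] =
  [set j | LRmin s j || (LRmax s j && (j <= i))].
Proof.
move=> hi; apply/setP => j; rewrite !inE; apply/andP/orP => [[hj ji]|].
  case: (boolP (LRmin s j)) => [|hm]; first by left.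
  right; have hj' : LRmax s j by move: hj; rewrite /left_rec (negPf hm).
  rewrite hj' leqNgt; apply/negP; move/LRmaxP: hj' => h /h; lia.
have z0 : s j <= s ord0 -> s j <= s i.
  move=> h; apply: leq_trans h _; have [->//|ne] := eqVneq i ord0.
  by move/LRmaxP: hi => /(_ ord0) H; apply/ltnW/H; rewrite lt0n; exact: ne.
case=> [hj|/andP[hj ji]].
  split; first by rewrite /left_rec hj.
  apply: z0; have [->//|ne] := eqVneq j ord0.
  by move/LRminP: hj => /(_ ord0) H; apply/ltnW/H; rewrite lt0n; exact: ne.
split; first by rewrite /left_rec hj orbT.
have [->//|ne] := eqVneq i j; move/LRmaxP: hi => /(_ j) H; apply/ltnW/H.
by rewrite ltn_neqAle ji andbT eq_sym; exact: ne.
Qed.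

Hypothesis sq : square_perm s.

Lemma sqP i : is_record s i. Proof. exact: (forallP sq). Qed.

End Min.

Lemma card_le_inj (q : pred 'I_n.+1) (a b : 'I_n.+1) : q a -> q b ->
  #|[set v | q v & v <= a]| = #|[set v | q v & v <= b]| -> a = b.
Proof.
wlog ab : a b / a <= b => [H qa qb E|].
  by case/orP: (leq_total a b) => ?; [exact: H|symmetry; apply: H].
move=> qa qb E; have sab : [set v | q v & v <= a] \subset [set v | q v & v <= b].
  by apply/fintype.subsetP => v; rewrite !inE => /andP[-> /leq_trans]; exact.
have := elimT (subset_cardP E) sab b; rewrite !inE qb leqnn /= => ba.
by apply/val_inj/eqP; rewrite eqn_leq ab ba.
Qed.

Lemma card_perm_set s (q r : pred 'I_n.+1) :
  #|[set j | q (s j) & r (s j)]| = #|[set v | q v & r v]|.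
Proof.
rewrite -(card_imset _ (@perm_inj _ s)); apply: eq_card => v; rewrite inE.
apply/imsetP/idP => [[j + ->]|h]; first by rewrite inE.
by exists (s^-1 v)%g; rewrite ?inE permKV.
Qed.

(** The left values form the same set for [s] and [t], and a member of a set of values is determined
    by its rank; the rank can be counted on positions. *)
Lemma left_rank_inj s t i : lefts s = lefts t -> left_rec s i -> left_rec t i ->
  [set j | left_rec s j & s j <= s i] = [set j | left_rec t j & t j <= t i] ->
  s i = t i.
Proof.
move=> E li ti H; apply: (@card_le_inj (lefts s)); rewrite ?leftsE//.
  by rewrite E leftsE.
rewrite -(card_perm_set s (lefts s) (fun v : 'I_n.+1 => v <= s i)).
rewrite -(card_perm_set t (lefts s) (fun v : 'I_n.+1 => v <= t i)).
have -> : [set j | lefts s (s j) & s j <= s i] = [set j | left_rec s j & s j <= s i].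
  by apply/setP => j; rewrite !inE leftsE.
by rewrite H; apply: eq_card => j; rewrite !inE E leftsE.
Qed.

Section Inj.
Variables (s t : 'S_n.+1) (z : 'I_n.+1).
Hypotheses (sz : s z = 0 :> nat) (tz : t z = 0 :> nat).
Hypotheses (sqs : square_perm s) (sqt : square_perm t).
Hypotheses (EX : lowers s = lowers t) (EY : lefts s = lefts t).

Lemma lowerE i : lower s i = lower t i.
Proof. by have /ffunP/(_ i) := EX; rewrite !ffunE. Qed.

Lemma LRmin_eq i : LRmin s i = LRmin t i.
Proof. by rewrite (LRminE sz) (LRminE tz) lowerE. Qed.

Lemma RLmin_eq i : RLmin s i = RLmin t i.
Proof. by rewrite (RLminE sz) (RLminE tz) lowerE. Qed.

(** Both permutations have used the same values before [i], so the value of [t'] at [i] is still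
    free for [s'], and a right-to-left minimum takes the smallest free value. *)
Lemma unused_min s' t' i : RLmin s' i -> (forall j, j < i -> s' j = t' j) ->
  s' i <= t' i.
Proof.
move=> hs IH; pose w := (s'^-1 (t' i))%g; have sw : s' w = t' i by rewrite permKV.
case: (ltngtP w i) => [wi|iw|/val_inj wi].
- by have := IH w wi; rewrite sw => /perm_inj E; rewrite E ltnn in wi.
- by move/RLminP: hs => /(_ w iw); rewrite sw; lia.
- by rewrite -sw wi.
Qed.

Lemma unused_max s' t' i : RLmax s' i -> (forall j, j < i -> s' j = t' j) ->
  t' i <= s' i.
Proof.
move=> hs IH; pose w := (s'^-1 (t' i))%g; have sw : s' w = t' i by rewrite permKV.
case: (ltngtP w i) => [wi|iw|/val_inj wi].
- by have := IH w wi; rewrite sw => /perm_inj E; rewrite E ltnn in wi.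
- by move/RLmaxP: hs => /(_ w iw); rewrite sw; lia.
- by rewrite -sw wi.
Qed.

(** The labels do not say at once whether an upper record is a left one. If it were only a
    right-to-left maximum of [t'], its value would be the largest free one, hence at least that of
    [s'], hence above the common past: a left-to-right maximum after all. *)
Lemma LRmax_past s' t' i : (forall j, j < i -> s' j = t' j) ->
  square_perm t' -> LRmax s' i -> ~~ lower t' i -> LRmax t' i.
Proof.
move=> IH sqt' hs hl; apply: contraT => ht; rewrite -(negPf ht).
have hr : RLmax t' i.
  move: (sqP sqt' i); rewrite is_recordE (negPf ht) /=.
  by move: hl; rewrite /lower negb_or => /andP[/negPf-> /negPf->]; rewrite orbF.
have ti : s' i <= t' i by apply: unused_max => // j /IH.
by apply/LRmaxP => j ji; rewrite -IH//; move/LRmaxP: hs => /(_ j ji); lia.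
Qed.

(* At the first position where s and t could differ, a right-to-left record
   takes the extreme value not used before it in both permutations, and a
   left-to-right record is determined by its rank among the left values. *)
Theorem square_code_inj : s = t.
Proof.
suff H m : forall i, i < m -> s i = t i by apply/permP => i; apply: (H n.+1).
elim: m => [//|m IH] i; rewrite ltnS leq_eqVlt => /orP[/eqP im|]; last exact: IH.
have {}IH j : j < i -> s j = t j by rewrite im; exact: IH.
have [li|li] := boolP (lower s i).
  case/orP: (li) => h.
    have h' : LRmin t i by rewrite -LRmin_eq.
    apply: left_rank_inj => //; rewrite ?/left_rec ?h ?h' //.
    rewrite (left_below_LRmin sz)// (left_below_LRmin tz)//.
    by apply/setP => j; rewrite !inE lowerE.
  have h' : RLmin t i by rewrite -RLmin_eq.
  by apply/val_inj/eqP; rewrite eqn_leq !unused_min// => k /IH.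
have li' : ~~ lower t i by rewrite -lowerE.
have E j : j <= i -> LRmax s j = LRmax t j.
  rewrite leq_eqVlt => /orP[/eqP/val_inj->|ji].
    apply/idP/idP => h; first by apply: (LRmax_past IH sqt h); rewrite -lowerE.
    by apply: (LRmax_past _ sqs h); rewrite // => k /IH.
  by apply/idP/idP => /LRmaxP h; apply/LRmaxP => k kj; have := h k kj;
    rewrite !IH//; lia.
have [h|h] := boolP (LRmax s i).
  have h' : LRmax t i by rewrite -E.
  apply: left_rank_inj => //; rewrite ?/left_rec ?h ?h' ?orbT //.
  rewrite (left_below_LRmax sz h) (left_below_LRmax tz h').
  apply/setP => j; rewrite !inE LRmin_eq; case: (leqP j i) => [/E->//|_].
  by rewrite !andbF.
have h' : ~~ LRmax t i by rewrite -E.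
have RL u : square_perm u -> ~~ lower u i -> ~~ LRmax u i -> RLmax u i.
  move=> sq l m'; move: (sqP sq i); rewrite is_recordE (negPf m') /=.
  by move: l; rewrite /lower negb_or => /andP[/negPf-> /negPf->]; rewrite orbF.
by apply/val_inj/eqP; rewrite eqn_leq !unused_max ?RL// => k /IH.
Qed.
End Inj.

End Records.

(** * The rebuilt permutation: squareness, labels and local order *)

Definition bits n (X : {ffun 'I_n.+1 -> bool}) : pred nat := fun i => X (inord i).

Section RebuildPerm.
Variables (n : nat) (X Y : {ffun 'I_n.+1 -> bool}) (z : 'I_n.+1) (e : nat).
Let x := bits X.
Let y := bits Y.
Hypothesis tc : typical_code x y z n.+1 e.
Let e_gt0 := tc_e tc.
Let bx := tc_x tc.
Let ze := tc_z tc.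
Let zNe := tc_zN tc.

Let xE (i : 'I_n.+1) : x i = X i. Proof. by rewrite /x /bits inord_val. Qed.
Let yE (i : 'I_n.+1) : y i = Y i. Proof. by rewrite /y /bits inord_val. Qed.

Local Notation rb := (rebuild x y z n.+1).
Local Notation UL := (is_LRmax x y z n.+1).
Local Notation UR := (is_RLmax x y z n.+1).

Let f (i : 'I_n.+1) : 'I_n.+1 := inord (rb i).

Let fE i : f i = rb i :> nat.
Proof. by rewrite inordK//; apply: (rebuild_ltN tc). Qed.

Let f_inj : injective f.
Proof.
move=> i j /(congr1 (@nat_of_ord _)); rewrite !fE => E; apply/val_inj.
by exact: (rebuild_inj tc _ _ E).
Qed.

Definition rebuilt : 'S_n.+1 := perm f_inj.
Local Notation s := rebuilt.

Lemma rebuiltE i : s i = rb i :> nat. Proof. by rewrite permE fE. Qed.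

Lemma rebuilt_argmin : s z = 0 :> nat.
Proof. by rewrite rebuiltE; apply: (rebuild_z tc). Qed.

(** Balance lets a count drift by at most e over the two endpoints, so an interval longer than 2 e
    contains both labels. *)
Lemma has_label (b : bool) i j : i + 2 * e < j -> j <= n.+1 ->
  exists a : 'I_n.+1, [/\ i <= a, a < j & X a = b].
Proof.
move=> ij jN; have [b1 b2] := bx jN; have iN : i <= n.+1 by lia.
have [b3 b4] := bx iN.
have /cnt_ex : i <= j by lia.
case: b => [/(_ x) | /(_ (predC x))].
  case=> [|a /andP[ia aj] xa]; first by lia.
  have aN : a < n.+1 by lia.
  by exists (Ordinal aN); split => //; rewrite -xE.
have := cntC x i; have := cntC x j => c1 c2.
case=> [|a /andP[ia aj] /negbTE xa]; first by lia.
have aN : a < n.+1 by lia.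
by exists (Ordinal aN); split => //; rewrite -xE.
Qed.

Lemma rebuilt_LRmin (i : 'I_n.+1) : X i -> i <= z -> LRmin s i.
Proof.
rewrite -xE => xi iz; apply/LRminP => j ji; rewrite !rebuiltE.
have [xj|xj] := boolP (x j); first by apply: (rebuild_lt_LRmin tc).
have /orP[h|h] := is_max y z n.+1 xj.
- exact: (rebuild_lt_LRmin_LRmax tc).
- by apply: (rebuild_lt_LRmin_RLmax tc) => //; lia.
Qed.

Lemma rebuilt_RLmin (i : 'I_n.+1) : X i -> z < i -> RLmin s i.
Proof.
rewrite -xE => xi iz; apply/RLminP => j ij; rewrite !rebuiltE.
have [xj|xj] := boolP (x j).
  by apply: (rebuild_lt_RLmin tc) => //; lia.
have /orP[h|h] := is_max y z n.+1 xj.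
- by apply: (rebuild_lt_RLmin_LRmax tc) => //; lia.
- exact: (rebuild_lt_RLmin_RLmax tc).
Qed.

Lemma rebuilt_LRmax (i : 'I_n.+1) : UL i -> LRmax s i.
Proof.
move=> hi; apply/LRmaxP => j ji; rewrite !rebuiltE.
have [xj|xj] := boolP (x j).
  case: (leqP j z) => jz; first exact: (rebuild_lt_LRmin_LRmax tc).
  by apply: (rebuild_lt_RLmin_LRmax tc) => //; lia.
apply: (rebuild_lt_LRmax tc) => //.
rewrite /is_LRmax xj /=; move/andP: hi => [_]; apply: leq_ltn_trans.
have /andP[_] := cnt_le x (ltnW ji); have := cntC x i; have := cntC x j; lia.
Qed.

Lemma rebuilt_RLmax (i : 'I_n.+1) : UR i -> RLmax s i.
Proof.
move=> hi; apply/RLmaxP => j ij; rewrite !rebuiltE.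
have [xj|xj] := boolP (x j).
  case: (leqP j z) => jz; last exact: (rebuild_lt_RLmin_RLmax tc).
  by apply: (rebuild_lt_LRmin_RLmax tc) => //; lia.
apply: (rebuild_lt_RLmax tc) => //.
rewrite /is_RLmax xj /=; move/andP: hi => [_] h; apply: leq_trans h _.
have /andP[_] := cnt_le x (ltnW ij); have := cntC x i; have := cntC x j; lia.
Qed.

Lemma rebuilt_square : square_perm s.
Proof.
apply/forallP => i; rewrite is_recordE; have [xi|xi] := boolP (X i).
  case: (leqP i z) => iz; first by rewrite rebuilt_LRmin ?orbT.
  by rewrite rebuilt_RLmin ?orbT.
rewrite -xE in xi; have /orP[h|h] := is_max y z n.+1 xi.
  by rewrite rebuilt_LRmax.
by rewrite rebuilt_RLmax ?orbT.
Qed.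

Lemma rebuilt_notLRmin (i : 'I_n.+1) : ~~ X i -> ~~ LRmin s i.
Proof.
move=> xi; apply/negP => h; have iz := LRmin_le rebuilt_argmin h.
move/LRminP: h => h.
have [a [ai ia xa]] : exists a : 'I_n.+1, [/\ a < i, i <= a + 10 * e & X a].
  case: (leqP i (2 * e)) => ie.
    (* Too close to the left end for [has_label]: the forced label at 0 supplies the smaller value
       to the left. *)
    exists ord0; split; [|by rewrite /=; lia|by rewrite -xE; exact: (tc_x0 tc)].
    by rewrite lt0n; apply: contra xi => /eqP i0; rewrite -xE i0; exact: (tc_x0 tc).
  have [|a [? ? ?]] := @has_label true (i - 2 * e - 1) i _ (ltnW (ltn_ord i)).
    by lia.
  by exists a; split => //; lia.
have := h a ai; rewrite !rebuiltE ltnNge ltnW //.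
rewrite -xE in xi; rewrite -xE in xa; have /orP[ui|ui] := is_max y z n.+1 xi.
  by apply: (rebuild_lt_LRmin_LRmax tc) => //; lia.
by apply: (rebuild_lt_LRmin_RLmax tc) => //; lia.
Qed.

Lemma rebuilt_notRLmin (i : 'I_n.+1) : ~~ X i -> ~~ RLmin s i.
Proof.
move=> xi; apply/negP => h; have iz := RLmin_ge rebuilt_argmin h.
move/RLminP: h => h.
(* The minimum is always a right-to-left minimum, so the case [i = z] is excluded only by the forced
   label at [z]. *)
have iz' : z < i.
  rewrite ltn_neqAle iz andbT; apply: contra xi => /eqP E.
  by rewrite -xE -E; exact: (tc_xz tc).
have [a [ai ia xa]] : exists a : 'I_n.+1, [/\ i < a, a <= i + 10 * e & X a].
  case: (leqP (n.+1) (i.+1 + 2 * e)) => ie.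
    exists ord_max; split => /=; [|by lia|by rewrite -xE; exact: (tc_xl tc)].
    rewrite ltn_neqAle -ltnS ltn_ord andbT; apply: contra xi => /eqP i0.
    by rewrite -xE i0; exact: (tc_xl tc).
  have [||a [? ? ?]] := @has_label true i.+1 (i.+2 + 2 * e); try lia.
  by exists a; split => //; lia.
have := h a ai; rewrite !rebuiltE ltnNge ltnW //.
rewrite -xE in xi; rewrite -xE in xa; have /orP[ui|ui] := is_max y z n.+1 xi.
  by apply: (rebuild_lt_RLmin_LRmax tc) => //; lia.
by apply: (rebuild_lt_RLmin_RLmax tc) => //; lia.
Qed.

Lemma rebuilt_lowers : lowers s = X.
Proof.
apply/ffunP => i; rewrite ffunE /lower; have [xi|xi] := boolP (X i).
  case: (leqP i z) => iz; first by rewrite rebuilt_LRmin.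
  by rewrite rebuilt_RLmin ?orbT.
by rewrite (negPf (rebuilt_notLRmin xi)) (negPf (rebuilt_notRLmin xi)).
Qed.

Lemma rebuilt_notLRmax_lower (i : 'I_n.+1) : X i -> z < i -> ~~ LRmax s i.
Proof.
move=> xi iz; apply/negP => /LRmaxP h.
have [|a [a1 a2 xa]] := @has_label false (i - 2 * e - 1) i _ (ltnW (ltn_ord i)).
  by lia.
have := h a a2; rewrite !rebuiltE ltnNge ltnW //.
have {}xa : ~~ x a by rewrite xE xa.
rewrite -xE in xi; have /orP[ui|ui] := is_max y z n.+1 xa.
  by apply: (rebuild_lt_RLmin_LRmax tc) => //; lia.
by apply: (rebuild_lt_RLmin_RLmax tc) => //; lia.
Qed.

Lemma rebuilt_notLRmax_upper (i : 'I_n.+1) : UR i -> ~~ LRmax s i.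
Proof.
move=> /andP[xi ri]; apply/negP => /LRmaxP h.
have [_] := rebuildP tc (ltn_ord i).
case=> [x1|x1|_ r1|_ r2 yi _ _ v1 v2]; rewrite ?x1 ?(negPf xi) // in xi *.
  by rewrite ltnNge ri in r1.
(* The largest value has a forced left label and is too high for the side of left-to-right minima,
   so [w] is among the first [up_left] upper positions. It therefore precedes [i], which cannot be a
   left-to-right maximum. *)
pose w := (s^-1 ord_max)%g; have sw : s w = ord_max by rewrite permKV.
have wi : w != i.
  apply: contraNneq yi => E; have := congr1 (@nat_of_ord _) sw.
  by rewrite E rebuiltE => -> /=; exact: (tc_yl tc).
have [yw wlt] : y (rb w) /\ i < w.
  rewrite -rebuiltE sw; split; first exact: (tc_yl tc).
  rewrite ltnNge leq_eqVlt; apply/negP => /orP[/eqP/val_inj E|wi'].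
    by rewrite E eqxx in wi.
  by have := h w wi'; rewrite sw /= ltnNge -ltnS ltn_ord.
have [_] := rebuildP tc (ltn_ord w).
have rw : rb w = n by rewrite -rebuiltE sw.
case=> [xw wz yw' cw v3 v4|xw zw /negP//|xw rw' _ _ v3 v4 v5|_ _ /negP//].
  by rewrite rw in v3 v4; lia.
have : i - cnt x i <= w - cnt x w.
  have /andP[_] := cnt_le x (ltnW wlt); have := cntC x i; have := cntC x w; lia.
by lia.
Qed.

Lemma rebuilt_lefts : lefts s = Y.
Proof.
apply/ffunP => v; rewrite -[v](permKV s); set i := (s^-1 v)%g.
rewrite leftsE -yE rebuiltE /left_rec.
have [_] := rebuildP tc (ltn_ord i).
case=> [xi iz yi _ _ _|xi zi yi _ _ _|xi ri yi _ _ _ _|xi ri yi _ _ _ _].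
- by rewrite yi rebuilt_LRmin // -xE.
- rewrite (negPf yi); apply/negbTE; rewrite negb_or rebuilt_notLRmax_lower -?xE// andbT.
  by apply/negP => /(LRmin_le rebuilt_argmin); lia.
- by rewrite yi rebuilt_LRmax ?orbT// /is_LRmax xi.
- rewrite (negPf yi); apply/negbTE.
  by rewrite negb_or rebuilt_notLRmin -?xE// rebuilt_notLRmax_upper// /is_RLmax xi.
Qed.

(** A window that avoids [z] has all its lower records of one type; one that is 5 e away from N - z
    has all its upper records of one type. [h <= 5 * e] keeps any two of its positions within the 10
    e required for opposite sides. *)
Lemma rebuilt_local_lt (i a b : 'I_n.+1) h : h <= 5 * e ->
  i <= a + h -> a <= i + h -> i <= b + h -> b <= i + h ->
  (i + h < z) || (z + h < i) ->
  (i + z + h + 5 * e < n.+1) || (n.+1 + h + 5 * e < i + z) ->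
  a < b ->
  (s a < s b) = match X a, X b with
                | true, false => true
                | false, true => false
                | true, true => z < i
                | false, false => i + z < n.+1
                end.
Proof.
move=> he ia ai ib bi hz hN ab; rewrite -!xE !rebuiltE.
(* The location estimates put left-to-right maxima at positions up to N - z + 4 e and right-to-left
   maxima from N - z - 4 e on, so the margin 5 e decides the type. *)
have UU c : i <= c + h -> c <= i + h -> c < n.+1 -> ~~ x c ->
  if i + z < n.+1 then UL c else UR c.
  move=> ic ci cN xc; have [_] := rebuildP tc cN.
  by case=> [x1|x1|_ r1 _ _ _ _ b1|_ r1 _ _ _ _ b1];
    rewrite ?x1 // in xc *; rewrite /is_LRmax /is_RLmax xc ?r1 ?[_ <= _]r1;
    case: ifP => // ?; lia.
have LU c d : i <= c + h -> c <= i + h -> i <= d + h -> d <= i + h ->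
   c < n.+1 -> d < n.+1 -> x c -> ~~ x d -> rb c < rb d.
  move=> ic ci id di cN dN xc xd; have /orP[ud|ud] := is_max y z n.+1 xd.
    case: (leqP c z) => cz; first exact: (rebuild_lt_LRmin_LRmax tc).
    by apply: (rebuild_lt_RLmin_LRmax tc) => //; lia.
  case: (leqP c z) => cz; last exact: (rebuild_lt_RLmin_RLmax tc).
  by apply: (rebuild_lt_LRmin_RLmax tc) => //; lia.
case xa : (x a); case xb : (x b).
- case: (ltnP z i) => zi; first by apply: (rebuild_lt_RLmin tc) => //; lia.
  apply/negbTE; rewrite -leqNgt ltnW//.
  by apply: (rebuild_lt_LRmin tc) => //; lia.
- by apply: LU => //; rewrite xb.
- by apply/negbTE; rewrite -leqNgt ltnW// LU// xa.
- have := UU a ia ai (ltn_ord a); have := UU b ib bi (ltn_ord b).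
  rewrite xa xb => /(_ isT) ub /(_ isT) ua; case: (ltnP (i + z) n.+1) ua ub => _ ua ub.
    exact: (rebuild_lt_LRmax tc).
  by apply/negbTE; rewrite -leqNgt ltnW//; apply: (rebuild_lt_RLmax tc).
Qed.

Lemma rebuilt_local (i a b : 'I_n.+1) h : h <= 5 * e ->
  i <= a + h -> a <= i + h -> i <= b + h -> b <= i + h ->
  (i + h < z) || (z + h < i) ->
  (i + z + h + 5 * e < n.+1) || (n.+1 + h + 5 * e < i + z) ->
  (s a <= s b) = match X a, X b with
                 | true, false => true
                 | false, true => false
                 | true, true => if z < i then a <= b else b <= a
                 | false, false => if i + z < n.+1 then a <= b else b <= a
                 end.
Proof.
move=> he ia ai ib bi hz hN; case: (ltngtP a b) => [ab|ba|/val_inj->].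
- rewrite leq_eqVlt (rebuilt_local_lt he _ _ _ _ hz hN ab)//.
  have -> : (s a == s b :> nat) = false.
    by apply/negbTE; apply: contraTneq ab => /val_inj/perm_inj->; rewrite ltnn.
  by case: (X a) (X b) => [] [] //=; case: ifP.
- rewrite leqNgt (rebuilt_local_lt he _ _ _ _ hz hN ba)//.
  by case: (X a) (X b) => [] [] //=; case: ifP.
- by rewrite leqnn; case: (X b); case: ifP.
Qed.

End RebuildPerm.

Import Order.TTheory GRing.Theory Num.Theory.
Local Open Scope ring_scope.

(** * Window statistics of uniform labels *)

Section Windows.
Variables (n h : nat).
Local Notation bitsT := {ffun 'I_n.+1 -> bool}.
Local Notation winT := {ffun 'I_(h.*2.+1) -> bool}.

(** The negation matches the limit object: its label + stands for the upper records, while [X] marks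
    the lower ones. *)
Definition win (X : bitsT) (i : nat) : winT := [ffun b : 'I_(h.*2.+1) => ~~ X (inord (i + b - h))].

Definition inside (i : nat) := (h <= i)%N && (i + h <= n)%N.

Definition flip_win (i : nat) (w : winT) (X : bitsT) : bitsT :=
  [ffun a : 'I_n.+1 => X a (+) ((i <= a + h)%N && (a <= i + h)%N && w (inord (a + h - i)))].

Lemma flip_winK i w : involutive (flip_win i w).
Proof. by move=> X; apply/ffunP => a; rewrite !ffunE -addbA addbb addbF. Qed.

Lemma win_flip i w X : inside i -> win (flip_win i w X) i = [ffun b : 'I_(h.*2.+1) => win X i b (+) w b].
Proof.
move=> /andP[hi ih]; apply/ffunP => b; rewrite !ffunE.
have bh := ltn_ord b; have iN : (i + b - h < n.+1)%N by lia.
rewrite inordK// (_ : (i <= _)%N = true); last by apply/idP; lia.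
rewrite (_ : (i + b - h <= _)%N = true); last by apply/idP; lia.
rewrite (_ : (i + b - h + h - i)%N = b); last by lia.
by rewrite inord_val /= addNb.
Qed.

Lemma win_flip_far i j w X : inside j -> (i + h.*2 < j)%N || (j + h.*2 < i)%N ->
  win (flip_win i w X) j = win X j.
Proof.
move=> /andP[hj jh] far; apply/ffunP => b; rewrite !ffunE.
have bh := ltn_ord b; have jN : (j + b - h < n.+1)%N by lia.
rewrite inordK// (_ : _ && _ = false) ?addbF//.
by apply/negbTE/negP => /andP[/andP[? ?] _]; lia.
Qed.

Variable R : realFieldType.
Implicit Types (g : winT -> R).

Lemma sum_flip g (v : winT) : \sum_(w : winT) g [ffun b : 'I_(h.*2.+1) => v b (+) w b] = \sum_(w : winT) g w.
Proof.
have K : involutive (fun w : winT => [ffun b : 'I_(h.*2.+1) => v b (+) w b]).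
  by move=> w; apply/ffunP => b; rewrite !ffunE addbA addbb.
by rewrite [RHS](reindex_inj (inv_inj K)).
Qed.

(* Flipping the labels of the window by a uniform mask leaves F unchanged and
   averages g to its mean. *)
Lemma sum_win_mul0 g (F : bitsT -> R) i : inside i -> \sum_(w : winT) g w = 0 ->
  (forall w X, F (flip_win i w X) = F X) ->
  \sum_X g (win X i) * F X = 0.
Proof.
move=> hi g0 FE; set S := LHS.
have SE (w : winT) : S = \sum_X g [ffun b : 'I_(h.*2.+1) => win X i b (+) w b] * F X.
  rewrite /S (reindex_inj (inv_inj (flip_winK i w))); apply: eq_bigr => X _.
  by rewrite FE win_flip.
have : S *+ #|{: winT}| = 0.
  rewrite -sumr_const; under eq_bigr => w _ do rewrite (SE w).
  rewrite exchange_big /= big1// => X _.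
  by rewrite -mulr_suml (eq_bigl xpredT)// sum_flip g0 mul0r.
move/eqP; rewrite -mulr_natr mulf_eq0 => /orP[/eqP//|].
by rewrite pnatr_eq0 -leqn0 leqNgt; case/negP; apply/card_gt0P; exists [ffun=> true].
Qed.

Lemma card_near (i : nat) :
  (#|[set j : 'I_n.+1 | (i <= j + h.*2)%N && (j <= i + h.*2)%N]| <= (4 * h).+1)%N.
Proof.
set A := [set _ | _]; pose f (j : 'I_n.+1) : 'I_((4 * h).+1) := inord (j + h.*2 - i).
rewrite -[leqRHS]card_ord -(card_in_imset (f := f) (D := A)) ?max_card//.
move=> j k; rewrite !inE => /andP[j1 j2] /andP[k1 k2] /(congr1 (@nat_of_ord _)).
by rewrite !inordK; [move=> E; apply/val_inj => /=; lia|lia|lia].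
Qed.

Definition win_sum (A : pred 'I_n.+1) g (X : bitsT) : R :=
  \sum_(i | A i) g (win X i).

(** Windows more than 2 h apart share no label, so their covariance vanishes and each window meets
    at most 4 h + 1 others. *)
Lemma win_sum_variance (A : pred 'I_n.+1) g : (forall i, A i -> inside i) ->
  \sum_(w : winT) g w = 0 -> (forall w, `|g w| <= 1) ->
  \sum_X win_sum A g X ^+ 2 <= (2 ^ n.+1)%:R * (n.+1)%:R * ((4 * h).+1)%:R.
Proof.
move=> Ain g0 g1.
under eq_bigr => X _ do rewrite expr2 /win_sum mulr_suml.
under eq_bigr => X _ do under eq_bigr => i _ do rewrite mulr_sumr.
rewrite exchange_big /=.
have -> : (2 ^ n.+1)%:R * (n.+1)%:R * ((4 * h).+1)%:R =
    \sum_(i : 'I_n.+1) (2 ^ n.+1)%:R * ((4 * h).+1)%:R :> R.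
  by rewrite sumr_const card_ord -[RHS]mulr_natr mulrAC.
rewrite big_mkcond ler_sum// => i _; case: ifP => [Ai|_]; last by rewrite mulr_ge0.
rewrite exchange_big /=.
apply: (@le_trans _ _ (\sum_(j in [set j : 'I_n.+1 | (i <= j + h.*2)%N && (j <= i + h.*2)%N])
    (2 ^ n.+1)%:R)); last first.
  by rewrite sumr_const -[leLHS]mulr_natr ler_wpM2l ?ler0n// ler_nat card_near.
rewrite big_mkcond [leRHS]big_mkcond ler_sum// => j _; rewrite inE.
case: ifP => [Aj|_]; last by case: ifP.
case: ifP => [_|/negbT far].
  apply: (@le_trans _ _ (\sum_(X : bitsT) 1)); last first.
    by rewrite sumr_const card_ffun card_bool card_ord.
  apply: ler_sum => X _; apply: le_trans (ler_norm _) _.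
  by rewrite normrM mulr_ile1.
rewrite sum_win_mul0//; first exact: Ain.
move=> w X; rewrite win_flip_far ?Ain//; move: far; lia.
Qed.

Lemma win_sum_chebyshev (A : pred 'I_n.+1) g t : (forall i, A i -> inside i) ->
  \sum_(w : winT) g w = 0 -> (forall w, `|g w| <= 1) -> 0 <= t ->
  #|[set X | t < `|win_sum A g X|]|%:R * t ^+ 2 <=
    (2 ^ n.+1)%:R * (n.+1)%:R * ((4 * h).+1)%:R.
Proof.
move=> Ain g0 g1 t0; apply: le_trans (win_sum_variance Ain g0 g1).
rewrite mulr_natl -sumr_const big_mkcond ler_sum// => X _; rewrite inE.
case: ifP => [tX|_]; last exact: sqr_ge0.
by rewrite -(real_normK (num_real (win_sum A g X))) lerXn2r ?nnegrE// ltW.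
Qed.

End Windows.

(** * Local patterns of square permutations *)

Section Code.
Variable h : nat.

(** A ball of the local distance encoded as finite tables: which offsets in [-h, h] exist, and how
    they compare. Tables realized by no rooted permutation are harmless, as their [cell_set] is
    empty. *)
Definition cell : finType :=
  ({ffun 'I_(h.*2.+1) -> bool} * {ffun 'I_(h.*2.+1) * 'I_(h.*2.+1) -> bool})%type.

Definition pos (a : 'I_(h.*2.+1)) : int := a%:Z - h%:Z.

Definition code (x : rperm) : cell :=
  ([ffun a => `[< rp_dom x (pos a) >]],
   [ffun ab => `[< rp_le x (pos ab.1) (pos ab.2) >]]).

Lemma posP (l : int) : - h%:Z <= l <= h%:Z -> exists a, l = pos a.
Proof.
move=> hl; have lN : (absz (l + h%:Z)%R < h.*2.+1)%N by lia.
by exists (Ordinal lN); rewrite /pos /=; lia.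
Qed.

Lemma pos_itv a : - h%:Z <= pos a <= h%:Z.
Proof. by rewrite /pos; have := ltn_ord a; lia. Qed.

Lemma code_eqP x y : code x = code y <->
  (forall a, - h%:Z <= a <= h%:Z -> rp_dom x a <-> rp_dom y a) /\
  (forall a b, - h%:Z <= a <= h%:Z -> - h%:Z <= b <= h%:Z ->
     rp_le x a b <-> rp_le y a b).
Proof.
split=> [[/ffunP Ed /ffunP El]|[Ed El]].
  split=> [_ /posP[a ->]|_ _ /posP[a ->] /posP[b ->]].
    by have := Ed a; rewrite !ffunE; exact: asbool_eq_equiv.
  by have := El (a, b); rewrite !ffunE; exact: asbool_eq_equiv.
congr (_, _); apply/ffunP => a; rewrite !ffunE; apply: asbool_equiv_eq.
  exact/Ed/pos_itv.
by apply: El; exact: pos_itv.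
Qed.

Lemma code_restrP x y : code x = code y <-> rp_restr h x = rp_restr h y.
Proof.
rewrite code_eqP; split=> [[Ed El]|E].
  apply: rperm_ext => [a|a b] /=.
    by split=> -[xa ha]; split => //; apply/Ed.
  split=> -[ab [xa ha] [xb hb]]; (split; [exact/El|split => //; exact/Ed|split => //; exact/Ed]).
split=> [a ha|a b ha hb].
  have := congr1 (fun u => rp_dom u a) E; rewrite /= => e.
  split=> xa.
    by have : rp_dom x a /\ - h%:Z <= a <= h%:Z by []; rewrite e => -[].
  by have : rp_dom y a /\ - h%:Z <= a <= h%:Z by []; rewrite -e => -[].
split=> xab; have [xa xb] := rp_le_dom xab.
  suff : rp_le (rp_restr h x) a b by rewrite E => -[].
  by split.
suff : rp_le (rp_restr h y) a b by rewrite -E => -[].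
by split.
Qed.

Lemma code_labelE j (L L' : int -> bool) :
  (forall l, - h%:Z <= l <= h%:Z -> L l = L' l) ->
  code (label_rperm j L) = code (label_rperm j L').
Proof.
by move=> E; apply/code_eqP; split => // a b ha hb /=; rewrite /label_le !E.
Qed.

Definition labels_of (w : {ffun 'I_(h.*2.+1) -> bool}) (l : int) : bool :=
  w (inord (absz (l + h%:Z))).

Lemma labels_ofE w a : labels_of w (pos a) = w a.
Proof.
by rewrite /labels_of /pos (_ : absz _ = a :> nat) ?inord_val//; lia.
Qed.

Definition label_code j w := code (label_rperm j (labels_of w)).

End Code.

Lemma code_mono h k x y : (k <= h)%N -> code h x = code h y -> code k x = code k y.
Proof.
move=> kh /code_eqP[Ed El]; apply/code_eqP; split=> [a ha|a b ha hb].
  by apply: Ed; lia.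
by apply: El; lia.
Qed.

(* The side of the rectangle above position i, numbered as the orders of
   [label_le]. *)
Definition region (N z i : nat) : nat :=
  if (i + z < N)%N then (if (z < i)%N then 1 else 2)
  else (if (z < i)%N then 3 else 4).

Lemma rooted_dom n (s : 'S_n.+1) (i : 'I_n.+1) (l : int) :
  rp_dom (rooted_perm s i) l <-> 0 <= l + i%:Z < n.+1%:Z.
Proof. by []. Qed.

Lemma code_rooted n (X Y : {ffun 'I_n.+1 -> bool}) (z : 'I_n.+1) e h
  (tc : typical_code (bits X) (bits Y) z n.+1 e) (i : 'I_n.+1) :
  (h <= 5 * e)%N -> inside n h i ->
  (i + h < z)%N || (z + h < i)%N ->
  (i + z + h + 5 * e < n.+1)%N || (n.+1 + h + 5 * e < i + z)%N ->
  code h (rooted_perm (rebuilt tc) i) = label_code (region n.+1 z i) (win h X i).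
Proof.
move=> he /andP[hi ih] iz iN; apply/code_eqP; split=> [a ha|a b ha hb].
  rewrite rooted_dom; split=> // _; lia.
have W (l : int) : - h%:Z <= l <= h%:Z -> exists c : 'I_n.+1,
    [/\ c%:Z = l + i%:Z, labels_of (win h X i) l = ~~ X c, (i <= c + h)%N & (c <= i + h)%N].
  move=> /posP[d ->].
  have dh := ltn_ord d; have cN : (i + d - h < n.+1)%N by lia.
  exists (Ordinal cN); rewrite labels_ofE ffunE; split; rewrite /pos /=; try lia.
  by congr (~~ X _); apply/val_inj; rewrite /= inordK.
have [c [cE cL c1 c2]] := W a ha; have [d [dE dL d1 d2]] := W b hb.
have -> : rp_le (rooted_perm (rebuilt tc) i) a b <-> (rebuilt tc c <= rebuilt tc d)%N.
  split=> [[u [v [uE vE]]]|le]; last by exists c, d.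
  have -> : u = c by apply/val_inj => /=; lia.
  by have -> : v = d by apply/val_inj => /=; lia.
rewrite /= (rebuilt_local tc he c1 c2 d1 d2 iz iN) /label_le cL dL /region.
have -> : (a <= b) = (c <= d)%N by lia.
have -> : (b <= a) = (d <= c)%N by lia.
by case: (X c) (X d) => [] []; case: (z < i)%N; case: (i + z < n.+1)%N; split.
Qed.

(** * Counting square permutations by the position of the minimum *)

Lemma card_forced (I : finType) (A : {set I}) :
  (#|[set X : {ffun I -> bool} | [forall i in A, X i]]| * 2 ^ #|A| = 2 ^ #|I|)%N.
Proof.
have -> : #|[set X : {ffun I -> bool} | [forall i in A, X i]]| =
          #|family (fun i => if i \in A then pred1 true else predT)|.
  apply: eq_card => X; rewrite inE; apply/forallP/familyP => H i.
    by have := H i; case: ifP => // _ /= Xi; rewrite inE Xi.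
  by have := H i; case: ifP => //= _; rewrite inE => /eqP ->.
rewrite card_family foldrE big_map big_enum /= -prod_nat_const -prod_nat_const.
rewrite [X in (_ * X)%N]big_mkcond -big_split; apply: eq_bigr => i _ /=.
by case: ifP => _; rewrite ?card1 // cardT enumT unlock.
Qed.

Section CountSq.
Variable n : nat.
Local Notation bitsT := {ffun 'I_n.+1 -> bool}.

(** The first position is a left-to-right minimum, the last a right-to-left minimum, and [z] is
    both. Among values, 0 sits at a left-to-right minimum and the largest one at a left-to-right
    maximum. These are 3 + 2 forced bits. *)
Definition forced_low (z : 'I_n.+1) : {set bitsT} :=
  [set X : bitsT | [forall i in [set ord0; ord_max; z], X i]].
Definition forced_left : {set bitsT} := [set X : bitsT | [forall i in [set ord0; ord_max], X i]].

Definition Sq_at (z : 'I_n.+1) : {set 'S_n.+1} := [set s in Sq n.+1 | s z == ord0].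

Lemma forced_lowP z (X : bitsT) :
  reflect [/\ X ord0, X ord_max & X z] (X \in forced_low z).
Proof.
rewrite inE; apply: (iffP forallP) => [H|[X0 Xm Xz] i].
  by split; [move/implyP: (H ord0)|move/implyP: (H ord_max)|move/implyP: (H z)];
    apply; rewrite !inE eqxx ?orbT.
by apply/implyP; rewrite !inE => /orP[/orP[]|] /eqP ->.
Qed.

Lemma forced_leftP (X : bitsT) : reflect (X ord0 /\ X ord_max) (X \in forced_left).
Proof.
rewrite inE; apply: (iffP forallP) => [H|[X0 Xm] i].
  by split; [move/implyP: (H ord0)|move/implyP: (H ord_max)];
    apply; rewrite !inE eqxx ?orbT.
by apply/implyP; rewrite !inE => /orP[] /eqP ->.
Qed.

Definition sq_code (s : 'S_n.+1) : bitsT * bitsT := (lowers s, lefts s).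

Lemma sq_code_inj z : {in Sq_at z &, injective sq_code}.
Proof.
move=> s t; rewrite !inE => /andP[sqs /eqP sz] /andP[sqt /eqP tz] [E1 E2].
by apply: (@square_code_inj n s t z) => //; rewrite ?sz ?tz.
Qed.

(** A crude bound that also covers z at the two ends, where some forced labels coincide; it provides
    the dominating constant later. *)
Lemma card_Sq_at_le z : (#|Sq_at z| <= 4 ^ n.+1)%N.
Proof.
rewrite -(card_in_imset (@sq_code_inj z)) (leq_trans (max_card _))//.
by rewrite card_prod card_ffun card_bool card_ord -expnMn.
Qed.

Lemma sq_code_forced z s : s \in Sq_at z ->
  sq_code s \in finset.setX (forced_low z) forced_left.
Proof.
rewrite !inE => /andP[sq /eqP sz]; have sz0 : s z = 0 :> nat by rewrite sz.
apply/andP; split.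
  have : lowers s \in forced_low z.
    apply/forced_lowP; rewrite !ffunE /lower; split.
    - by apply/orP; left; apply/LRminP => j; rewrite ltn0.
    - by apply/orP; right; apply/RLminP => j /= jn; have := ltn_ord j; lia.
    - by rewrite LRmin_argmin.
  by rewrite inE.
have : lefts s \in forced_left.
  apply/forced_leftP; rewrite !ffunE /left_rec; split.
    by rewrite (_ : (s^-1)%g _ = z) ?LRmin_argmin// -sz permK.
  apply/orP; right; apply/LRmaxP => j jm; rewrite permKV /=.
  rewrite ltn_neqAle -ltnS ltn_ord andbT; apply: contraTneq jm => jn.
  by rewrite -[X in (s^-1)%g X](_ : s j = _) ?permK ?ltnn//; apply/val_inj.
by rewrite inE.
Qed.

Lemma sum_Sq_at (R : nmodType) (F : 'S_n.+1 -> R) :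
  \sum_(s in Sq n.+1) F s = \sum_(z : 'I_n.+1) \sum_(s in Sq_at z) F s.
Proof.
rewrite (partition_big (fun s : 'S_n.+1 => (s^-1)%g ord0) predT)//=.
apply: eq_bigr => z _; apply: eq_bigl => s; rewrite !inE; congr (_ && _).
by apply/eqP/eqP => [<-|<-]; rewrite ?permKV ?permK.
Qed.

Lemma card_forced_low (z : 'I_n.+1) : (0 < z < n)%N ->
  (#|forced_low z| * 8 = 2 ^ n.+1)%N.
Proof.
move=> /andP[z0 zn]; have := card_forced [set ord0; ord_max; z].
rewrite card_ord (_ : #|[set ord0; ord_max; z]| = 3)//.
have n0 : ord0 != ord_max :> 'I_n.+1 by rewrite -val_eqE /=; lia.
have zm : ord_max != z by rewrite -val_eqE /=; lia.
have z0' : ord0 != z by rewrite -val_eqE /=; lia.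
by rewrite finset.setUC cardsU1 !inE cards2 n0 negb_or eq_sym z0' eq_sym zm.
Qed.

Lemma card_forced_left : (0 < n)%N -> (#|forced_left| * 4 = 2 ^ n.+1)%N.
Proof.
move=> n0; have := card_forced [set (ord0 : 'I_n.+1); ord_max].
by rewrite card_ord cards2 (_ : ord0 != _)// -val_eqE /=; lia.
Qed.

Lemma card_Sq_at (z : 'I_n.+1) : (0 < z < n)%N -> (#|Sq_at z| * 32 <= 4 ^ n.+1)%N.
Proof.
move=> zn; rewrite -(card_in_imset (@sq_code_inj z)).
rewrite (_ : 4 ^ n.+1 = #|finset.setX (forced_low z) forced_left| * 32)%N; last first.
  have n0 : (0 < n)%N by lia.
  have E : (4 ^ n.+1 = 2 ^ n.+1 * 2 ^ n.+1)%N by rewrite -expnMn.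
  rewrite cardsX E -{1}(card_forced_low zn) -(card_forced_left n0).
  by rewrite mulnACA.
rewrite leq_mul2r /=; apply/subset_leq_card/fintype.subsetP => _ /imsetP[s /sq_code_forced + ->].
by [].
Qed.

Lemma card_typical_le (G : {set bitsT * bitsT}) (S : {set 'S_n.+1}) :
  (forall XY, XY \in G -> exists2 s, s \in S & sq_code s = XY) -> (#|G| <= #|S|)%N.
Proof.
move=> H; apply: leq_trans (leq_imset_card sq_code S); apply/subset_leq_card.
by apply/fintype.subsetP => XY /H[s sS <-]; apply/imsetP; exists s.
Qed.

End CountSq.

(** * Balanced label sequences *)

Section Balanced.
Variable R : realFieldType.
Variables (n : nat).
Local Notation bitsT := {ffun 'I_n.+1 -> bool}.

(** A window of width 1 read as a sign: since windows hold negated labels, a lower record counts +1,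
    and sums over prefixes are the deviations 2 cnt - m. *)
Definition sgn_win (w : {ffun 'I_((0).*2.+1) -> bool}) : R := if w ord0 then -1 else 1.

Lemma sgn_win_sum (X : bitsT) m : (m <= n.+1)%N ->
  win_sum (fun i : 'I_n.+1 => i < m)%N sgn_win X = (cnt (bits X) m)%:R *+ 2 - m%:R.
Proof.
move=> mn; rewrite /win_sum.
rewrite (eq_bigr (fun i : 'I_n.+1 => (if bits X i then 1 else -1) : R)); last first.
  move=> i _; rewrite /sgn_win /win ffunE addn0 subn0 /bits.
  by case: (X _).
rewrite -(big_ord_widen _ (fun i => (if bits X i then 1 else -1) : R))//.
elim: m mn => [|m IH] mn; first by rewrite big_ord0 cnt0 mul0rn subrr.
rewrite big_ord_recr /= IH ?(ltnW mn)// cntS natrD -[in RHS]natr1.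
by case: (bits X m) => /=; rewrite ?mulr2n; ring.
Qed.

(** Between consecutive multiples of q the deviation moves by less than q, so r + 1 checks control
    every prefix and replace a maximal inequality. *)
Lemma balanced_grid (X : bitsT) (q r : nat) : (n.+1 < q * r.+1)%N ->
  (forall t : 'I_r.+1, `|win_sum (fun i : 'I_n.+1 => i < t * q)%N sgn_win X| <= q%:R) ->
  balanced (2 * q) (bits X) n.+1.
Proof.
move=> nq H m mn.
have q0 : (0 < q)%N by lia.
have tr : (m %/ q < r.+1)%N by rewrite ltn_divLR//; lia.
have tm : (m %/ q * q <= m)%N by exact: leq_divM.
have mt : (m < m %/ q * q + q)%N by rewrite -mulSnr -ltn_divLR.
have := H (Ordinal tr); rewrite /= sgn_win_sum; last exact: leq_trans tm mn.
have /andP[] := cnt_le (bits X) tm.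
move: (cnt (bits X) m) (cnt (bits X) _) tm mt => a b; set c := (m %/ q * q)%N.
move=> cm mc ba ab; rewrite ler_norml => /andP[h1 h2].
have h3 : (c <= b * 2 + q)%N.
  by rewrite -(ler_nat R) natrD natrM; move: h1; lra.
have h4 : (b * 2 <= c + q)%N.
  by rewrite -(ler_nat R) natrD natrM; move: h2; lra.
by split; lia.
Qed.

End Balanced.

Lemma card_ord_itv N a b :
  (#|[set i : 'I_N | (a <= i) && (i < b)]%SET| = minn b N - a)%N.
Proof.
rewrite -sum1_card (eq_bigl (fun i : 'I_N => (a <= i) && (i < b)))%N; last by move=> i; rewrite inE.
rewrite big_mkcond /=; elim: N => [|N IH]; first by rewrite big_ord0; lia.
by rewrite big_ord_recr /= IH; case: ifP; lia.
Qed.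

Lemma card_exists_le (R : numDomainType) (T I : finType) (b : I -> pred T) (c : R) :
  (forall i, #|[set X | b i X]%SET|%:R <= c) ->
  #|[set X | [exists i, b i X]]%SET|%:R <= #|I|%:R * c.
Proof.
move=> H; apply: (@le_trans _ _ (\sum_(i : I) #|[set X | b i X]%SET|%:R)); last first.
  by rewrite mulr_natl -sumr_const ler_sum.
rewrite -natr_sum ler_nat; under [leqRHS]eq_bigr => i _ do rewrite -sum1_card big_mkcond /=.
rewrite -sum1_card big_mkcond exchange_big /= leq_sum// => X _; rewrite inE.
case: ifP => // /existsP[i bi]; rewrite (bigD1 i)//= inE bi.
by rewrite addSn.
Qed.

(** * Limiting frequencies of local patterns *)

Section Limit.
Variable R : realType.

(** The length of the projection of side [j] to the position axis when the minimum is at u,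
    everything rescaled by N. *)
Definition arm_weight (j : nat) (u : R) : R :=
  match j with
  | 1 => Num.max (1 - 2 * u) 0
  | 2 | 3 => Num.min u (1 - u)
  | _ => Num.max (2 * u - 1) 0
  end.

Definition cell_prob h (j : nat) (c : cell h) : R :=
  #|[set w | label_code j w == c]%SET|%:R / (2 ^ h.*2.+1)%:R.

Definition cell_limit h (u : R) (c : cell h) : R :=
  \sum_(j < 4) arm_weight j.+1 u * cell_prob j.+1 c.

Definition cell_freq h n (s : 'S_n.+1) (c : cell h) : R :=
  #|[set i | code h (rooted_perm s i) == c]%SET|%:R / n.+1%:R.

Definition cell_dev h j (c : cell h) (w : {ffun 'I_(h.*2.+1) -> bool}) : R :=
  (label_code j w == c)%:R - cell_prob j c.

Lemma pow2_gt0 k : 0 < (2 ^ k)%:R :> R.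
Proof. by rewrite ltr0n expn_gt0. Qed.

Lemma cell_prob_ge0 h j (c : cell h) : 0 <= cell_prob j c.
Proof. by rewrite divr_ge0. Qed.

Lemma cell_prob_le1 h j (c : cell h) : cell_prob j c <= 1.
Proof.
rewrite ler_pdivrMr ?pow2_gt0// mul1r ler_nat (leq_trans (max_card _))//.
by rewrite card_ffun card_bool card_ord.
Qed.

Lemma sum_cell_dev h j (c : cell h) : \sum_w cell_dev j c w = 0.
Proof.
rewrite sumrB sumr_const card_ffun card_bool card_ord -[X in _ - X]mulr_natr.
rewrite /cell_prob divfK ?gt_eqF ?pow2_gt0// -natr_sum -sum1_card.
apply/eqP; rewrite subr_eq0 eqr_nat [eqbRHS]big_mkcond /=; apply/eqP.
by apply: eq_bigr => w _; rewrite inE; case: eqP.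
Qed.

Lemma cell_dev_le1 h j (c : cell h) w : `|cell_dev j c w| <= 1.
Proof.
have := cell_prob_ge0 j c; have := cell_prob_le1 j c; rewrite /cell_dev ler_norml.
by case: eqP => _ /=; lra.
Qed.

Definition arm n h (z : nat) (j : nat) (i : 'I_n.+1) : bool :=
  inside n h i && (region n.+1 z i == j).

(** Trimming windows that leave the range costs at most 2 h, and rounding N u to z moves each end of
    the interval by a bounded amount. *)
Lemma card_arm n h z (j : 'I_4) (u : R) : (z <= n)%N ->
  z%:R <= n.+1%:R * u -> n.+1%:R * u < z.+1%:R ->
  `| #|[set i : 'I_n.+1 | arm h z j.+1 i]%SET|%:R - n.+1%:R * arm_weight j.+1 u| <= (2 * h + 4)%:R.
Proof.
move=> zn zu uz.
have E lo hi : (forall i : 'I_n.+1, (region n.+1 z i == j.+1) = (lo <= i) && (i < hi))%N ->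
    (#|[set i : 'I_n.+1 | arm h z j.+1 i]%SET| = minn hi (n.+1 - h) - maxn lo h)%N.
  move=> H; rewrite (_ : [set i | _]%SET =
    [set i : 'I_n.+1 | (maxn lo h <= i) && (i < minn hi (n.+1 - h))]%SET)%N ?card_ord_itv; first by lia.
  by apply/setP => i; rewrite !inE /arm H /inside; have := ltn_ord i; lia.
have regE i k : (region n.+1 z i == k) =
   ((i + z < n.+1)%N && (((z < i)%N && (k == 1)) || ((i <= z)%N && (k == 2)))
   || (n.+1 <= i + z)%N && (((z < i)%N && (k == 3)) || ((i <= z)%N && (k == 4))))%N.
  by rewrite /region; case: ltnP => _; case: ltnP => _ /=; rewrite ?orbF ?andbF // eq_sym.
have n0 : (0 : R) <= n.+1%:R by [].
have hh : (2 * h + 4)%:R = 2 * h%:R + 4 :> R by rewrite natrD natrM.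
rewrite hh; have h0 : (0 : R) <= h%:R by [].
have zz : z.+1%:R = z%:R + 1 :> R by rewrite natr1.
rewrite zz in uz.
have fin (c : nat) (w : R) : (c%:R <= w + 2) -> (w <= c%:R + 2 * h%:R + 2) ->
    `|c%:R - w| <= 2 * h%:R + 4 by rewrite ler_norml; lra.
set c := #|_|; case: j @c E => -[|[|[|[|//]]]] j4 c E; rewrite /=.
- have {}E : (c = minn (n.+1 - z) (n.+1 - h) - maxn z.+1 h)%N.
    by apply: E => i; rewrite regE /=; lia.
  rewrite maxr_pMr// mulr0 mulrBr mulr1 mulrCA; apply: fin.
    have : (c + 2 * z <= n.+1)%N || (c == 0)%N by lia.
    rewrite -(ler_nat R) natrD natrM -(eqr_nat R) => /orP[H|/eqP ->].
      have : n.+1%:R - 2 * (n.+1%:R * u) <= Num.max (n.+1%:R - 2 * (n.+1%:R * u)) 0.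
        by rewrite le_max lexx.
      lra.
    have : 0 <= Num.max (n.+1%:R - 2 * (n.+1%:R * u)) 0 by rewrite le_max lexx orbT.
    lra.
  have : (n.+1 <= c + 2 * z + 2 * h + 1)%N by lia.
  rewrite -(ler_nat R) !natrD => H.
  by rewrite ge_max; apply/andP; split; [lra|rewrite !addr_ge0 ?mulr_ge0].
- have {}E : (c = minn (minn z.+1 (n.+1 - z)) (n.+1 - h) - maxn 0 h)%N.
    by apply: E => i; rewrite regE /=; lia.
  rewrite minr_pMr// mulrBr mulr1; apply: fin.
    have : (c <= z.+1)%N && (c + z <= n.+1)%N by lia.
    rewrite -!(ler_nat R) natrD zz => /andP[H1 H2].
    by rewrite -lerBlDr le_min; apply/andP; split; lra.
  have : (z.+1 <= c + 2 * h)%N || (n.+1 <= c + z + 2 * h)%N by lia.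
  rewrite -!(ler_nat R) !natrD zz ge_min => /orP[H|H]; apply/orP; [left|right]; lra.
- have {}E : (c = minn n.+1 (n.+1 - h) - maxn (maxn z.+1 (n.+1 - z)) h)%N.
    by apply: E => i; rewrite regE /=; have := ltn_ord i; lia.
  rewrite minr_pMr// mulrBr mulr1; apply: fin.
    have : (c <= z)%N && (c + z <= n.+1)%N by lia.
    rewrite -!(ler_nat R) natrD => /andP[H1 H2].
    by rewrite -lerBlDr le_min; apply/andP; split; lra.
  have : (z.+1 <= c + 2 * h + 1)%N || (n.+1 <= c + z + 2 * h + 1)%N by lia.
  rewrite -!(ler_nat R) !natrD zz ge_min => /orP[H|H]; apply/orP; [left|right]; lra.
- have {}E : (c = minn z.+1 (n.+1 - h) - maxn (n.+1 - z) h)%N.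
    by apply: E => i; rewrite regE /=; lia.
  rewrite maxr_pMr// mulr0 mulrBr mulr1 mulrCA; apply: fin.
    have : (c + n.+1 <= 2 * z + 1)%N || (c == 0)%N by lia.
    rewrite -(ler_nat R) !natrD -(eqr_nat R) => /orP[H|/eqP ->].
      have : 2 * (n.+1%:R * u) - n.+1%:R <= Num.max (2 * (n.+1%:R * u) - n.+1%:R) 0.
        by rewrite le_max lexx.
      lra.
    have : 0 <= Num.max (2 * (n.+1%:R * u) - n.+1%:R) 0 by rewrite le_max lexx orbT.
    lra.
  have : (2 * z + 1 <= c + n.+1 + 2 * h)%N by lia.
  rewrite -(ler_nat R) !natrD => H.
  by rewrite ge_max; apply/andP; split; [lra|rewrite !addr_ge0 ?mulr_ge0].
Qed.

End Limit.

Import numFieldNormedType.Exports.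
Local Open Scope classical_set_scope.
Local Open Scope ring_scope.

(** * Almost all label pairs give the expected frequencies *)

Section Typical.
Variable R : realType.

Lemma card_setU_le (T : finType) (A B : {set T}) a b :
  (#|A| <= a -> #|B| <= b -> #|A :|: B| <= a + b)%N.
Proof. by move=> Aa Bb; rewrite (leq_trans (leq_card_setU A B))// leq_add. Qed.

Definition atypical n h (z e i : nat) : bool :=
  ~~ [&& inside n h i, (i + h < z)%N || (z + h < i)%N &
     (i + z + h + 5 * e < n.+1)%N || (n.+1 + h + 5 * e < i + z)%N].

Lemma card_atypical n h z e :
  (#|[set i : 'I_n.+1 | atypical n h z e i]%SET| <= 6 * h + 10 * e + 2)%N.
Proof.
pose I a b := [set i : 'I_n.+1 | (a <= i)%N && (i < b)%N]%SET.
(* The four bands are the two ends of the range and the neighbourhoods of the corners at z and N -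
   z. *)
apply: (@leq_trans (#|I 0 h :|: I (n.+1 - h) n.+1 :|: I (z - h) (z + h).+1
   :|: I (n.+1 - z - h - 5 * e) (n.+1 - z + h + 5 * e).+1|)%N).
  apply/subset_leq_card/fintype.subsetP => i; rewrite !inE /atypical /inside.
  by have := ltn_ord i; lia.
have c0 : (#|I 0 h| <= h)%N by rewrite card_ord_itv; lia.
have c1 : (#|I (n.+1 - h) n.+1| <= h)%N by rewrite card_ord_itv; lia.
have c2 : (#|I (z - h) (z + h).+1| <= 2 * h + 1)%N by rewrite card_ord_itv; lia.
have c3 : (#|I (n.+1 - z - h - 5 * e) (n.+1 - z + h + 5 * e).+1| <=
    2 * h + 10 * e + 1)%N by rewrite card_ord_itv; lia.
by apply: leq_trans (card_setU_le (card_setU_le (card_setU_le c0 c1) c2) c3) _; lia.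
Qed.

Lemma sum_arms n h z (F : nat -> 'I_n.+1 -> R) :
  \sum_(i : 'I_n.+1 | inside n h i) F (region n.+1 z i) i =
  \sum_(j < 4) \sum_(i : 'I_n.+1 | arm h z j.+1 i) F j.+1 i.
Proof.
rewrite (partition_big (fun i : 'I_n.+1 => inord (region n.+1 z i).-1 : 'I_4) predT)//=.
apply: eq_bigr => j _; rewrite (eq_bigl (arm h z j.+1)).
  by apply: eq_bigr => i /andP[_ /eqP ->].
move=> i; rewrite /arm; congr (_ && _); rewrite -val_eqE /=.
by rewrite /region; case: ifP => _; case: ifP => _ /=; rewrite inordK.
Qed.

Section Deterministic.
Variables (n h : nat) (X Y : {ffun 'I_n.+1 -> bool}) (z : 'I_n.+1) (e : nat).
Hypothesis tc : typical_code (bits X) (bits Y) z n.+1 e.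
Hypothesis he : (h <= 5 * e)%N.
Variables (c : cell h) (t : R).
Hypothesis devX : forall j : 'I_4,
  `|win_sum (arm h z j.+1) (@cell_dev R h j.+1 c) X| <= t.

Lemma cell_freq_arms :
  `|n.+1%:R * cell_freq R (rebuilt tc) c -
    \sum_(j < 4) #|[set i : 'I_n.+1 | arm h z j.+1 i]%SET|%:R * cell_prob R j.+1 c|
  <= (6 * h + 10 * e + 2)%:R + 4 * t.
Proof.
pose lc (i : 'I_n.+1) : R := (label_code (region n.+1 z i) (win h X i) == c)%:R.
have E1 : n.+1%:R * cell_freq R (rebuilt tc) c =
    \sum_(i : 'I_n.+1) (code h (rooted_perm (rebuilt tc) i) == c)%:R.
  rewrite mulrC divfK ?pnatr_eq0// -natr_sum -sum1_card big_mkcond /=; congr (_%:R).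
  by apply: eq_bigr => i _; rewrite inE; case: eqP.
have E2 : \sum_(i : 'I_n.+1 | inside n h i) lc i =
    \sum_(j < 4) win_sum (arm h z j.+1) (@cell_dev R h j.+1 c) X +
    \sum_(j < 4) #|[set i : 'I_n.+1 | arm h z j.+1 i]%SET|%:R * cell_prob R j.+1 c.
  rewrite (sum_arms h z (fun k i => (label_code k (win h X i) == c)%:R)) -big_split /=.
  apply: eq_bigr => j _; rewrite /win_sum /cell_dev sumrB sumr_const.
  rewrite -[X in _ - X + _]mulr_natl (_ : #|_| = #|[set i : 'I_n.+1 | arm h z j.+1 i]%SET|).
    by rewrite subrK.
  by apply: eq_card => i; rewrite inE.
have E3 : `|\sum_(i : 'I_n.+1) (code h (rooted_perm (rebuilt tc) i) == c)%:R
    - \sum_(i : 'I_n.+1 | inside n h i) lc i| <= (6 * h + 10 * e + 2)%:R.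
  apply: (@le_trans _ _ (#|[set i : 'I_n.+1 | atypical n h z e i]%SET|%:R)); last first.
    by rewrite ler_nat card_atypical.
  rewrite [in X in _ - X]big_mkcond -sumrB -sum1_card natr_sum [leRHS]big_mkcond.
  apply: le_trans (ler_norm_sum _ _ _) _; apply: ler_sum => i _; rewrite inE.
  have [a|/negPn/and3P[i1 i2 i3]] := boolP (atypical n h z e i); last first.
    by rewrite i1 /lc code_rooted// subrr normr0.
  rewrite ler_norml /lc; move: (_ == c) (inside n h i) (_ == c) => [] [] [] /=; lra.
have E4 : `|\sum_(j < 4) win_sum (arm h z j.+1) (@cell_dev R h j.+1 c) X| <= 4 * t.
  apply: le_trans (ler_norm_sum _ _ _) _.
  apply: le_trans (ler_sum _ (fun j _ => devX j)) _.
  by rewrite sumr_const card_ord mulr_natl.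
rewrite E1; move: E3; rewrite E2; move: E4.
set a := \sum_(j < 4) win_sum _ _ _; set b := \sum_(j < 4) _; set d := \sum_i _.
move=> E4 E3; rewrite (_ : d - b = (d - (a + b)) + a); last by ring.
by apply: le_trans (ler_normD _ _) _; exact: lerD.
Qed.

Lemma cell_freq_limit (u : R) : z%:R <= n.+1%:R * u -> n.+1%:R * u < z.+1%:R ->
  `|n.+1%:R * (cell_freq R (rebuilt tc) c - cell_limit u c)|
  <= (6 * h + 10 * e + 2)%:R + 4 * t + 4 * (2 * h + 4)%:R.
Proof.
move=> zu uz; rewrite mulrBr.
set b := \sum_(j < 4) #|[set i : 'I_n.+1 | arm h z j.+1 i]%SET|%:R * cell_prob R j.+1 c.
rewrite (_ : _ - _ = (n.+1%:R * cell_freq R (rebuilt tc) c - b) +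
   (b - n.+1%:R * cell_limit u c)); last by ring.
apply: le_trans (ler_normD _ _) _; apply: lerD; first exact: cell_freq_arms.
rewrite /b /cell_limit mulr_sumr -sumrB; apply: le_trans (ler_norm_sum _ _ _) _.
rewrite (_ : 4 * _ = \sum_(j < 4) (2 * h + 4)%:R); last first.
  by rewrite sumr_const card_ord -[RHS]mulr_natl.
apply: ler_sum => j _; rewrite mulrA -mulrBl normrM (ger0_norm (cell_prob_ge0 _ _ _)).
rewrite -[leRHS]mulr1 ler_pM//; first exact: cell_prob_ge0.
  by rewrite card_arm// -ltnS.
exact: cell_prob_le1.
Qed.

End Deterministic.

Lemma card_deviation n h (A : pred 'I_n.+1) (g : {ffun 'I_(h.*2.+1) -> bool} -> R) (tau t : R) :
  (forall i, A i -> inside n h i) -> \sum_w g w = 0 -> (forall w, `|g w| <= 1) ->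
  0 < tau -> tau * n.+1%:R <= t ->
  #|[set X | t < `|win_sum A g X|]%SET|%:R <=
    (2 ^ n.+1)%:R * ((4 * h).+1%:R / tau ^+ 2 / n.+1%:R).
Proof.
move=> Ain g0 g1 tau0 tt; have N0 : 0 < n.+1%:R :> R by rewrite ltr0n.
have tN : 0 <= tau * n.+1%:R by rewrite mulr_ge0// ltW.
have t0 : 0 <= t := le_trans tN tt.
have H := win_sum_chebyshev Ain g0 g1 t0.
have d0 : 0 < (tau * n.+1%:R) ^+ 2 by rewrite exprn_gt0// mulr_gt0.
rewrite -(ler_pM2r d0); apply: le_trans (le_trans H _).
  by rewrite ler_wpM2l// lerXn2r// nnegrE.
rewrite le_eqVlt; apply/orP; left; apply/eqP; field.
by rewrite nat1r pnatr_eq0 (gt_eqF tau0).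
Qed.

(** Chebyshev at each of the r + 1 grid points with relative deviation 1 / r; with r fixed, the
    proportion is O(1 / N). *)
Lemma card_unbalanced n (q r : nat) : (0 < r)%N -> (n.+1 < q * r)%N ->
  #|[set X : {ffun 'I_n.+1 -> bool} | [exists t : 'I_r.+1,
     q%:R < `|win_sum (fun i : 'I_n.+1 => i < t * q)%N (@sgn_win R) X|]]%SET|%:R
  <= (2 ^ n.+1)%:R * (r.+1%:R * r%:R ^+ 2 / n.+1%:R) :> R.
Proof.
move=> r0 nq; have rR : 0 < r%:R :> R by rewrite ltr0n.
have H (t : 'I_r.+1) : #|[set X : {ffun 'I_n.+1 -> bool} |
     q%:R < `|win_sum (fun i : 'I_n.+1 => i < t * q)%N (@sgn_win R) X|]%SET|%:R
    <= (2 ^ n.+1)%:R * ((4 * 0).+1%:R / r%:R^-1 ^+ 2 / n.+1%:R) :> R.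
  apply: card_deviation.
  - by move=> i _; rewrite /inside; have := ltn_ord i; lia.
  - pose w0 (b : bool) : {ffun 'I_((0).*2.+1) -> bool} := [ffun=> b].
    rewrite (reindex (fun b : bool => w0 b)) /=; last first.
      exists (fun w => w ord0) => [b _|w _]; first by rewrite ffunE.
      by apply/ffunP => i; rewrite ffunE (ord1 i).
    by rewrite big_bool /= /sgn_win !ffunE addrC subrr.
  - by move=> w; rewrite /sgn_win; case: ifP; rewrite ?normrN normr1.
  - by rewrite invr_gt0.
  - by rewrite mulrC ler_pdivrMr// -natrM ler_nat ltnW.
apply: le_trans (card_exists_le H) _; rewrite card_ord le_eqVlt; apply/orP; left.
by apply/eqP; field; rewrite nat1r !pnatr_eq0 /= -lt0n.
Qed.

Lemma card_pattern_deviation n h z (tau : R) : 0 < tau ->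
  #|[set X : {ffun 'I_n.+1 -> bool} | [exists jc : 'I_4 * cell h,
     tau * n.+1%:R < `|win_sum (arm h z jc.1.+1) (@cell_dev R h jc.1.+1 jc.2) X|]]%SET|%:R
  <= (2 ^ n.+1)%:R * (#|{: 'I_4 * cell h}|%:R * (4 * h).+1%:R / tau ^+ 2 / n.+1%:R) :> R.
Proof.
move=> tau0.
have H (jc : 'I_4 * cell h) : #|[set X : {ffun 'I_n.+1 -> bool} |
     tau * n.+1%:R < `|win_sum (arm h z jc.1.+1) (@cell_dev R h jc.1.+1 jc.2) X|]%SET|%:R
    <= (2 ^ n.+1)%:R * ((4 * h).+1%:R / tau ^+ 2 / n.+1%:R) :> R.
  apply: card_deviation => //; first by move=> i /andP[].
  - exact: sum_cell_dev.
  - exact: cell_dev_le1.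
apply: le_trans (card_exists_le H) _; rewrite le_eqVlt; apply/orP; left.
by apply/eqP; field; rewrite nat1r pnatr_eq0 (gt_eqF tau0).
Qed.

Definition zpos n (u : R) : 'I_n.+1 := inord (Num.truncn (n.+1%:R * u)).

Lemma zposP n u : 0 <= u < 1 ->
  (zpos n u)%:R <= n.+1%:R * u /\ n.+1%:R * u < (zpos n u).+1%:R.
Proof.
move=> /andP[u0 u1]; have nu : 0 <= n.+1%:R * u by rewrite mulr_ge0.
have := truncn_itv nu; rewrite /zpos inordK; first by move=> /andP[].
by rewrite truncn_lt_nat// -[ltRHS]mulr1 ltr_pM2l// ltr0n.
Qed.

Definition close_at n h (u d : R) : {set 'S_n.+1} :=
  [set s | [forall c : cell h, `|cell_freq R s c - cell_limit u c| <= d]]%SET.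

Lemma typical_count h (u d : R) : 0 < u < 1 -> 0 < d ->
  \forall n \near \oo, (1 - d) * (4 ^ n.+1)%:R <=
    32 * #|(Sq_at (zpos n u) :&: close_at n h u d)%SET|%:R.
Proof.
move=> /andP[u0 u1] d0.
pose tau := d / 16.
have tau0 : 0 < tau by rewrite divr_gt0.
pose v := Num.min d (Num.min u (1 - u)).
have v0 : 0 < v by rewrite !lt_min d0 u0 subr_gt0.
(* With e = 2 q and q about N / r, this makes 40 e at most a fraction of v N, so that it fits below
   z and N - z, and keeps the 10 e atypical positions below a fraction of d N. *)
pose r := (Num.truncn (200 / v)).+1.
have rv : 200 < r%:R * v.
  by rewrite -ltr_pdivrMr//; exact: truncnS_gt.
(* B / N bounds the proportion of discarded pairs: imbalance counts twice, for [X] and for [Y], and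
   pattern deviations once, for [X]. It is compared with d / 32 because admissible pairs are only 1
   / 32 of all pairs. *)
pose B := 2 * (r.+1%:R * r%:R ^+ 2) + #|{: 'I_4 * cell h}|%:R * (4 * h).+1%:R / tau ^+ 2.
near=> n.
have Nr : (h.+1 * r <= n.+1)%N.
  by near: n; exists (h.+1 * r)%N => // m /= /leqW.
have NB : 32 * B <= d * n.+1%:R.
  rewrite [leRHS]mulrC -ler_pdivrMr// -[n.+1%:R]natr1 -lerBlDr; near: n; exact: nbhs_infty_ger.
have Nv : (1000 + 100 * h%:R) <= v * n.+1%:R.
  rewrite [leRHS]mulrC -ler_pdivrMr// -[n.+1%:R]natr1 -lerBlDr; near: n; exact: nbhs_infty_ger.
have N0 : 0 < n.+1%:R :> R by rewrite ltr0n.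
pose q := (n.+1 %/ r).+1.
have nq : (n.+1 < q * r)%N by rewrite /q; exact: ltn_ceil.
have qn : (q * r <= n.+1 + r)%N by rewrite mulSn addnC leq_add2r leq_divM.
have hq : (h < q)%N by rewrite ltnS leq_divRL// (leq_trans _ Nr)// leq_mul2r leqnSn orbT.
set z := zpos n u.
have [zu uz] : z%:R <= n.+1%:R * u /\ n.+1%:R * u < z.+1%:R.
  by apply: zposP; rewrite u1 ltW.
pose badX := ([set X : {ffun 'I_n.+1 -> bool} | [exists t : 'I_r.+1,
     q%:R < `|win_sum (fun i : 'I_n.+1 => i < t * q)%N (@sgn_win R) X|]])%SET.
pose badP := [set X : {ffun 'I_n.+1 -> bool} | [exists jc : 'I_4 * cell h,
     tau * n.+1%:R < `|win_sum (arm h z jc.1.+1) (@cell_dev R h jc.1.+1 jc.2) X|]]%SET.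
pose G := (finset.setX (forced_low z :\: (badX :|: badP)) (forced_left n :\: badX))%SET.
have qv : 400 * q%:R <= 2 * v * n.+1%:R + 400.
  have : q%:R * r%:R <= n.+1%:R + r%:R :> R by rewrite -natrM -natrD ler_nat.
  move=> H; have r0 : 0 < r%:R :> R by rewrite ltr0n.
  have : (q%:R - 1) * (r%:R * v) <= n.+1%:R * v by rewrite mulrA ler_wpM2r ?(ltW v0)//; lra.
  have q1 : 0 <= q%:R - 1 :> R by rewrite subr_ge0 ler1n.
  have : (q%:R - 1) * 200 <= (q%:R - 1) * (r%:R * v) by rewrite ler_wpM2l// ltW.
  lra.
have vu : v <= u by rewrite /v !ge_min lexx orbT.
have vu' : v <= 1 - u by rewrite /v !ge_min lexx !orbT.
have vd : v <= d by rewrite /v !ge_min lexx.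
have h0 : (0 : R) <= h%:R by [].
have vun : v * n.+1%:R <= u * n.+1%:R by rewrite ler_wpM2r// ltW.
have vun' : v * n.+1%:R <= (1 - u) * n.+1%:R by rewrite ler_wpM2r// ltW.
have vdn : v * n.+1%:R <= d * n.+1%:R by rewrite ler_wpM2r// ltW.
have uz' := uz; rewrite -natr1 in uz.
have z1 : (40 * (2 * q) <= z)%N.
  by rewrite -(ler_nat R) !natrM; clear -qv vun uz zu Nv h0; lra.
have z2 : (z + 40 * (2 * q) <= n.+1)%N.
  by rewrite -(ler_nat R) natrD !natrM; clear -qv vun' uz zu Nv h0; lra.
have GS : (#|G| <= #|(Sq_at z :&: close_at n h u d)%SET|)%N.
  apply: card_typical_le => -[X Y]; rewrite finset.in_setX !finset.in_setD finset.in_setU.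
  move=> /andP[/andP[/norP[bX bP] /forced_lowP[X0 Xm Xz]] /andP[bY /forced_leftP[Y0 Ym]]].
  have bal Z : Z \notin badX -> balanced (2 * q) (bits Z) n.+1.
    rewrite inE negb_exists => /forallP H; apply: (@balanced_grid R _ _ _ r).
      by rewrite (leq_trans nq)// leq_mul2l leqnSn orbT.
    by move=> t; rewrite leNgt; exact: H.
  have bE Z i : bits Z (nat_of_ord i) = Z i :> bool by rewrite /bits inord_val.
  have tc : typical_code (bits X) (bits Y) z n.+1 (2 * q).
    split=> //; try exact: bal; rewrite -?[0%N]/(nat_of_ord (@ord0 n))
      -?[n.+1.-1]/(nat_of_ord (@ord_max n)) ?bE//.
  exists (rebuilt tc); last by rewrite /sq_code rebuilt_lowers rebuilt_lefts.
  rewrite !inE rebuilt_square /= -val_eqE /= rebuilt_argmin eqxx /=.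
  apply/forallP => c.
  have hq5 : (h <= 5 * (2 * q))%N by clear -hq; lia.
  have dX (j : 'I_4) :
      `|win_sum (arm h z j.+1) (@cell_dev R h j.+1 c) X| <= tau * n.+1%:R.
    rewrite leNgt; move: bP; rewrite inE negb_exists => /forallP H.
    exact: (H (j, c)).
  have := cell_freq_limit tc hq5 dX zu uz'.
  rewrite normrM (ger0_norm (ltW N0)) => H.
  rewrite -(ler_pM2l N0); apply: le_trans H _.
  rewrite !natrD !natrM /tau; clear -qv vdn Nv h0 d0 N0; lra.
have zi : (0 < z < n)%N by clear -z1 z2 hq; lia.
(* The pairs lost from the product have a bad [X] with any [Y], or any [X] with an unbalanced [Y];
   overlaps are counted twice. *)
have cG : (#|forced_low z| * #|forced_left n| <=
    #|G| + (#|badX| + #|badP|) * #|forced_left n| + #|forced_low z| * #|badX|)%N.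
  rewrite cardsX.
  have a1 : (#|forced_low z| <= #|(forced_low z :\: (badX :|: badP))%SET| + (#|badX| + #|badP|))%N.
    rewrite -(cardsID (badX :|: badP)%SET (forced_low z)) addnC leq_add2l.
    by rewrite (leq_trans (subset_leq_card (subsetIr _ _)))// leq_card_setU.
  have a2 : (#|forced_left n| <= #|(forced_left n :\: badX)%SET| + #|badX|)%N.
    rewrite -(cardsID badX (forced_left n)) addnC leq_add2l.
    by rewrite subset_leq_card// subsetIr.
  have a3 : (#|(forced_low z :\: (badX :|: badP))%SET| <= #|forced_low z|)%N.
    by rewrite subset_leq_card// subsetDl.
  apply: leq_trans (leq_mul a1 (leqnn _)) _; rewrite mulnDl addnAC leq_add2r.
  apply: leq_trans (leq_mul (leqnn _) a2) _; rewrite mulnDr leq_add2l.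
  by rewrite leq_mul2r a3 orbT.
have n0 : (0 < n)%N by clear -zi; lia.
have cl : #|forced_low z|%:R * 8 = (2 ^ n.+1)%:R :> R by rewrite -natrM card_forced_low.
have cr : #|forced_left n|%:R * 4 = (2 ^ n.+1)%:R :> R by rewrite -natrM card_forced_left.
have r_gt0 : (0 < r)%N by [].
have b1 := card_unbalanced r_gt0 nq; have b2 := @card_pattern_deviation n h z _ tau0.
have W0 : 0 <= (2 ^ n.+1)%:R :> R by [].
have -> : (4 ^ n.+1)%:R = (2 ^ n.+1)%:R * (2 ^ n.+1)%:R :> R by rewrite -natrM -expnMn.
apply: (@le_trans _ _ (32 * #|G|%:R)); last by rewrite ler_wpM2l// ler_nat.
have BE : B = n.+1%:R * (2 * (r.+1%:R * r%:R ^+ 2 / n.+1%:R) +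
    #|{: 'I_4 * cell h}|%:R * (4 * h).+1%:R / tau ^+ 2 / n.+1%:R).
  rewrite /B; field; rewrite nat1r pnatr_eq0 (gt_eqF tau0)//.
move: NB; rewrite BE mulrCA [leRHS]mulrC (ler_pM2l N0).
move: cG; rewrite -(ler_nat R) !natrD !natrM natrD.
have x0 : 0 <= #|badX|%:R :> R by [].
have p0 : 0 <= #|badP|%:R :> R by [].
move: b1 b2 cl cr W0 x0 p0; rewrite -/badX -/badP.
set W := (2 ^ n.+1)%:R; set k1 := _ / n.+1%:R; set k2 := _ / n.+1%:R.
move: #|badX|%:R #|badP|%:R #|G|%:R #|forced_low z|%:R #|forced_left n|%:R => x p g a b.
clear; move=> b1 b2 cl cr W0 x0 p0 cG NB.
have aE : a = W / 8 by lra.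
have bE : b = W / 4 by lra.
have ab : a * b = W * W / 32 by rewrite aE bE; field.
have h1 : (x + p) * b <= (W * k1 + W * k2) * W.
  by rewrite ler_pM ?addr_ge0 ?lerD// bE; lra.
have h2 : a * x <= W * (W * k1) by rewrite ler_pM// aE; lra.
have h3 : W * W * (32 * (2 * k1 + k2)) <= W * W * d by rewrite ler_wpM2l// mulr_ge0.
have : W * W / 32 <= g + (W * k1 + W * k2) * W + W * (W * k1).
  by rewrite -ab; apply: le_trans cG _; lra.
lra.
Unshelve. all: by end_near.
Qed.

End Typical.

(** * The local topology and weak convergence *)

Section CellTopology.
Variable R : realType.
Local Notation S := (rpspace R).

Definition cell_set h (c : cell h) : set S := [set y | code h y = c].

Lemma rp_dist_lt (x y : S) h : rp_dist R x y < 2 `^ (- h%:R) -> code h x = code h y.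
Proof.
apply: contraPP => nc; apply/negP; rewrite -leNgt /rp_dist.
have sup_le : (ereal_sup [set (k%:R : R)%:E | k in
    [set k | rp_restr k x = rp_restr k y]] <= h%:R%:E)%E.
  apply: ge_ereal_sup => _ [k /= /code_restrP ck <-]; rewrite lee_fin ler_nat leqNgt.
  by apply/negP => hk; apply: nc; apply: code_mono ck; exact: ltnW.
case: ereal_sup sup_le => [r||] //=.
  by rewrite lee_fin => rh; rewrite ler_powR ?ler1n// lerN2.
by move=> _; rewrite -[leRHS](powRr0 2) ler_powR ?ler1n// oppr_le0.
Qed.

Lemma rp_dist_le (x y : S) h : code h x = code h y -> rp_dist R x y <= 2 `^ (- h%:R).
Proof.
move=> /code_restrP E; rewrite /rp_dist.
have sup_ge : (h%:R%:E <= ereal_sup [set (k%:R : R)%:E | k in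
    [set k | rp_restr k x = rp_restr k y]])%E.
  by apply: ereal_sup_ubound; exists h.
case: ereal_sup sup_ge => [r||] //=.
  by rewrite lee_fin => rh; rewrite ler_powR ?ler1n// lerN2.
Qed.

Lemma nbhs_code (x : S) h : nbhs x (cell_set (code h x)).
Proof.
have e0 : 0 < 2 `^ (- h%:R) :> R by rewrite powR_gt0.
apply: filterS (nbhsx_ballx x _ e0) => y; rewrite ballEmdist /= => xy.
by symmetry; exact: rp_dist_lt.
Qed.

Lemma cell_set_open h (c : cell h) : open (cell_set c).
Proof.
rewrite openE => x xc; rewrite /interior; rewrite -[c]xc; exact: nbhs_code.
Qed.

Lemma nbhs_code_ex (x : S) (A : set S) : nbhs x A ->
  exists h, forall k, (h <= k)%N -> cell_set (code k x) `<=` A.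
Proof.
rewrite -nbhs_ballE => -[e /= e0 xA].
have [h he] : exists h : nat, 2 `^ (- h%:R) < e.
  exists (Num.truncn e^-1).+1; rewrite powRN powR_mulrn// -[ltRHS]invrK ltf_pV2 ?posrE ?invr_gt0 ?exprn_gt0//.
  apply: lt_le_trans (truncnS_gt _) _; rewrite -natrX ler_nat; exact/ltnW/ltn_expl.
exists h => k hk y yk; apply: xA; rewrite ballEmdist /=.
apply: le_lt_trans he; apply: (rp_dist_le (x := x)); symmetry.
exact: code_mono hk yk.
Qed.

Lemma open_cells (O : set S) : open O ->
  O = \bigcup_(hc in [set hc : {h : nat & cell h} | cell_set (tagged hc) `<=` O])
        cell_set (tagged hc).
Proof.
move=> oO; apply/seteqP; split=> [x Ox|x [hc /= sub /sub]//].
have /nbhs_code_ex[h H] := open_nbhs_nbhs (conj oO Ox).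
by exists (Tagged cell (code h x)) => //=; exact: H.
Qed.

Lemma cell_set_measurable h (c : cell h) : measurable (cell_set c : set (borel S)).
Proof. by apply: sub_sigma_algebra; exact: cell_set_open. Qed.

(** There are countably many cells over all levels, and every open set is a union of cells. *)
Lemma measurable_cells d (T : measurableType d) (f : T -> S) :
  (forall h (c : cell h), measurable (f @^-1` cell_set c)) ->
  measurable_fun setT (f : T -> borel S).
Proof.
move=> mf; apply: (@measurability _ _ T (borel S) setT f (@open S)); first by [].
move=> _ [V oV <-]; rewrite setTI (open_cells oV) preimage_bigcup bigcup_mkcond.
apply: countable_bigcupT_measurable; first exact: countableP.
by move=> hc; case: ifP => // _; exact: mf.
Qed.

End CellTopology.

(** * Random variables with finitely many values *)

Section FiniteRV.
Variables (R : realType) (d : measure_display) (T : measurableType d).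
Variables (P : probability T R) (I : finType) (X : T -> I).
Hypothesis mX : forall i, measurable (X @^-1` [set i]).

Lemma fin_rv_indicE (g : I -> R) w : g (X w) = \sum_i g i * \1_(X @^-1` [set i]) w.
Proof.
rewrite (bigD1 (X w))//= big1 => [|i /eqP ne]; last first.
  by rewrite indicE memNset ?mulr0// => /= E; apply: ne; rewrite E.
by rewrite indicE mem_set// mulr1 addr0.
Qed.

Lemma measurable_fin_rv (g : I -> R) : measurable_fun setT (fun w => g (X w)).
Proof.
rewrite (_ : (fun w => _) = (fun w => \sum_i g i * \1_(X @^-1` [set i]) w)).
  apply: measurable_sum => i; apply: measurable_funM => //.
by apply/funext => w; exact: fin_rv_indicE.
Qed.

Lemma measurable_fin_preimage (A : set I) : measurable (X @^-1` A).
Proof.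
rewrite (_ : X @^-1` A = \bigcup_(i in A) (X @^-1` [set i])).
  by apply: fin_bigcup_measurable => //; exact: finite_finset.
by apply/seteqP; split=> [w Aw|w [i Ai /= ->]//]; exists (X w).
Qed.

Lemma integral_fin_rv (g : I -> R) :
  (\int[P]_w (g (X w))%:E = (\sum_i g i * fine (P (X @^-1` [set i])))%:E)%E.
Proof.
have int_i i : P.-integrable setT (fun w => (\1_(X @^-1` [set i]) w)%:E).
  by apply: integrable_indic.
rewrite (eq_integral (fun w => \sum_i (g i)%:E * (\1_(X @^-1` [set i]) w)%:E)%E).
  rewrite integral_sum//=; last by move=> i; exact: integrableZl.
  rewrite -sumEFin; apply: eq_bigr => i _.
  by rewrite integralZl// integral_indic// setIT EFinM fineK// fin_num_measure.
by move=> w _; rewrite (fin_rv_indicE g) -sumEFin; apply: eq_bigr => i _; rewrite EFinM.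
Qed.

Lemma fin_rv_law (A : pred I) :
  fine (P (X @^-1` [set i | A i])) = \sum_(i | A i) fine (P (X @^-1` [set i])).
Proof.
have mA : measurable (X @^-1` [set i | A i]) by exact: measurable_fin_preimage.
have := integral_fin_rv (fun i => (A i)%:R).
rewrite (eq_integral (fun w => (\1_(X @^-1` [set i | A i]) w)%:E)); last first.
  by move=> w _; rewrite indicE /= mem_setE /=; congr (_%:R%:E); apply/idP/idP.
rewrite integral_indic// setIT => E; have := congr1 fine E => /= ->.
rewrite [RHS]big_mkcond; apply: eq_bigr => i _.
by case: (A i); rewrite ?mul1r ?mul0r.
Qed.

End FiniteRV.

Lemma continuous_borel (R : realType) (U : ptopologicalType) (f : U -> R) :
  continuous f -> measurable_fun setT (f : borel U -> R).
Proof.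
move=> /continuousP cf.
apply: (@measurability _ _ (borel U) R setT f (@RGenOpens.G R)).
  exact: RGenOpens.measurableE.
move=> _ [_ [a [b ->]] <-]; rewrite setTI; apply: sub_sigma_algebra; apply: cf.
exact: interval_open.
Qed.

Lemma bounded_integrable d (T : measurableType d) (R : realType) (P : probability T R)
  (f : T -> R) (M : R) : measurable_fun setT f -> (forall x, `|f x| <= M) ->
  P.-integrable setT (EFin \o f).
Proof.
move=> mf fM; apply: measurable_bounded_integrable => //.
  by apply: le_lt_trans (probability_le1 P _) (ltry _).
exists M; split; first exact: num_real.
by move=> x Mx y _ /=; rewrite (le_trans (fM y))// ltW.
Qed.

(** * Integrals of continuous functions and cell masses *)

Section Weak.
Variable R : realType.
Local Notation S := (rpspace R).
Implicit Types (mu : probability (borel S) R).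

Definition cell_mass mu h (c : cell h) : R := fine (mu (@cell_set R h c)).

Lemma cell_massE mu h (c : cell h) : mu (@cell_set R h c) = (cell_mass mu c)%:E.
Proof. by rewrite /cell_mass fineK//; apply: fin_num_measure; exact: cell_set_measurable. Qed.

Lemma measurable_code_step h (a : cell h -> R) :
  measurable_fun setT ((fun x => a (code h x)) : borel S -> R).
Proof. exact: (@measurable_fin_rv _ _ (borel S) _ _ (@cell_set_measurable R h)). Qed.

Lemma integrable_code_step mu h (a : cell h -> R) :
  mu.-integrable setT (fun x => (a (code h x))%:E).
Proof.
apply: (@bounded_integrable _ _ _ _ _ (\sum_c `|a c|)).
  exact: measurable_code_step.
by move=> x; rewrite (bigD1 (code h x))//= lerDl sumr_ge0.
Qed.

Lemma integral_code_step mu h (a : cell h -> R) :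
  Rintegral mu setT (fun x => a (code h x)) = \sum_c a c * cell_mass mu c.
Proof.
exact: (congr1 fine (integral_fin_rv mu (@cell_set_measurable R h) a)).
Qed.

Section Bounded.
Variables (f : S -> R) (M : R).
Hypothesis cf : continuous f.
Hypothesis fM : forall x, `|f x| <= M.

(** A lower step approximation of [f]. On an empty cell the infimum is a default value, but its mass
    is 0. *)
Definition cell_inf h (c : cell h) : R := inf (f @` cell_set c).

Lemma cell_inf_has h (x : S) : has_inf (f @` cell_set (code h x)).
Proof.
split; first by exists (f x), x.
by exists (- M) => _ [y _ <-]; have := fM y; rewrite ler_norml => /andP[].
Qed.

Lemma cell_inf_le h (x : S) : cell_inf (code h x) <= f x.
Proof. by apply: ge_inf; [case: (cell_inf_has h x)|exists x]. Qed.

Lemma cell_inf_bounded h (x : S) : `|cell_inf (code h x)| <= M.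
Proof.
rewrite ler_norml (le_trans (cell_inf_le h x)) ?andbT; last first.
  by have := fM x; rewrite ler_norml => /andP[].
apply: lb_le_inf; first by case: (cell_inf_has h x).
by move=> _ [y _ <-]; have := fM y; rewrite ler_norml => /andP[].
Qed.

Lemma cell_inf_cvg (x : S) : cell_inf (code h x) @[h --> \oo] --> f x.
Proof.
apply/cvgrPdist_le => e e0.
have [h H] : exists h, forall k, (h <= k)%N ->
    cell_set (code k x) `<=` [set y | `|f x - f y| < e].
  by apply: nbhs_code_ex; have cfx : f @ x --> f x := @cf x; move/cvgrPdist_lt: cfx; exact.
exists h => // k /= hk; rewrite ger0_norm ?subr_ge0 ?cell_inf_le//.
rewrite lerBlDr -lerBlDl; apply: lb_le_inf; first by case: (cell_inf_has k x).
move=> _ [y xy <-]; have /= := H k hk y xy; rewrite ltr_norml => /andP[_].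
by rewrite ltrBlDr => /ltW; rewrite -lerBlDl.
Qed.

Lemma integrable_cont mu : mu.-integrable setT (EFin \o f).
Proof. by apply: (@bounded_integrable _ (borel S) _ _ _ M) fM; exact: continuous_borel. Qed.

Lemma cell_inf_integral_cvg mu :
  (\sum_c cell_inf c * @cell_mass mu h c) @[h --> \oo] --> Rintegral mu setT f.
Proof.
rewrite (_ : (fun h => _) = (fun h => Rintegral mu setT (fun x => cell_inf (code h x)))).
  apply: fine_cvg; rewrite fineK; last first.
    exact: integrable_fin_num (integrable_cont mu).
  apply: (@dominated_cvg _ _ _ mu setT measurableT _ _ (cst M%:E)) => //.
  - by move=> h; apply/measurable_EFinP; exact: measurable_code_step.
  - by move=> x _; apply/cvg_EFin; [exact: nearW|exact: cell_inf_cvg].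
  - exact: finite_measure_integrable_cst.
  - by move=> h x _; rewrite /= lee_fin cell_inf_bounded.
by apply/funext => h; rewrite integral_code_step.
Qed.

(* The step functions [cell_inf] increase to f and their integrals depend on
   finitely many cell masses only. *)
Lemma integral_lsc mu (e : R) : 0 < e -> exists h0, forall h, (h0 <= h)%N ->
  exists2 d : R, 0 < d & forall mu', 
    (forall c : cell h, `|cell_mass mu' c - cell_mass mu c| <= d) ->
    Rintegral mu setT f - e <= Rintegral mu' setT f.
Proof.
move=> e0; have e2 : 0 < e / 2 by rewrite divr_gt0.
have /cvgrPdist_le/(_ _ e2)[h0 _ H] := @cell_inf_integral_cvg mu.
exists h0 => h /H /=; rewrite ler_norml => /andP[_ Hh].
(* An error e / (2 A) in each mass costs at most e / 2 in the integral of the step function; the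
   added 1 keeps [A] positive. *)
pose A := \sum_(c : cell h) `|cell_inf c| + 1.
have A0 : 0 < A by rewrite ltr_wpDl// sumr_ge0.
exists (e / 2 / A) => [|mu' Hd]; first by rewrite divr_gt0.
apply: (@le_trans _ _ (Rintegral mu' setT (fun x => cell_inf (code h x)))); last first.
  apply: le_Rintegral => //.
  - exact: integrable_code_step.
  - exact: integrable_cont.
  - by move=> x _; exact: cell_inf_le.
rewrite integral_code_step.
have D : `|\sum_(c : cell h) cell_inf c * cell_mass mu' c - \sum_(c : cell h) cell_inf c * cell_mass mu c| <= e / 2.
  rewrite -sumrB; apply: le_trans (ler_norm_sum _ _ _) _.
  apply: (@le_trans _ _ (\sum_(c : cell h) `|cell_inf c| * (e / 2 / A))).
    by apply: ler_sum => c _; rewrite -mulrBr normrM ler_wpM2l.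
  rewrite -mulr_suml -[leRHS](@divfK _ A) ?gt_eqF// [leRHS]mulrC ler_wpM2r//.
    by rewrite divr_ge0 ?ltW// divr_ge0// ltW.
  by rewrite lerDl.
move: D; rewrite ler_norml => /andP[D _]; move: Hh D.
set a := Rintegral _ _ _; set b := \sum_c _; set b' := \sum_c _; lra.
Qed.

End Bounded.

(** Lower semicontinuity applied to f and to - f. *)
Lemma integral_cont_cells (f : S -> R) (M : R) mu (e : R) :
  continuous f -> (forall x, `|f x| <= M) -> 0 < e ->
  exists h0, forall h, (h0 <= h)%N -> exists2 d : R, 0 < d & forall mu',
    (forall c : cell h, `|cell_mass mu' c - cell_mass mu c| <= d) ->
    `|Rintegral mu' setT f - Rintegral mu setT f| <= e.
Proof.
move=> cf fM e0; have [h1 H1] := integral_lsc cf fM mu e0.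
have cNf : continuous (fun x => - f x) by move=> x; have cfx : f @ x --> f x := @cf x; exact: (cvgN cfx).
have NfM x : `|- f x| <= M by rewrite normrN.
have NE (nu : probability (borel S) R) : Rintegral nu setT (fun x => - f x) = - Rintegral nu setT f.
  rewrite -[RHS]mulN1r -RintegralZl//; last exact: (integrable_cont cf fM nu).
  by apply: eq_Rintegral => x _; rewrite mulN1r.
have [h2 H2] := integral_lsc cNf NfM mu e0.
exists (maxn h1 h2) => h; rewrite geq_max => /andP[/H1[d1 d10 D1] /H2[d2 d20 D2]].
exists (Num.min d1 d2); first by rewrite lt_min d10.
move=> mu' Hd; rewrite ler_norml; apply/andP; split.
  rewrite lerBrDl; apply: D1 => c; apply: le_trans (Hd c) _.
  by rewrite ge_min lexx.
have := D2 mu'; rewrite !NE => {}D2.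
have : - Rintegral mu setT f - e <= - Rintegral mu' setT f.
  by apply: D2 => c; apply: le_trans (Hd c) _; rewrite ge_min lexx orbT.
lra.
Qed.

End Weak.

(** * The weak topology and cell masses *)

Section WeakTopologyCells.
Variable R : realType.
Local Notation S := (rpspace R).
Local Notation W := (wprobability R S).

Definition mass (mu : W) h (c : cell h) : R := @cell_mass R mu h c.

Definition near_cells (mu : W) h (d : R) : set W :=
  [set mu' | forall c : cell h, `|mass mu' c - mass mu c| <= d].

(** Asking for a radius at every large level, and not just at one, makes intersections immediate:
    two thresholds are joined by a maximum, without comparing masses across levels. *)
Definition cell_filter (mu : W) : set_system W :=
  [set A | exists h0, forall h, (h0 <= h)%N -> exists2 d : R, 0 < d & near_cells mu h d `<=` A].

Lemma cell_filter_filter (mu : W) : Filter (cell_filter mu).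
Proof.
split.
- by exists 0%N => h _; exists 1.
- move=> A B [hA HA] [hB HB]; exists (maxn hA hB) => h; rewrite geq_max.
  move=> /andP[/HA[dA dA0 sA] /HB[dB dB0 sB]].
  exists (Num.min dA dB); first by rewrite lt_min dA0.
  move=> mu' H; split; [apply: sA|apply: sB] => c; apply: le_trans (H c) _.
    by rewrite ge_min lexx.
  by rewrite ge_min lexx orbT.
- move=> A B AB [h0 H]; exists h0 => h /H[d d0 s]; exists d => //.
  exact: subset_trans s AB.
Qed.

(** The topology is initial for [mean] into a product, so it is enough to look at one coordinate,
    that is, at the integral of one bounded continuous function. *)
Lemma cell_filter_nbhs (mu : W) (A : set W) : nbhs mu A -> cell_filter mu A.
Proof.
move=> [B [[C oC <-] Cmu] sA].
have FF := cell_filter_filter mu; have FM := fmap_filter (@mean R S) FF.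
suff cvg : (@mean R S @ cell_filter mu : set_system _) --> mean mu.
  apply: (@filterS _ _ FF _ _ sA); apply: cvg; exact: open_nbhs_nbhs.
apply/cvg_sup => i; case: i => f [cf [M fM]].
move=> D [E [[U oU <-] /= Umu] sD].
have /nbhs_ballP[e /= e0 sU] : nbhs (Rintegral mu setT f) U by exact: open_nbhs_nbhs.
have e2 : 0 < e / 2 by rewrite divr_gt0.
have [h0 H] := integral_cont_cells mu cf fM e2.
exists h0 => h /H[d d0 Hd]; exists d => // mu' mu'd.
apply: sD; apply: sU; rewrite /ball /= distrC.
have le := Hd _ mu'd; apply: le_lt_trans le _.
by rewrite ltr_pdivrMr// mulr_natr mulr2n ltrDl.
Qed.

Lemma mass_ge0 (mu : W) h (c : cell h) : 0 <= mass mu c.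
Proof. by rewrite fine_ge0. Qed.

Lemma mass_le1 (mu : W) h (c : cell h) : mass mu c <= 1.
Proof.
by rewrite -lee_fin -[(mass mu c)%:E]cell_massE probability_le1//; exact: cell_set_measurable.
Qed.

(** A countable type: rational centres for the finitely many masses of one level, and a radius 1 /
    (k + 1). *)
Definition base_index := {h : nat & ({ffun cell h -> rat} * nat)%type}.

Definition base_set (b : base_index) : set W :=
  [set mu | forall c : cell (tag b),
    `|mass mu c - ratr ((tagged b).1 c)| <= (tagged b).2.+1%:R^-1].

Lemma open_base (V : set W) : open V ->
  V = \bigcup_(b in [set b | base_set b `<=` V]) base_set b.
Proof.
move=> oV; apply/seteqP; split=> [mu Vmu|mu [b /= sb /sb]//].
have [h0 /(_ h0 (leqnn _))[d d0 sd]] : cell_filter mu V.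
  by apply: cell_filter_nbhs; exact: open_nbhs_nbhs.
(* Two measures of the same base set differ by at most 2 / (k + 1) on each cell, which must not
   exceed [d]. *)
pose k := Num.truncn (2 / d).
have k0 : 0 < k.+1%:R^-1 :> R by rewrite invr_gt0.
have kd : 2 * k.+1%:R^-1 <= d.
  rewrite ler_pdivrMr// mulrC -ler_pdivrMr//; exact/ltW/truncnS_gt.
have qex (c : cell h0) : exists q : rat, `|mass mu c - ratr q| <= k.+1%:R^-1.
  have /rat_in_itvoo[q] : mass mu c < mass mu c + k.+1%:R^-1 by rewrite ltrDl.
  rewrite in_itv /= => /andP[q1 q2]; exists q.
  rewrite ler_norml; move: (k.+1%:R^-1) k0 q2 => r r0 q2.
  by apply/andP; split; lra.
have [q0 q0P] := choice qex; pose q := [ffun c => q0 c].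
exists (Tagged (fun h => ({ffun cell h -> rat} * nat)%type) (q, k)) => /=.
  move=> mu' H; apply: sd => c; have := H c; rewrite /= ffunE.
  have := q0P c; rewrite !ler_norml; move: (k.+1%:R^-1) kd => r kd /andP[? ?] /andP[? ?].
  by apply/andP; split; lra.
by move=> c /=; rewrite ffunE.
Qed.

Lemma measurable_wprob d (T : measurableType d) (N : T -> W) :
  (forall h (c : cell h), measurable_fun setT (fun w => mass (N w) c)) ->
  measurable_fun setT (N : T -> borel W).
Proof.
move=> mN; apply: (@measurability _ _ T (borel W) setT N (@open W)); first by [].
move=> _ [V oV <-]; rewrite setTI (open_base oV) preimage_bigcup bigcup_mkcond.
apply: countable_bigcupT_measurable; first exact: countableP.
move=> b; case: ifP => // _.
rewrite (_ : N @^-1` base_set b = \bigcap_(c in [set: cell (tag b)])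
  ((fun w => mass (N w) c) @^-1` `[ratr ((tagged b).1 c) - (tagged b).2.+1%:R^-1,
     ratr ((tagged b).1 c) + (tagged b).2.+1%:R^-1]%classic)).
  apply: fin_bigcap_measurable; first exact: finite_finset.
  by move=> c _; rewrite -[X in measurable X]setTI; apply: mN.
apply/seteqP; split=> w H c => [_|].
  have := H c; rewrite /= in_itv /= ler_norml.
  by move: (_^-1) => r /andP[? ?]; apply/andP; split; lra.
have := H c I; rewrite /= in_itv /= ler_norml.
by move: (_^-1) => r /andP[? ?]; apply/andP; split; lra.
Qed.

End WeakTopologyCells.

(** * The limiting random measure *)

Lemma expectationE_integral (R : realType) d (T : measurableType d) (P : probability T R) (f : T -> R) :
  ('E_P[f] = \int[P]_w (f w)%:E)%E.
Proof. by rewrite unlock. Qed.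

Section Labels.
Variables (R : realType) (d : measure_display) (T : measurableType d).
Variables (Q : probability T R) (L : int -> T -> bool).
Hypothesis L_unif : forall z, uniform_on Q (L z) predT.
Hypothesis L_indep : mutual_indep Q (fun z => sigma_discrete (L z)).

Definition label_win h (w : T) : {ffun 'I_(h.*2.+1) -> bool} := [ffun a => L (pos a) w].

(** The sample space with the sigma-algebra of the labels alone: measurability in [M] is membership
    in [sigma_family L], the form in which independence is assumed. *)
Let M := g_sigma_algebraType (\bigcup_z sigma_discrete (L z)).

Lemma label_family z b : sigma_family L (L z @^-1` [set b]).
Proof.
apply: sub_sigma_algebra; exists z => //; exists [set b] => //.
by rewrite setTI.
Qed.

Lemma label_winE h b : @label_win h @^-1` [set b] =
  \bigcap_(a in [set: 'I_(h.*2.+1)]) (L (pos a) @^-1` [set b a]).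
Proof.
apply/seteqP; split=> [w /= <- a _ /=|w H]; first by rewrite ffunE.
by apply/ffunP => a; rewrite ffunE; exact: H.
Qed.

Lemma label_win_family h b : sigma_family L (@label_win h @^-1` [set b]).
Proof.
rewrite label_winE; have := @fin_bigcap_measurable _ M _ setT
  (fun a : 'I_(h.*2.+1) => L (pos a) @^-1` [set b a]).
apply; first exact: finite_finset.
by move=> a _; exact: label_family.
Qed.

Lemma sigma_family_measurable A : sigma_family L A -> measurable A.
Proof.
move=> H; apply: H; split; first exact: sigma_algebra_measurable.
move=> _ [z _ [B _ <-]]; rewrite setTI.
by apply: measurable_fin_preimage => b; exact: (L_unif z b).1.
Qed.

Lemma label_rperm_code j h (c : cell h) :
  (fun w => label_rperm j (L ^~ w)) @^-1` @cell_set R h c =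
  @label_win h @^-1` [set b | label_code j b == c].
Proof.
apply/seteqP; split=> w; rewrite /cell_set /preimage /=; [move=> <-|move=> /eqP <-].
  by apply/eqP/code_labelE => l /posP[a ->]; rewrite labels_ofE ffunE.
by apply/code_labelE => l /posP[a ->]; rewrite labels_ofE ffunE.
Qed.

Lemma label_rperm_family j h (c : cell h) :
  sigma_family L ((fun w => label_rperm j (L ^~ w)) @^-1` @cell_set R h c).
Proof.
rewrite label_rperm_code.
exact: (@measurable_fin_preimage _ M _ (@label_win h) (@label_win_family h)).
Qed.

Lemma label_win_unif h (b : {ffun 'I_(h.*2.+1) -> bool}) :
  Q (@label_win h @^-1` [set b]) = ((2 ^ h.*2.+1)%:R^-1)%:E.
Proof.
pose Js : {fset int} := [fset pos a | a in 'I_(h.*2.+1)]%fset.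
have JP z : z \in Js -> exists a : 'I_(h.*2.+1), z = pos a.
  by move=> /imfsetP[a _ ->]; exists a.
rewrite (_ : _ @^-1` _ = \bigcap_(z in [set` Js]) (L z @^-1` [set labels_of b z])).
  rewrite (L_indep (J := Js)); last first.
    by move=> z _; exists [set labels_of b z] => //; rewrite setTI.
  rewrite (eq_bigr (fun=> (2^-1)%:E)); last first.
    move=> z _; rewrite (L_unif z _).2; congr (_%:E).
    by rewrite cardT enumT unlock /= mul1r.
  rewrite prodEFin big_const_seq count_predT iter_mulr_1.
  rewrite (_ : size _ = h.*2.+1) ?natrX ?exprVn//.
  rewrite -[size _]/(#|` Js|) card_imfset /=; last first.
    by move=> a a'; rewrite /pos => E; apply/val_inj => /=; lia.
  by rewrite size_enum_ord.
rewrite label_winE; apply/seteqP; split=> w H z.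
  by move=> /= /JP[a ->]; rewrite labels_ofE; apply: H.
move=> _; have := H (pos z); rewrite /= labels_ofE; apply.
by apply/imfsetP; exists z.
Qed.

Lemma label_rperm_law j h (c : cell h) :
  Q ((fun w => label_rperm j (L ^~ w)) @^-1` @cell_set R h c) = (cell_prob R j c)%:E.
Proof.
have mw b : measurable (@label_win h @^-1` [set b]).
  by apply: sigma_family_measurable; exact: label_win_family.
have mc := sigma_family_measurable (@label_rperm_family j h c).
rewrite -[LHS]fineK ?fin_num_measure// label_rperm_code fin_rv_law//.
congr (_%:E); rewrite (eq_bigr (fun=> (2 ^ h.*2.+1)%:R^-1)); last first.
  by move=> b _; rewrite label_win_unif.
rewrite sumr_const -[LHS]mulr_natl /cell_prob; congr (_ * _); congr (_%:R).
by apply: eq_card => b; rewrite !inE.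
Qed.

End Labels.

(** * The law of J for a fixed first argument *)

Section UniformJ.
Variable R : realType.
Local Notation unif := (uniform_prob (@ltr01 R)).
Local Notation mu := (@lebesgue_measure R).

Lemma unifE (A : set R) : measurable A -> unif A = mu (A `&` `[0, 1]%classic).
Proof.
move=> mA; rewrite /uniform_prob integral_uniform_pdf (eq_integral (cst 1%E)).
  by rewrite integral_cst ?mul1e//; exact: measurableI.
move=> x; rewrite inE => -[_]; rewrite /= in_itv /= /uniform_pdf => ->.
by rewrite subr0 invr1.
Qed.

Lemma unif_cc (a b : R) : 0 <= a -> a <= b -> b <= 1 -> unif `[a, b]%classic = (b - a)%:E.
Proof.
move=> a0 ab b1; rewrite unifE; last exact: measurable_itv.
rewrite (_ : _ `&` _ = `[a, b]%classic).
  rewrite lebesgue_measure_itv /= lte_fin; case: ltP => // ba.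
  by rewrite (_ : b = a) ?subrr//; apply/eqP; rewrite eq_le ab ba.
apply/seteqP; split=> x /=; rewrite !in_itv /=; [by case|].
by move=> /andP[ax xb]; rewrite ax xb (le_trans a0 ax) (le_trans xb b1).
Qed.

Lemma unif_lt (a : R) : 0 <= a <= 1 -> unif `]-oo, a[%classic = a%:E.
Proof.
move=> /andP[a0 a1]; rewrite unifE; last exact: measurable_itv.
rewrite (_ : _ `&` _ = `[0, a[%classic).
  rewrite lebesgue_measure_itv /= lte_fin; case: ltP => // [_|ba]; first by rewrite oppr0 adde0.
  by rewrite (_ : a = 0)//; apply/eqP; rewrite eq_le a0 ba.
apply/seteqP; split=> x /=; rewrite !in_itv /=.
  by move=> [xa /andP[x0 _]]; rewrite xa x0.
by move=> /andP[x0 xa]; rewrite x0 xa (le_trans (ltW xa) a1).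
Qed.

Lemma unif_gt (a : R) : 0 <= a <= 1 -> unif `]a, +oo[%classic = (1 - a)%:E.
Proof.
move=> /andP[a0 a1]; rewrite unifE; last exact: measurable_itv.
rewrite (_ : _ `&` _ = `]a, 1]%classic).
  rewrite lebesgue_measure_itv /= lte_fin; case: ltP => // ba.
  by rewrite (_ : a = 1) ?subrr//; apply/eqP; rewrite eq_le a1 ba.
apply/seteqP; split=> x /=; rewrite !in_itv /= ?andbT.
  by move=> [xa /andP[_ x1]]; rewrite xa x1.
by move=> /andP[ax x1]; rewrite ax x1 (le_trans a0 (ltW ax)).
Qed.

Lemma J_left (u v : R) : u < 1 / 2 ->
  J u v = if v < u then 2 else if 1 - u < v then 3 else 1.
Proof.
move=> u2; rewrite /J u2 /= min_l; last by lra.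
rewrite max_r; last by lra.
by case: (ltP v u) => //= _; case: (ltP (1 - u) v).
Qed.

Lemma J_right (u v : R) : 1 / 2 <= u ->
  J u v = if v < 1 - u then 2 else if u < v then 3 else 4.
Proof.
move=> u2; rewrite /J ltNge u2 /= min_r; last by lra.
by rewrite max_l//; lra.
Qed.

Lemma J_range (u v : R) : (0 < J u v <= 4)%N.
Proof. by rewrite /J; case: ifP => // _; case: ifP => // _; case: ifP. Qed.

Definition J_prob (j : nat) (u : R) : \bar R := unif [set v | J u v = j].

(** On a vertical slice J changes only at min(u, 1 - u) and max(u, 1 - u), just as the sides of the
    rectangle change at the positions z and N - z. *)
Lemma J_prob_arm (j : 'I_4) (u : R) : 0 <= u <= 1 ->
  J_prob j.+1 u = (arm_weight j.+1 u)%:E.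
Proof.
move=> /[dup] u01 /andP[u0 u1]; rewrite /J_prob.
have u01' : 0 <= 1 - u <= 1 by lra.
have [u2|u2] := ltP u (1 / 2).
  have Jset k : [set v | J u v = k] =
    [set v | (if v < u then 2 else if 1 - u < v then 3 else 1) = k].
    by apply/seteqP; split=> v /=; rewrite J_left.
  rewrite Jset; case: j => -[|[|[|[|//]]]] j4 /=.
  - rewrite (_ : [set v | _] = `[u, 1 - u]%classic).
      rewrite unif_cc//; [|lra|lra].
      rewrite max_l; last by lra.
      by congr (_%:E); ring.
    apply/seteqP; split=> v /=; rewrite in_itv /=.
      by case: ltP => // ?; case: ltP => // ? _; apply/andP; split; lra.
    by case: ltP => //= ?; case: ltP => //; lra.
  - rewrite (_ : [set v | _] = `]-oo, u[%classic).
      by rewrite unif_lt// min_l//; lra.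
    apply/seteqP; split=> v /=; rewrite in_itv /=; first by case: ifP => //; case: ifP.
    by move=> ->.
  - rewrite (_ : [set v | _] = `]1 - u, +oo[%classic).
      by rewrite unif_gt// min_l; [congr (_%:E); ring|lra].
    apply/seteqP; split=> v /=; rewrite in_itv /= andbT.
      by case: ifP => //; case: ifP.
    by move=> vu; rewrite vu ltNge (_ : _ <= _ = true)//; apply/idP; lra.
  - rewrite (_ : [set v | _] = set0) ?measure0 ?max_r//; first lra.
    by apply/seteqP; split=> v //=; case: ifP => //; case: ifP.
have Jset k : [set v | J u v = k] =
  [set v | (if v < 1 - u then 2 else if u < v then 3 else 4) = k].
  by apply/seteqP; split=> v /=; rewrite J_right.
rewrite Jset; case: j => -[|[|[|[|//]]]] j4 /=.
- rewrite (_ : [set v | _] = set0) ?measure0 ?max_r//; first lra.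
  by apply/seteqP; split=> v //=; case: ifP => //; case: ifP.
- rewrite (_ : [set v | _] = `]-oo, 1 - u[%classic).
    by rewrite unif_lt// min_r//; lra.
  apply/seteqP; split=> v /=; rewrite in_itv /=; first by case: ifP => //; case: ifP.
  by move=> ->.
- rewrite (_ : [set v | _] = `]u, +oo[%classic).
    by rewrite unif_gt// min_r; [|lra].
  apply/seteqP; split=> v /=; rewrite in_itv /= andbT.
    by case: ifP => //; case: ifP.
  by move=> vu; rewrite vu ltNge (_ : _ <= _ = true)//; apply/idP; lra.
- rewrite (_ : [set v | _] = `[1 - u, u]%classic).
    rewrite unif_cc//; [|lra|lra].
    rewrite max_l; last by lra.
    by congr (_%:E); ring.
  apply/seteqP; split=> v /=; rewrite in_itv /=.
    by case: ltP => // ?; case: ltP => // ? _; apply/andP; split; lra.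
  by case: ltP => //= ?; case: ltP => //; lra.
Qed.

Lemma measurable_J : measurable_fun setT (fun p : R * R => J p.1 p.2).
Proof.
have m1 : measurable_fun setT (fun p : R * R => p.1) by exact: measurable_fst.
have m2 : measurable_fun setT (fun p : R * R => p.2) by exact: measurable_snd.
have m1' : measurable_fun setT (fun p : R * R => 1 - p.1) by apply: measurable_funB.
have b1 : measurable_fun setT (fun p : R * R => (p.1 < 1 / 2) && (p.1 <= p.2 <= 1 - p.1)).
  apply: measurable_and; first by apply: measurable_fun_ltr.
  by apply: measurable_and; apply: measurable_fun_ler.
have b2 : measurable_fun setT (fun p : R * R => p.2 < Num.min p.1 (1 - p.1)).
  by apply: measurable_fun_ltr => //; apply: measurable_minr.
have b3 : measurable_fun setT (fun p : R * R => Num.max p.1 (1 - p.1) < p.2).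
  by apply: measurable_fun_ltr => //; apply: measurable_maxr.
apply: (measurable_fun_ifT b1) => //; apply: (measurable_fun_ifT b2) => //.
exact: (measurable_fun_ifT b3).
Qed.

End UniformJ.

(** * Mean weights of the four sides *)

Section ArmIntegral.
Variable R : realType.
Local Notation mu := (@lebesgue_measure R).
Local Notation unif := (uniform_prob (@ltr01 R)).

Lemma integral_affine (p q a b : R) : a < b ->
  (\int[mu]_(x in `[a, b]) (p + q * x)%:E = (p * (b - a) + q / 2 * (b ^+ 2 - a ^+ 2))%:E)%E.
Proof.
move=> ab; pose F : R -> R := fun x => p * x + q / 2 * (x * x).
have dF (x : R) : is_derive x 1 F (p + q * x).
  by apply: is_derive_eq; rewrite /GRing.scale /=; field.
have cF (x : R) : {for x, continuous F}.
  by apply: differentiable_continuous; apply/derivable1_diffP; case: (dF x).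
rewrite (@continuous_FTC2 _ _ F)//.
- by rewrite -EFinB; congr (_%:E); rewrite /F; field.
- apply: continuous_subspaceT => x; apply: cvgD; first exact: cvg_cst.
  by apply: cvgMr; exact: cvg_id.
- split.
  + by move=> x _; case: (dF x).
  + by apply: cvg_at_right_filter; exact: cF.
  + by apply: cvg_at_left_filter; exact: cF.
- by move=> x _; rewrite derive1E; case: (dF x).
Qed.

Lemma integral_affine2 (f : R -> R) (p1 q1 p2 q2 : R) :
  measurable_fun setT f -> (forall x, 0 <= x <= 1 -> 0 <= f x) ->
  (forall x, 0 <= x <= 2^-1 -> f x = p1 + q1 * x) ->
  (forall x, 2^-1 <= x <= 1 -> f x = p2 + q2 * x) ->
  (\int[mu]_(x in `[0%R, 1%R]) (f x)%:E =
    (p1 / 2 + q1 / 8 + p2 / 2 + q2 * 3 / 8)%:E)%E.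
Proof.
move=> mf f0 f1 f2.
have half1 : 2^-1 < 1 :> R by rewrite invf_lt1// ltr1n.
have half0 : 0 < 2^-1 :> R by rewrite invr_gt0.
have E : `[0%R, 1%R]%classic = `[0%R, 2^-1]%classic `|` `]2^-1, 1%R]%classic :> set R.
  apply/seteqP; split=> x /=; rewrite !in_itv /=.
    by case: (leP x 2^-1) => xh /andP[x0 x1]; [left|right]; rewrite ?x0 ?x1.
  move=> [/andP[x0 xh]|/andP[xh x1]]; first by rewrite x0 (le_trans xh)// ltW.
  by rewrite x1 andbT (le_trans _ (ltW xh))// ltW.
rewrite E ge0_integral_setU//=; last 3 first.
- by apply: measurable_funTS; exact/measurable_EFinP.
- move=> x Hx; have : `[0%R, 1%R]%classic x by rewrite E.
  by rewrite /= in_itv /= lee_fin; exact: f0.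
- rewrite disj_set2E; apply/eqP/seteqP; split=> x //= [].
  by rewrite !in_itv /= => /andP[_ xh] /andP[hx _]; move: (lt_le_trans hx xh); rewrite ltxx.
rewrite integral_itv_obnd_cbnd; last by apply: measurable_funTS; exact/measurable_EFinP.
transitivity (\int[mu]_(x in `[0%R, (2^-1)%R]) (p1 + q1 * x)%:E +
    \int[mu]_(x in `[(2^-1)%R, 1%R]) (p2 + q2 * x)%:E)%E.
  congr (_ + _)%E; apply: eq_integral => x; rewrite inE /= in_itv /=.
    by move=> /f1 ->.
  by move=> /f2 ->.
by rewrite !integral_affine// -EFinD; congr (_%:E); field.
Qed.

Lemma measurable_arm_weight j : measurable_fun setT (@arm_weight R j).
Proof.
have m1 : measurable_fun setT (fun x : R => 1 - x) by apply: measurable_funB.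
have m2 : measurable_fun setT (fun x : R => 2 * x) by apply: measurable_funM.
case: j => [|[|[|[|j]]]]; rewrite /arm_weight /=.
- by apply: measurable_maxr => //; apply: measurable_funB.
- by apply: measurable_maxr => //; apply: measurable_funB.
- exact: measurable_minr.
- exact: measurable_minr.
- by apply: measurable_maxr => //; apply: measurable_funB.
Qed.

Lemma arm_weight_ge0 j (x : R) : 0 <= x <= 1 -> 0 <= arm_weight j x.
Proof.
move=> /andP[x0 x1].
by case: j => [|[|[|[|j]]]]; rewrite /arm_weight /= ?le_max ?lexx ?orbT// le_min x0 subr_ge0.
Qed.

(** Each side has mean weight 1 / 4 over u, which is why the annealed limit involves a uniform
    [K]. *)
Lemma integral_arm (j : 'I_4) :
  (\int[mu]_(x in `[0%R, 1%R]) (arm_weight j.+1 x)%:E = (4^-1)%R%:E)%E.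
Proof.
have A (p1 q1 p2 q2 : R) : (forall x, 0 <= x <= 2^-1 -> arm_weight j.+1 x = p1 + q1 * x) ->
    (forall x, 2^-1 <= x <= 1 -> arm_weight j.+1 x = p2 + q2 * x) ->
    p1 / 2 + q1 / 8 + p2 / 2 + q2 * 3 / 8 = 4^-1 ->
    (\int[mu]_(x in `[0%R, 1%R]) (arm_weight j.+1 x)%:E = (4^-1)%R%:E)%E.
  move=> H1 H2 H3; rewrite (integral_affine2 _ _ H1 H2) ?H3//.
    exact: measurable_arm_weight.
  by move=> x; exact: arm_weight_ge0.
case: j A => -[|[|[|[|//]]]] j4 /= A.
- by apply: (A 1 (-2) 0 0) => [x|x|]; [move=> /andP[? ?]; rewrite max_l; lra|
    move=> /andP[? ?]; rewrite max_r; lra|field].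
- by apply: (A 0 1 1 (-1)) => [x|x|]; [move=> /andP[? ?]; rewrite min_l; lra|
    move=> /andP[? ?]; rewrite min_r; lra|field].
- by apply: (A 0 1 1 (-1)) => [x|x|]; [move=> /andP[? ?]; rewrite min_l; lra|
    move=> /andP[? ?]; rewrite min_r; lra|field].
- by apply: (A 0 0 (-1) 2) => [x|x|]; [move=> /andP[? ?]; rewrite max_r; lra|
    move=> /andP[? ?]; rewrite max_l; lra|field].
Qed.

End ArmIntegral.

Definition mfun_of d d' (T : measurableType d) (T' : measurableType d') (f : T -> T')
    (mf : measurable_fun setT f) : {mfun T >-> T'} :=
  HB.pack f (isMeasurableFun.Build _ _ _ _ _ mf).

Lemma fin_rv_split (R : realType) d (T : measurableType d) (P : probability T R)
    (I : finType) (Z : T -> I) (D : set T) :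
  (forall i, measurable (Z @^-1` [set i])) -> measurable D ->
  (P D = \sum_i P (D `&` Z @^-1` [set i]))%E.
Proof.
move=> mZ mD.
have mDi i : measurable (D `&` Z @^-1` [set i]) by exact: measurableI.
have int_i i : P.-integrable setT (fun w => (\1_(D `&` Z @^-1` [set i]) w)%:E).
  exact: integrable_indic.
transitivity (\int[P]_w (\sum_i (\1_(D `&` Z @^-1` [set i]) w)%:E)%E)%E; last first.
  by rewrite integral_sum//; apply: eq_bigr => i _; rewrite integral_indic// setIT.
rewrite -[D in LHS]setIT -integral_indic//; apply: eq_integral => w _.
rewrite sumEFin (bigD1 (Z w))//= big1 ?addr0; last first.
  move=> i /eqP ne; rewrite indicE memNset// => -[_ /= E]; exact: ne.
by rewrite !indicE in_setI [w \in Z @^-1` _]mem_set// andbT.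
Qed.

(** * Uniqueness of conditional expectations given U *)

Section SubSigma.
Variables (R : realType) (d : measure_display) (T : measurableType d).
Variables (Q : probability T R) (U : T -> R).
Hypothesis mU : measurable_fun setT U.
Local Notation M := (g_sigma_algebraType (sigma_rv U)).

Lemma sigma_rv_gen (A : set M) : measurable A ->
  exists2 B : set R, measurable B & A = U @^-1` B.
Proof.
move=> mA; have : preimage_set_system setT U measurable A.
  suff -> : preimage_set_system setT U (@measurable _ R) = @measurable _ M by [].
  rewrite /measurable /= /sigma_rv.
  rewrite g_sigma_preimageE; congr preimage_set_system.
  by apply: esym; apply: sigma_algebra_id; exact: sigma_algebra_measurable.
by case=> B mB <-; exists B => //; rewrite setTI.
Qed.

Lemma measurable_sub_rv : measurable_fun setT (U : M -> R).
Proof. by move=> _ B mB; apply: sub_sigma_algebra; exists B. Qed.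

Lemma sub_measurable_fun (g : T -> R) : measurable_fun setT (g : M -> R) ->
  measurable_fun setT g.
Proof.
move=> mg _ B mB; have [C mC ->] := sigma_rv_gen (mg measurableT B mB).
by rewrite -[X in measurable X]setTI; exact: mU.
Qed.

(** The set where k < g is itself the preimage of a Borel set under U, so the integrals agree on it
    and the positive difference integrates to 0 there. *)
Lemma ae_le_slices (g k : T -> R) :
  measurable_fun setT (g : M -> R) -> measurable_fun setT (k : M -> R) ->
  Q.-integrable setT (EFin \o g) -> Q.-integrable setT (EFin \o k) ->
  (forall B, measurable B -> (\int[Q]_(w in U @^-1` B) (g w)%:E =
     \int[Q]_(w in U @^-1` B) (k w)%:E)%E) ->
  \forall w \ae Q, g w <= k w.
Proof.
move=> mg mk ig ik H.
have mD : measurable ([set w | k w < g w] : set M).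
  rewrite (_ : [set w | _] = [set: M] `&` (fun w : M => k w < g w) @^-1` [set true]).
    by apply: (measurable_fun_ltr mk mg).
  by rewrite setTI; apply/seteqP; split.
have [B mB DE] := sigma_rv_gen mD.
have mD' : measurable (U @^-1` B) by rewrite -[X in measurable X]setTI; exact: mU.
have ig' : Q.-integrable (U @^-1` B) (EFin \o g) by apply: integrableS ig.
have ik' : Q.-integrable (U @^-1` B) (EFin \o k) by apply: integrableS ik.
have I0 : (\int[Q]_(w in U @^-1` B) `|(g w)%:E - (k w)%:E| = 0)%E.
  rewrite (eq_integral (fun w => (g w)%:E - (k w)%:E)%E); last first.
    move=> w; rewrite inE -DE => kg; have kg' : k w < g w by [].
    by rewrite -EFinB gee0_abs// lee_fin subr_ge0 ltW.
  rewrite integralB//= H// subee//; exact: integrable_fin_num.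
have mf : measurable_fun (U @^-1` B) (fun w => (g w)%:E - (k w)%:E)%E.
  apply: measurable_funTS; apply: emeasurable_funB; apply/measurable_EFinP;
    exact: sub_measurable_fun.
have := (ae_eq_integral_abs Q mD' mf).1 I0.
apply: filterS => w H'; rewrite leNgt; apply/negP => kg.
have Dw : (U @^-1` B) w by rewrite -DE.
have /eqP := H' Dw; rewrite -EFinB eqe subr_eq0 => /eqP E.
by rewrite E ltxx in kg.
Qed.

End SubSigma.

(** * Cell masses of the limiting random measure *)

Section LimitMass.
Variables (R : realType) (d : measure_display) (T : measurableType d).
Variables (Q : probability T R) (L : int -> T -> bool) (U V : T -> R).
Hypothesis L_unif : forall z, uniform_on Q (L z) predT.
Hypothesis L_indep : mutual_indep Q (fun z => sigma_discrete (L z)).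
Hypothesis U_unif : uniform01 Q U.
Hypothesis V_unif : uniform01 Q V.
Hypothesis UV_indep : indep Q (sigma_rv U) (sigma_rv V).
Hypothesis UVL_indep : indep Q (sigma_rv (fun w => (U w, V w))) (sigma_family L).
Variable nu : T -> wprobability R (rpspace R).
Hypothesis nu_cond : cond_law Q (sigma_rv U)
  (fun w => label_rperm (J (U w) (V w)) (L ^~ w) : rpspace R) nu.

Local Notation unif := (uniform_prob (@ltr01 R)).
(* [uniform_prob] lives on [measurableTypeR R], whose display differs from the
   canonical one of R. *)
Local Notation RT := (measurableTypeR R).

Let mU : measurable_fun setT (U : T -> RT) := U_unif.1.
Let mV : measurable_fun setT (V : T -> RT) := V_unif.1.
Let mUV : measurable_fun setT (fun w => (U w, V w) : RT * RT).
Proof. exact: measurable_fun_pair. Qed.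

Lemma UV_law (X : set (RT * RT)) : measurable X ->
  Q ((fun w => (U w, V w)) @^-1` X) = (unif \x unif)%E X.
Proof.
move=> mX; symmetry.
rewrite (@product_measure_unique _ _ _ _ _ unif unif (distribution Q (mfun_of mUV)))//.
move=> A B mA mB; rewrite /distribution /pushforward /=.
transitivity (Q (U @^-1` A `&` V @^-1` B)); first by [].
rewrite UV_indep.
- by rewrite U_unif.2// V_unif.2.
- by exists A => //; rewrite setTI.
- by exists B => //; rewrite setTI.
Qed.

Definition J_set j : set (RT * RT) := [set p | J p.1 p.2 = j].

Lemma measurable_J_set j : measurable (J_set j).
Proof.
have := @measurable_J R measurableT [set j] I.
by rewrite setTI.
Qed.

Lemma measurable_J_prob j : measurable_fun setT (@J_prob R j : RT -> \bar R).
Proof.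
rewrite (_ : @J_prob R j = (fun u => unif (xsection (J_set j) u))).
  by apply: measurable_fun_xsection; exact: measurable_J_set.
apply/funext => u; rewrite /J_prob; congr (unif _).
by apply/seteqP; split=> v; rewrite /xsection /= inE.
Qed.

(** The joint law of U and V is a product, and its section at u has mass [J_prob j u]; the integral
    in u is then carried back to the sample space. *)
Lemma J_slice j (B : set RT) : measurable B ->
  (Q (U @^-1` B `&` [set w | J (U w) (V w) = j]) =
   \int[Q]_(w in U @^-1` B) J_prob j (U w))%E.
Proof.
move=> mB; pose X := (B `*` setT) `&` J_set j.
have mX : measurable X.
  by apply: measurableI; [exact: measurableX|exact: measurable_J_set].
rewrite (_ : _ `&` _ = (fun w => (U w, V w)) @^-1` X); last first.
  by apply/seteqP; split=> w /=; [move=> [? ?]|move=> [[? _] ?]].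
rewrite UV_law// /product_measure1 /=.
transitivity (\int[unif]_(u in B) J_prob j u)%E.
  rewrite [RHS]integral_mkcond; apply: eq_integral => u _; rewrite patchE.
  case: ifPn => [uB|uB].
    congr (unif _); apply/seteqP; split=> v; rewrite /xsection /= !inE.
      by move=> [].
    by move=> uv; split=> //; split=> //; move: uB; rewrite inE.
  rewrite (_ : xsection _ _ = set0) ?measure0//.
  apply/seteqP; split=> v //; rewrite /xsection /= inE => -[[/= Bu _] _].
  by move: uB; rewrite notin_setE; apply.
rewrite (@eq_measure_integral _ _ _ B (distribution Q (mfun_of mU))); last first.
  by move=> A mA _; symmetry; exact: U_unif.2.
rewrite ge0_integral_pushforward//.
by apply: measurable_funTS; exact: measurable_J_prob.
Qed.

Lemma J_prob_fin j (u : R) : J_prob j u \is a fin_num.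
Proof.
apply: fin_num_measure.
rewrite (_ : [set v | _] = xsection (J_set j) u).
  by apply: measurable_xsection; exact: measurable_J_set.
by apply/seteqP; split=> v; rewrite /xsection /= inE.
Qed.

Definition arm_mass (u : R) h (c : cell h) : R :=
  \sum_(j < 4) fine (J_prob j.+1 u) * cell_prob R j.+1 c.

Lemma arm_massE u h (c : cell h) : (arm_mass u c)%:E =
  (\sum_(j < 4) (cell_prob R j.+1 c)%:E * J_prob j.+1 u)%E.
Proof.
rewrite /arm_mass -sumEFin; apply: eq_bigr => j _.
by rewrite mulrC EFinM fineK// J_prob_fin.
Qed.

Lemma measurable_J_rv j : measurable [set w | J (U w) (V w) = j].
Proof.
rewrite -[X in measurable X]setTI.
exact: (mUV measurableT (measurable_J_set j)).
Qed.

Lemma limit_cellE h (c : cell h) (j : nat) :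
  (fun w => label_rperm (J (U w) (V w)) (L ^~ w)) @^-1` @cell_set R h c
    `&` [set w | J (U w) (V w) = j] =
  [set w | J (U w) (V w) = j] `&` (fun w => label_rperm j (L ^~ w)) @^-1` @cell_set R h c.
Proof.
apply/seteqP; split=> w [H1 H2]; first by split=> //; rewrite /= -H2.
by split=> //; rewrite /preimage /= H1.
Qed.

Lemma measurable_label j h (c : cell h) :
  measurable ((fun w => label_rperm j (L ^~ w)) @^-1` @cell_set R h c).
Proof. by apply: (sigma_family_measurable L_unif); exact: label_rperm_family. Qed.

Definition J_ord w : 'I_4 := inord (J (U w) (V w)).-1.

Lemma J_ordE j : J_ord @^-1` [set j] = [set w | J (U w) (V w) = j.+1].
Proof.
apply/seteqP; split=> w /=; have := J_range (U w) (V w).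
  by move=> /andP[J0 J4] <-; rewrite /J_ord inordK prednK.
by move=> _ E; apply/val_inj; rewrite /J_ord E /= inordK.
Qed.

Lemma measurable_limit_cell h (c : cell h) :
  measurable ((fun w => label_rperm (J (U w) (V w)) (L ^~ w)) @^-1` @cell_set R h c).
Proof.
rewrite (_ : _ @^-1` _ = \bigcup_(j in [set: 'I_4]) ([set w | J (U w) (V w) = j.+1] `&`
   (fun w => label_rperm j.+1 (L ^~ w)) @^-1` @cell_set R h c)).
  apply: fin_bigcup_measurable => [|j _]; first exact: finite_finset.
  by apply: measurableI; [exact: measurable_J_rv|exact: measurable_label].
apply/seteqP; split=> [w Hw|w [j _]]; last by rewrite -limit_cellE => -[].
exists (J_ord w) => //; rewrite -limit_cellE; split=> //.
by rewrite -J_ordE.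
Qed.

(** Split by the value of J. On each piece the order is a fixed one, and the labels are independent
    of the pair (U, V), so the probability factors. *)
Lemma limit_cell_slice (B : set RT) h (c : cell h) : measurable B ->
  (Q (U @^-1` B `&` (fun w => label_rperm (J (U w) (V w)) (L ^~ w)) @^-1` @cell_set R h c) =
   \int[Q]_(w in U @^-1` B) (arm_mass (U w) c)%:E)%E.
Proof.
move=> mB; have mUB : measurable (U @^-1` B).
  by rewrite -[X in measurable X]setTI; exact: mU.
rewrite (@fin_rv_split _ _ _ Q _ J_ord); last 2 first.
- by move=> j; rewrite J_ordE; exact: measurable_J_rv.
- by apply: measurableI => //; exact: measurable_limit_cell.
under [RHS]eq_integral => w _ do rewrite arm_massE.
rewrite ge0_integral_sum//; last 2 first.
- move=> j; apply: measurable_funTS; apply: measurable_funeM.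
  by apply: (measurableT_comp (measurable_J_prob j.+1)).
- by move=> j w _; rewrite mule_ge0// lee_fin cell_prob_ge0.
apply: eq_bigr => j _.
rewrite ge0_integralZl//; last 2 first.
- apply: measurable_funTS.
  by apply: (measurableT_comp (measurable_J_prob j.+1)).
- by rewrite lee_fin cell_prob_ge0.
rewrite J_ordE -setIA limit_cellE setIA UVL_indep; last 2 first.
- exists ((B `*` setT) `&` J_set j.+1).
    by apply: measurableI; [exact: measurableX|exact: measurable_J_set].
  by rewrite setTI; apply/seteqP; split=> w /=; [move=> [[? _] ?]|move=> [? ?]].
- exact: label_rperm_family.
by rewrite J_slice// muleC (label_rperm_law L_unif L_indep).
Qed.

Lemma nu_mass_slice (B : set RT) h (c : cell h) : measurable B ->
  (\int[Q]_(w in U @^-1` B) (mass (nu w) c)%:E =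
   \int[Q]_(w in U @^-1` B) (arm_mass (U w) c)%:E)%E.
Proof.
move=> mB; rewrite -limit_cell_slice//.
have [_ H] := nu_cond (@cell_set_measurable R h c).
rewrite -H; last by exists B => //; rewrite setTI.
by apply: eq_integral => w _; symmetry; exact: cell_massE.
Qed.

Lemma measurable_arm_mass h (c : cell h) :
  measurable_fun setT (fun u : RT => arm_mass u c).
Proof.
apply: measurable_sum => j; apply: measurable_funM => //.
by apply: (measurableT_comp (@fine_measurable R _ measurableT)); exact: measurable_J_prob.
Qed.

Lemma J_prob_le1 j (u : R) : fine (J_prob j u) <= 1.
Proof.
rewrite -lee_fin fineK ?J_prob_fin//; apply: probability_le1.
rewrite (_ : [set v | _] = xsection (J_set j) u).
  by apply: measurable_xsection; exact: measurable_J_set.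
by apply/seteqP; split=> v; rewrite /xsection /= inE.
Qed.

Lemma arm_mass_bound h (c : cell h) u : `|arm_mass u c| <= 4.
Proof.
apply: le_trans (ler_norm_sum _ _ _) _.
apply: (@le_trans _ _ (\sum_(j < 4) 1)); last by rewrite sumr_const card_ord.
apply: ler_sum => j _; rewrite ger0_norm; last first.
  by rewrite mulr_ge0 ?cell_prob_ge0// fine_ge0.
by rewrite mulr_ile1 ?cell_prob_ge0 ?cell_prob_le1 ?J_prob_le1// fine_ge0.
Qed.

Lemma mass_bound h (c : cell h) (mu : wprobability R (rpspace R)) : `|mass mu c| <= 1.
Proof. by rewrite ger0_norm ?mass_ge0 ?mass_le1. Qed.

Local Notation M := (g_sigma_algebraType (sigma_rv U)).

Lemma nu_mass_sub h (c : cell h) :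
  measurable_fun setT ((fun w => mass (nu w) c) : M -> R).
Proof.
apply: (measurableT_comp (@fine_measurable R _ measurableT)) => _ C mC; rewrite setTI.
have [H _] := nu_cond (@cell_set_measurable R h c).
by apply: sub_sigma_algebra; exact: H.
Qed.

Lemma measurable_nu_mass h (c : cell h) : measurable_fun setT (fun w => mass (nu w) c).
Proof. exact: (sub_measurable_fun U_unif.1 (@nu_mass_sub h c)). Qed.

Lemma nu_mass_ae1 h (c : cell h) : \forall w \ae Q, mass (nu w) c = arm_mass (U w) c.
Proof.
have mk : measurable_fun setT ((fun w => arm_mass (U w) c) : M -> R).
  by apply: (measurableT_comp (measurable_arm_mass c)); exact: measurable_sub_rv.
have ig : Q.-integrable setT (EFin \o (fun w => mass (nu w) c)).
  apply: (@bounded_integrable _ _ _ _ _ 1); first exact: measurable_nu_mass.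
  by move=> w; exact: mass_bound.
have ik : Q.-integrable setT (EFin \o (fun w => arm_mass (U w) c)).
  apply: (@bounded_integrable _ _ _ _ _ 4); last by move=> w; exact: arm_mass_bound.
  exact: (sub_measurable_fun U_unif.1 mk).
have H1 := ae_le_slices U_unif.1 (@nu_mass_sub h c) mk ig ik
  (fun B mB => @nu_mass_slice B h c mB).
have H2 := ae_le_slices U_unif.1 mk (@nu_mass_sub h c) ik ig
  (fun B mB => esym (@nu_mass_slice B h c mB)).
by apply: filterS2 H1 H2 => w w1 w2; apply/eqP; rewrite eq_le w1 w2.
Qed.

Lemma U_ae : \forall w \ae Q, 0 < U w < 1.
Proof.
pose B : set RT := ~` `]0, 1[%classic.
have mB : measurable B by apply: measurableC; exact: measurable_itv.
exists (U @^-1` B); split.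
- by rewrite -[X in measurable X]setTI; exact: mU.
- rewrite U_unif.2// unifE// (_ : _ `&` _ = [set 0] `|` [set 1]).
    have m0 : measurable ([set 0] : set RT) by have := @measurable_set1 R 0.
    have m1 : measurable ([set 1] : set RT) by have := @measurable_set1 R 1.
    rewrite measureU0//; first exact: lebesgue_measure_set1.
    exact: lebesgue_measure_set1.
  apply/seteqP; split=> u; rewrite /B /= !in_itv /=.
    move=> [/negP nu01 /andP[u0 u1]]; move: nu01; rewrite negb_and -!leNgt.
    by move=> /orP[h|h]; [left|right]; apply/eqP; rewrite eq_le ?h ?u0 ?u1.
  by move=> [->|->]; rewrite ?ltxx ?lexx ?ler01 ?andbF.
- by move=> w /= H; rewrite /B /= in_itv.
Qed.

Lemma arm_mass_limit (u : R) h (c : cell h) : 0 <= u <= 1 -> arm_mass u c = cell_limit u c.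
Proof.
by move=> u01; apply: eq_bigr => j _; rewrite J_prob_arm.
Qed.

(** Each cell has its own null set; the cells of all levels are countable, so enumerating them by
    [unpickle] leaves a single null set. *)
Lemma nu_mass_ae : \forall w \ae Q, 0 < U w < 1 /\
  forall h (c : cell h), mass (nu w) c = cell_limit (U w) c.
Proof.
pose E n w := if choice.unpickle n : option {h : nat & cell h} is Some hc
  then mass (nu w) (tagged hc) = arm_mass (U w) (tagged hc) else True.
have : \forall w \ae Q, forall n, E n w.
  apply: ae_foralln => n; rewrite /E; case: choice.unpickle => [hc|]; first exact: nu_mass_ae1.
  exact: aeW.
apply: filterS2 U_ae => w /andP[u0 u1] H; split; first by rewrite u0.
move=> h c; rewrite -arm_mass_limit ?(ltW u0) ?(ltW u1)//.
by have := H (choice.pickle (Tagged cell c)); rewrite /E choice.pickleK.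
Qed.

Lemma J_unif (j : 'I_4) : (\int[Q]_w J_prob j.+1 (U w) = (4^-1)%R%:E)%E.
Proof.
transitivity (\int[unif]_u J_prob j.+1 u)%E.
  rewrite (@eq_measure_integral _ _ _ setT (distribution Q (mfun_of mU))); last first.
    by move=> A mA _; symmetry; exact: U_unif.2.
  by rewrite ge0_integral_pushforward//; exact: measurable_J_prob.
rewrite integral_uniform//; last exact: measurable_J_prob.
rewrite subr0 invr1 mul1e -(@integral_arm R j); apply: eq_integral => u.
by rewrite inE /= in_itv /= => u01; rewrite J_prob_arm.
Qed.

Lemma limit_cell_law h (c : cell h) :
  Q ((fun w => label_rperm (J (U w) (V w)) (L ^~ w)) @^-1` @cell_set R h c) =
  (\sum_(j < 4) 4^-1 * cell_prob R j.+1 c)%:E.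
Proof.
rewrite -[X in Q X]setTI -(preimage_setT U) limit_cell_slice//= preimage_setT.
under [LHS]eq_integral => w _ do rewrite arm_massE.
rewrite ge0_integral_sum//; last 2 first.
- move=> j; apply: measurable_funeM.
  by apply: (measurableT_comp (measurable_J_prob j.+1)).
- by move=> j w _; rewrite mule_ge0// lee_fin cell_prob_ge0.
rewrite -sumEFin; apply: eq_bigr => j _.
rewrite ge0_integralZl//; last 2 first.
- by apply: (measurableT_comp (measurable_J_prob j.+1)).
- by rewrite lee_fin cell_prob_ge0.
by rewrite J_unif muleC EFinM.
Qed.

Variable K : T -> 'I_4.
Hypothesis K_unif : uniform_on Q K predT.
Hypothesis KL_indep : indep Q (sigma_discrete K) (sigma_family L).

Lemma K_cellE h (c : cell h) (j : 'I_4) :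
  (fun w => label_rperm (K w).+1 (L ^~ w)) @^-1` @cell_set R h c `&` K @^-1` [set j] =
  K @^-1` [set j] `&` (fun w => label_rperm j.+1 (L ^~ w)) @^-1` @cell_set R h c.
Proof.
apply/seteqP; split=> w [H1 H2]; first by split=> //; rewrite /= -H2.
by split=> //; rewrite /preimage /= H1.
Qed.

Lemma measurable_K_cell h (c : cell h) :
  measurable ((fun w => label_rperm (K w).+1 (L ^~ w)) @^-1` @cell_set R h c).
Proof.
rewrite (_ : _ @^-1` _ = \bigcup_(j in [set: 'I_4]) (K @^-1` [set j] `&`
   (fun w => label_rperm j.+1 (L ^~ w)) @^-1` @cell_set R h c)).
  apply: fin_bigcup_measurable => [|j _]; first exact: finite_finset.
  by apply: measurableI; [exact: (K_unif j).1|exact: measurable_label].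
apply/seteqP; split=> [w Hw|w [j _]]; last by rewrite -K_cellE => -[].
by exists (K w) => //; rewrite -K_cellE.
Qed.

(** The same value as in [limit_cell_law]: J(U, V) and K have the same uniform law and both are
    independent of the labels. *)
Lemma K_cell_law h (c : cell h) :
  Q ((fun w => label_rperm (K w).+1 (L ^~ w)) @^-1` @cell_set R h c) =
  (\sum_(j < 4) 4^-1 * cell_prob R j.+1 c)%:E.
Proof.
rewrite (@fin_rv_split _ _ _ Q _ K); last 2 first.
- by move=> j; exact: (K_unif j).1.
- exact: measurable_K_cell.
rewrite -sumEFin; apply: eq_bigr => j _.
rewrite K_cellE KL_indep; last 2 first.
- by exists [set j] => //; rewrite setTI.
- exact: label_rperm_family.
rewrite (label_rperm_law L_unif L_indep) (K_unif j).2 -EFinM.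
by rewrite cardT size_enum_ord div1r.
Qed.

End LimitMass.

(** * Averaging over square permutations *)

Lemma unif_co (R : realType) (a b : R) : 0 <= a -> a <= b -> b <= 1 ->
  uniform_prob (@ltr01 R) `[a, b[%classic = (b - a)%:E.
Proof.
move=> a0 ab b1; rewrite unifE; last exact: measurable_itv.
rewrite (_ : _ `&` _ = `[a, b[%classic).
  rewrite lebesgue_measure_itv /= lte_fin; case: ltP => // ba.
  by rewrite (_ : b = a) ?subrr//; apply/eqP; rewrite eq_le ab ba.
apply/seteqP; split=> x /=; rewrite !in_itv /=; [by case|].
by move=> /andP[ax xb]; rewrite ax xb (le_trans a0 ax) (le_trans (ltW xb) b1).
Qed.

Section Averages.
Variables (R : realType) (d : measure_display) (T : measurableType d).
Variables (Q : probability T R) (U : T -> R).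
Hypothesis U_unif : uniform01 Q U.

(* Five labels out of 2 (n + 1) are forced, whence the factor 32 = 2 ^ 5. *)
Definition Sq_weight n : R := 32 / (4 ^ n.+1)%:R.

Definition fiber_avg n (Phi : 'S_n.+1 -> R) (z : 'I_n.+1) : R :=
  Sq_weight n * \sum_(s in Sq_at z) Phi s.

Lemma Sq_weight_ge0 n : 0 <= Sq_weight n.
Proof. by rewrite divr_ge0. Qed.

Lemma four_gt0 n : 0 < (4 ^ n)%:R :> R.
Proof. by rewrite ltr0n expn_gt0. Qed.

Lemma fiber_avg_bound n (Phi : 'S_n.+1 -> R) M z :
  (forall s, `|Phi s| <= M) -> `|fiber_avg Phi z| <= 32 * M.
Proof.
move=> PM; have M0 : 0 <= M by apply: le_trans (normr_ge0 _) (PM 1%g).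
rewrite /fiber_avg normrM ger0_norm ?Sq_weight_ge0//.
apply: (@le_trans _ _ (Sq_weight n * ((4 ^ n.+1)%:R * M))).
  rewrite ler_wpM2l ?Sq_weight_ge0//; apply: le_trans (ler_norm_sum _ _ _) _.
  apply: le_trans (ler_sum _ (fun s _ => PM s)) _.
  by rewrite sumr_const -[leLHS]mulr_natl ler_wpM2r// ler_nat card_Sq_at_le.
by rewrite /Sq_weight mulrA divfK// gt_eqF// four_gt0.
Qed.

(** The weighted size of the fiber is squeezed between 1 - d2 and 1, and [Phi] is nearly x on the
    part close to the limit frequencies. *)
Lemma fiber_avg_cvg (Phi : forall n, 'S_n.+1 -> R) (M x u : R) : 0 < u < 1 ->
  (forall n s, `|Phi n s| <= M) -> `|x| <= M ->
  (forall e, 0 < e -> exists h, exists2 dl : R, 0 < dl & forall n s,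
     s \in Sq n.+1 -> s \in close_at n h u dl -> `|Phi n s - x| <= e) ->
  fiber_avg (Phi n) (zpos n u) @[n --> \oo] --> x.
Proof.
move=> /[dup] u01 /andP[u0 u1] PM xM H; apply/cvgrPdist_le => e e0.
have M0 : 0 <= M := le_trans (normr_ge0 _) xM.
have e2 : 0 < e / 2 by rewrite divr_gt0.
have [h [dl dl0 Hdl]] := H _ e2.
(* The missing mass is paid twice, as the contribution of the remaining permutations and as the
   defect of the weight of x: 2 M d2 in all, at most e / 2. Using M + 1 covers M = 0. *)
pose d2 := Num.min dl (e / (4 * (M + 1))).
have d20 : 0 < d2 by rewrite lt_min dl0 divr_gt0// mulr_gt0// ltr_wpDl.
have d2e : 2 * M * d2 <= e / 2.
  apply: (@le_trans _ _ (2 * M * (e / (4 * (M + 1))))).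
    by rewrite ler_wpM2l ?mulr_ge0// ge_min lexx orbT.
  rewrite (_ : _ * _ = (M / (M + 1)) * (e / 2)); last by field; rewrite gt_eqF// ltr_wpDl.
  by rewrite ler_piMl ?(ltW e2)// ler_pdivrMr ?ltr_wpDl// mul1r lerDl ler01.
near=> n.
have tc : (1 - d2) * (4 ^ n.+1)%:R <=
    32 * #|(Sq_at (zpos n u) :&: close_at n h u d2)%SET|%:R.
  by near: n; exact: typical_count.
have Nu : 2 <= u * n.+1%:R.
  by rewrite mulrC -ler_pdivrMr// -[n.+1%:R]natr1 -lerBlDr; near: n; exact: nbhs_infty_ger.
have Nu' : 2 <= (1 - u) * n.+1%:R.
  rewrite mulrC -ler_pdivrMr ?subr_gt0// -[n.+1%:R]natr1 -lerBlDr.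
  by near: n; exact: nbhs_infty_ger.
have [zu uz] : (zpos n u)%:R <= n.+1%:R * u /\ n.+1%:R * u < (zpos n u).+1%:R.
  by apply: zposP; rewrite u1 ltW.
set z := zpos n u in tc zu uz *.
have zi : (0 < z < n)%N.
  apply/andP; split.
    by rewrite -ltnS -(ltr_nat R); apply: le_lt_trans uz; lra.
  rewrite -ltnS -(ltr_nat R) -natr1; apply: le_lt_trans (_ : n.+1%:R * u + 1 < _); lra.
have cA := card_Sq_at zi.
set A := Sq_at z in tc cA *; set G := (A :&: close_at n h u d2)%SET in tc.
pose k := Sq_weight n; have k0 : 0 <= k by exact: Sq_weight_ge0.
have kA : k * #|A|%:R <= 1.
  rewrite /k /Sq_weight mulrAC ler_pdivrMr ?four_gt0// mul1r -natrM ler_nat mulnC//.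
have kG : 1 - d2 <= k * #|G|%:R.
  by rewrite /k /Sq_weight mulrAC ler_pdivlMr ?four_gt0.
have GA : (#|G| <= #|A|)%N by rewrite subset_leq_card// subsetIl.
have DE : #|(A :\: close_at n h u d2)%SET|%:R = #|A|%:R - #|G|%:R :> R.
  by rewrite -(cardsID (close_at n h u d2) A) natrD addrC addKr.
have kGA : k * #|G|%:R <= k * #|A|%:R by rewrite ler_wpM2l// ler_nat.
rewrite /fiber_avg -/k -/A (big_setID (close_at n h u d2)) /= -/G.
have S1 : `|k * \sum_(s in G) Phi n s - k * #|G|%:R * x| <= e / 2.
  rewrite -mulrA -mulrBr normrM ger0_norm//.
  have -> : \sum_(s in G) Phi n s - #|G|%:R * x = \sum_(s in G) (Phi n s - x).
    by rewrite sumrB sumr_const mulr_natl.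
  apply: (@le_trans _ _ (k * (#|G|%:R * (e / 2)))).
    rewrite ler_wpM2l//; apply: le_trans (ler_norm_sum _ _ _) _.
    rewrite mulr_natl -sumr_const ler_sum// => s /setIP[sA sG]; apply: Hdl.
      by move: sA; rewrite inE => /andP[].
    move: sG; rewrite !inE => /forallP sG; apply/forallP => c.
    by apply: le_trans (sG c) _; rewrite ge_min lexx.
  by rewrite [leLHS]mulrA ler_piMl ?(ltW e2)//; exact: le_trans kA.
have S2 : `|k * \sum_(s in (A :\: close_at n h u d2)%SET) Phi n s| <= M * d2.
  rewrite normrM ger0_norm//; apply: (@le_trans _ _ (k * ((#|A|%:R - #|G|%:R) * M))).
    rewrite ler_wpM2l//; apply: le_trans (ler_norm_sum _ _ _) _.
    by rewrite -DE mulr_natl -sumr_const ler_sum.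
  rewrite mulrA mulrBr [leRHS]mulrC ler_wpM2r//; lra.
have S3 : `|x - k * #|G|%:R * x| <= M * d2.
  rewrite -[X in X - _]mul1r -mulrBl normrM ger0_norm ?subr_ge0; last by lra.
  by rewrite mulrC ler_pM ?subr_ge0//; lra.
rewrite mulrDr; move: S1 S2 S3.
set a := k * \sum_(s in G) _; set b := k * \sum_(s in _) _; set g := k * _ * x.
move=> S1 S2 S3.
rewrite (_ : x - (a + b) = (x - g) - (a - g) - b); last by ring.
apply: le_trans (ler_normB _ _) _; apply: le_trans (lerD (ler_normB _ _) (lexx _)) _.
lra.
Unshelve. all: by end_near.
Qed.

(** Half-open so that the slots partition [0, 1[ and match the truncation in [zpos]. *)
Definition slot n (z : 'I_n.+1) : set R := `[z%:R / n.+1%:R, z.+1%:R / n.+1%:R[%classic.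

Lemma slotP n (u : R) (z : 'I_n.+1) : 0 < u < 1 -> slot z u <-> z = zpos n u.
Proof.
move=> /andP[u0 u1]; have N0 : 0 < n.+1%:R :> R by rewrite ltr0n.
have [zu uz] : (zpos n u)%:R <= n.+1%:R * u /\ n.+1%:R * u < (zpos n u).+1%:R.
  by apply: zposP; rewrite u1 ltW.
rewrite /slot /= in_itv /= ler_pdivrMr// ltr_pdivlMr// mulrC; split=> [/andP[h1 h2]|->].
  have z1 : (z <= zpos n u)%N by rewrite -ltnS -(ltr_nat R) (le_lt_trans h1 uz).
  have z2 : (zpos n u <= z)%N by rewrite -ltnS -(ltr_nat R) (le_lt_trans zu h2).
  by apply/val_inj/eqP; rewrite eqn_leq z1 z2.
by rewrite zu uz.
Qed.

Lemma unif_slot n (z : 'I_n.+1) : fine (Q (U @^-1` slot z)) = n.+1%:R^-1.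
Proof.
have N0 : 0 < n.+1%:R :> R by rewrite ltr0n.
rewrite U_unif.2; last exact: measurable_itv.
rewrite unif_co /=.
- by rewrite -mulrBl -natrB ?leqnSn// subSnn mul1r.
- by rewrite divr_ge0.
- by rewrite ler_wpM2r ?invr_ge0// ler_nat.
- by rewrite ler_pdivrMr// mul1r ler_nat.
Qed.

Lemma measurable_slot n (z : 'I_n.+1) : measurable (U @^-1` slot z).
Proof. by rewrite -[X in measurable X]setTI; apply: U_unif.1 => //; exact: measurable_itv. Qed.

Definition slot_step n (g : 'I_n.+1 -> R) (w : T) : R :=
  \sum_z g z * \1_(U @^-1` slot z) w.

Lemma slot_stepE n (g : 'I_n.+1 -> R) w : 0 < U w < 1 -> slot_step g w = g (zpos n (U w)).
Proof.
move=> u01; rewrite /slot_step (bigD1 (zpos n (U w)))//= big1 => [|z /eqP ne].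
  by rewrite indicE mem_set ?mulr1 ?addr0//=; exact/slotP.
by rewrite indicE memNset ?mulr0// => /(slotP _ u01).
Qed.

Lemma measurable_slot_step n (g : 'I_n.+1 -> R) : measurable_fun setT (slot_step g).
Proof.
apply: measurable_sum => z; apply: measurable_funM => //.
by apply: measurable_indic; exact: measurable_slot.
Qed.

Lemma integral_slot_step n (g : 'I_n.+1 -> R) :
  (\int[Q]_w (slot_step g w)%:E = (\sum_z g z / n.+1%:R)%:E)%E.
Proof.
have int_i z : Q.-integrable setT (fun w => (\1_(U @^-1` slot z) w)%:E).
  by apply: integrable_indic; exact: measurable_slot.
under eq_integral => w _ do rewrite /slot_step -sumEFin.
rewrite integral_sum//; last first.
  by move=> z; under eq_fun do rewrite EFinM; exact: integrableZl.
rewrite -sumEFin; apply: eq_bigr => z _.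
under eq_integral => w _ do rewrite EFinM.
rewrite integralZl// integral_indic//; last exact: measurable_slot.
by rewrite setIT EFinM -(unif_slot z) fineK// fin_num_measure//; exact: measurable_slot.
Qed.

(** U falls into each slot with probability 1 / (n + 1), so the sum over positions of the minimum is
    the expectation of a step function of U. It converges for almost every U and is bounded by 32
    M. *)
Lemma weighted_avg_cvg (Phi : forall n, 'S_n.+1 -> R) (phi : T -> R) (M : R) :
  measurable_fun setT phi ->
  (forall n s, `|Phi n s| <= M) -> (forall w, `|phi w| <= M) ->
  (\forall w \ae Q, 0 < U w < 1 /\ forall e, 0 < e ->
    exists h, exists2 dl : R, 0 < dl & forall n s,
     s \in Sq n.+1 -> s \in close_at n h (U w) dl -> `|Phi n s - phi w| <= e) ->
  Sq_weight n / n.+1%:R * \sum_(s in Sq n.+1) Phi n s @[n --> \oo] -->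
    Rintegral Q setT phi.
Proof.
move=> mphi PM pM H.
have iphi : Q.-integrable setT (EFin \o phi) by exact: bounded_integrable pM.
have E n : (\int[Q]_w (slot_step (fiber_avg (Phi n)) w)%:E)%E =
    (Sq_weight n / n.+1%:R * \sum_(s in Sq n.+1) Phi n s)%:E.
  rewrite integral_slot_step; congr (_%:E).
  by rewrite -mulr_suml -mulr_sumr -sum_Sq_at mulrAC.
rewrite (_ : (fun n => _) = fine \o (fun n => \int[Q]_w (slot_step (fiber_avg (Phi n)) w)%:E)%E);
  last by apply/funext => n; rewrite /= E.
apply: fine_cvg; rewrite /Rintegral fineK; last exact: integrable_fin_num iphi.
have mf n : measurable_fun setT (fun w => (slot_step (fiber_avg (Phi n)) w)%:E).
  by apply/measurable_EFinP; exact: measurable_slot_step.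
have mphi' : measurable_fun setT (fun w => (phi w)%:E) by exact/measurable_EFinP.
have ig : Q.-integrable setT (cst (32 * M)%:E) by exact: finite_measure_integrable_cst.
have cv : \forall w \ae Q, setT w ->
    (slot_step (fiber_avg (Phi n)) w)%:E @[n --> \oo] --> (phi w)%:E.
  apply: filterS H => w [u01 H] _; apply: cvg_EFin; first exact: nearW.
  rewrite (_ : _ \o _ = (fun n => fiber_avg (Phi n) (zpos n (U w)))).
    exact: fiber_avg_cvg u01 PM (pM w) H.
  by apply/funext => n; rewrite /= slot_stepE.
have bd : \forall w \ae Q, forall n, setT w ->
    (`|(slot_step (fiber_avg (Phi n)) w)%:E| <= cst (32 * M)%:E w)%E.
  apply: filterS H => w [u01 _] n _; rewrite /= lee_fin slot_stepE//.
  exact: fiber_avg_bound.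
by have [_ _] := dominated_convergence measurableT mf mphi' cv ig bd.
Qed.

Lemma Sq_avg_cvg (Phi : forall n, 'S_n.+1 -> R) (phi : T -> R) (M : R) :
  measurable_fun setT phi ->
  (forall n s, `|Phi n s| <= M) -> (forall w, `|phi w| <= M) ->
  (\forall w \ae Q, 0 < U w < 1 /\ forall e, 0 < e ->
    exists h, exists2 dl : R, 0 < dl & forall n s,
     s \in Sq n.+1 -> s \in close_at n h (U w) dl -> `|Phi n s - phi w| <= e) ->
  \sum_(s in Sq n.+1) Phi n s / #|Sq n.+1|%:R @[n --> \oo] --> Rintegral Q setT phi.
Proof.
move=> mphi PM pM H; have c1 := weighted_avg_cvg mphi PM pM H.
(* The constant function gives the asymptotic size N 4^N / 32 of the set of square permutations,
   with N = n + 1; dividing removes the weight. *)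
have c2 : Sq_weight n / n.+1%:R * \sum_(s in Sq n.+1) 1 @[n --> \oo] -->
    Rintegral Q setT (cst 1 : T -> R).
  apply: (@weighted_avg_cvg (fun n s => 1) (cst 1) 1) => //.
  - by move=> n s; rewrite normr1.
  - by move=> w; rewrite normr1.
  - apply: filterS H => w [u01 _]; split=> // e e0; exists 0%N; exists 1 => // n s _ _.
    by rewrite subrr normr0 ltW.
have I1 : Rintegral Q setT (cst 1 : T -> R) = 1.
  by rewrite Rintegral_cst// mul1r; exact: (congr1 fine (probability_setT Q)).
rewrite I1 in c2.
have c3 := cvgM c1 (cvgV (oner_neq0 R) c2); rewrite invr1 mulr1 in c3.
rewrite (_ : (fun n => _) = (fun n => Sq_weight n / n.+1%:R * \sum_(s in Sq n.+1) Phi n s) *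
  (fun n => (Sq_weight n / n.+1%:R * \sum_(s in Sq n.+1) 1)^-1)); first exact: c3.
apply/funext => n; transitivity (Sq_weight n / n.+1%:R * (\sum_(s in Sq n.+1) Phi n s) *
  (Sq_weight n / n.+1%:R * \sum_(s in Sq n.+1) 1)^-1); last by [].
rewrite sumr_const -mulr_suml; set k := Sq_weight n / n.+1%:R.
have k0 : k != 0.
  by rewrite mulf_neq0 ?invr_eq0 ?pnatr_eq0// mulf_neq0 ?invr_eq0 ?pnatr_eq0 ?expn_eq0.
by rewrite invfM mulrACA divff// mul1r.
Qed.

End Averages.

(* Probabilities are functions on all sets, so two versions of a conditional
   law need not be Leibniz equal; continuous functionals do not see the
   difference. *)
Lemma same_mass_eq (R : realType) (F : wprobability R (rpspace R) -> R)
    (m m' : wprobability R (rpspace R)) : continuous F ->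
  (forall h (c : cell h), mass m' c = mass m c) -> F m' = F m.
Proof.
move=> cF E; apply/eqP; rewrite -subr_eq0 -normr_le0; apply/ler_addgt0Pl => e e0.
rewrite addr0.
have cFm : F @ m --> F m := @cF m.
move/cvgrPdist_le: cFm => /(_ _ e0) /cell_filter_nbhs[h /(_ h (leqnn _))[d d0]].
move=> /(_ m') /=; rewrite distrC; apply => c.
by rewrite E subrr normr0 ltW.
Qed.

(** * Permutation, root and conditional law at a fixed size *)

Section FixedSize.
Variables (R : realType) (d : measure_display) (T : measurableType d).
Variables (P : probability T R) (n : nat).
Variables (sigma : T -> 'S_n.+1) (root : T -> 'I_n.+1).
Hypothesis sigma_unif : uniform_on P sigma (Sq n.+1).
Hypothesis root_unif : uniform_on P root predT.
Hypothesis root_indep : indep P (sigma_discrete sigma) (sigma_discrete root).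

Definition rooted_at (w : T) : rpspace R := rooted_perm (sigma w) (root w).

Let mpair (si : 'S_n.+1 * 'I_n.+1) : measurable ((fun w => (sigma w, root w)) @^-1` [set si]).
Proof.
rewrite (_ : _ @^-1` _ = sigma @^-1` [set si.1] `&` root @^-1` [set si.2]).
  by apply: measurableI; [exact: (sigma_unif _).1|exact: (root_unif _).1].
by case: si => s i; apply/seteqP; split=> w /=; [case=> <- <-|case=> <- <-].
Qed.

Lemma rooted_cell_measurable h (c : cell h) : measurable (rooted_at @^-1` @cell_set R h c).
Proof.
exact: (measurable_fin_preimage mpair
  [set si | code h (rooted_perm si.1 si.2) = c]).
Qed.

Lemma rooted_measurable : measurable_fun setT (rooted_at : T -> borel (rpspace R)).
Proof. by apply: measurable_cells => h c; exact: rooted_cell_measurable. Qed.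

Lemma sigma_rooted_law (s : 'S_n.+1) h (c : cell h) :
  fine (P (sigma @^-1` [set s] `&` rooted_at @^-1` @cell_set R h c)) =
  (s \in Sq n.+1)%:R / #|Sq n.+1|%:R * cell_freq R s c.
Proof.
rewrite (_ : _ `&` _ = sigma @^-1` [set s] `&`
    root @^-1` [set i | code h (rooted_perm s i) == c]); last first.
  apply/seteqP; split=> w; rewrite /rooted_at /cell_set /preimage /= => -[E H]; split=> //.
    by rewrite -E; apply/eqP.
  by rewrite E; apply/eqP.
have mr i : measurable (root @^-1` [set i]) by exact: (root_unif i).1.
rewrite root_indep; last 2 first.
- by exists [set s] => //; rewrite setTI.
- by exists [set i | code h (rooted_perm s i) == c] => //; rewrite setTI.
rewrite fineM ?fin_num_measure//; last 2 first.
- exact: (sigma_unif s).1.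
- exact: (measurable_fin_preimage mr).
rewrite (sigma_unif s).2 (fin_rv_law P mr) (eq_bigr (fun=> n.+1%:R^-1)); last first.
  by move=> i _; rewrite (root_unif i).2 /= cardT size_enum_ord div1r.
rewrite sumr_const -[X in _ * X]mulr_natl /cell_freq; congr (_ * (_%:R * _)).
by apply: eq_card => i; rewrite !inE.
Qed.

Lemma sigma_fiber_measurable s : measurable (sigma @^-1` [set s]).
Proof. exact: (sigma_unif s).1. Qed.

Lemma sigma_expect (g : 'S_n.+1 -> R) :
  (\int[P]_w (g (sigma w))%:E = (\sum_(s in Sq n.+1) g s / #|Sq n.+1|%:R)%:E)%E.
Proof.
rewrite (integral_fin_rv P sigma_fiber_measurable); congr (_%:E).
rewrite [RHS]big_mkcond; apply: eq_bigr => s _; rewrite (sigma_unif s).2 /=.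
by case: (s \in _); rewrite ?mul1r// mul0r mulr0.
Qed.

Lemma rooted_law h (c : cell h) :
  fine (P (rooted_at @^-1` @cell_set R h c)) =
  \sum_(s in Sq n.+1) cell_freq R s c / #|Sq n.+1|%:R.
Proof.
have mc := @rooted_cell_measurable h c.
rewrite (@fin_rv_split _ _ _ P _ sigma _ sigma_fiber_measurable mc).
rewrite (eq_bigr (fun s => (fine (P (sigma @^-1` [set s] `&` rooted_at @^-1` @cell_set R h c)))%:E)).
  rewrite sumEFin /= [RHS]big_mkcond; apply: eq_bigr => s _; rewrite sigma_rooted_law.
  by case: (s \in _); rewrite ?mul0r// mul1r mulrC.
move=> s _; rewrite fineK; first by rewrite setIC.
by apply: fin_num_measure; apply: measurableI => //; exact: sigma_fiber_measurable.
Qed.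

Section CondLaw.
Variable mu : T -> wprobability R (rpspace R).
Hypothesis mu_cond : cond_law P (sigma_discrete sigma) rooted_at mu.

(** Level sets of a mass lie in the sigma-algebra of [sigma], hence are unions of its fibers; the
    mass is constant on fibers everywhere, not just almost surely. *)
Lemma mu_mass_fiber (w w' : T) h (c : cell h) : sigma w = sigma w' ->
  mass (mu w) c = mass (mu w') c.
Proof.
move=> E; have [H _] := mu_cond (@cell_set_measurable R h c).
have [B _ BE] := H _ (@emeasurable_set1 R ((mu w : probability (borel _) R) (@cell_set R h c))).
rewrite /mass /cell_mass; congr fine.
have : ([set: T] `&` sigma @^-1` B) w by rewrite BE.
move=> [_ Bw]; have : ([set: T] `&` sigma @^-1` B) w' by split=> //; rewrite /preimage /= -E.
by rewrite BE.
Qed.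

Lemma mu_mass (w : T) h (c : cell h) : sigma w \in Sq n.+1 ->
  mass (mu w) c = cell_freq R (sigma w) c.
Proof.
move=> wSq; have [_ H] := mu_cond (@cell_set_measurable R h c).
have /H : sigma_discrete sigma (sigma @^-1` [set sigma w]).
  by exists [set sigma w] => //; rewrite setTI.
rewrite (eq_integral (cst (mass (mu w) c)%:E)); last first.
  move=> w'; rewrite inE /= => E; rewrite -(mu_mass_fiber c E).
  exact: cell_massE.
rewrite integral_cst; last exact: sigma_fiber_measurable.
move=> H3; have {H3} : ((mass (mu w) c)%:E * P (sigma @^-1` [set sigma w]) =
    P (sigma @^-1` [set sigma w] `&` rooted_at @^-1` @cell_set R h c))%E := H3.
move=> /(congr1 fine); rewrite sigma_rooted_law (sigma_unif _).2 -EFinM /= wSq.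
rewrite [RHS]mulrC => /mulIf; apply.
rewrite mul1r invr_eq0 pnatr_eq0 -lt0n; apply/card_gt0P; by exists (sigma w).
Qed.

Lemma mu_measurable : measurable_fun setT (mu : T -> borel (wprobability R (rpspace R))).
Proof.
apply: measurable_wprob => h c.
apply: (measurableT_comp (@fine_measurable R _ measurableT)) => _ C mC.
have [H _] := mu_cond (@cell_set_measurable R h c).
have [B _ BE] := H _ mC; rewrite setTI -BE setTI.
exact: (measurable_fin_preimage sigma_fiber_measurable).
Qed.

(** The factorization of F o mu through [sigma]. [get] picks a sample point in the fiber, and an
    arbitrary one if the fiber is empty, which can happen only for permutations that are not
    square. *)
Definition fiber_value (F : wprobability R (rpspace R) -> R) (s : 'S_n.+1) : R :=
  F (mu (get [set w | sigma w = s])).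

Lemma get_fiber w : sigma (get [set w' | sigma w' = sigma w]) = sigma w.
Proof. by have /getPex : exists w', [set w' | sigma w' = sigma w] w' by exists w. Qed.

Lemma fiber_valueE F w : continuous F -> F (mu w) = fiber_value F (sigma w).
Proof.
move=> cF; apply: same_mass_eq => // h c; apply: mu_mass_fiber.
by rewrite get_fiber.
Qed.

Lemma sigma_fiber_nonempty s : s \in Sq n.+1 -> exists w, sigma w = s.
Proof.
move=> sSq; apply: contrapT => ne.
have := (sigma_unif s).2; rewrite (_ : _ @^-1` _ = set0); last first.
  by apply/seteqP; split=> w //= E; apply: ne; exists w.
rewrite measure0 sSq => /(congr1 fine) /= /esym/eqP; rewrite mul1r invr_eq0 pnatr_eq0.
by move=> /eqP/card0_eq/(_ s); rewrite sSq.
Qed.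

Lemma fiber_value_close F (s : 'S_n.+1) : s \in Sq n.+1 ->
  exists2 m, fiber_value F s = F m & forall h (c : cell h), mass m c = cell_freq R s c.
Proof.
move=> sSq; have [w ws] := sigma_fiber_nonempty sSq.
exists (mu (get [set w | sigma w = s])) => // h c.
by rewrite mu_mass -ws get_fiber// ws.
Qed.

End CondLaw.

End FixedSize.

(** * Quenched and annealed limits *)

(** A level has finitely many cells, so convergence of each mass is uniform over the level. *)
Lemma integral_mass_cvg (R : realType) (m : nat -> probability (borel (rpspace R)) R)
    (m0 : probability (borel (rpspace R)) R) (f : rpspace R -> R) :
  (forall h (c : cell h), cell_mass (m n) c @[n --> \oo] --> cell_mass m0 c) ->
  continuous f -> (exists M, forall x, `|f x| <= M) ->
  Rintegral (m n) setT f @[n --> \oo] --> Rintegral m0 setT f.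
Proof.
move=> mc cf [M fM]; apply/cvgrPdist_le => e e0.
have [h /(_ h (leqnn _))[d d0 H]] := integral_cont_cells m0 cf fM e0.
have near_all : \forall n \near \oo, forall c : cell h,
    `|cell_mass (m n) c - cell_mass m0 c| <= d.
  have N (c : cell h) : exists N, forall n, (N <= n)%N ->
      `|cell_mass (m n) c - cell_mass m0 c| <= d.
    have mcc := mc h c; move/cvgrPdist_le: mcc => /(_ _ d0)[N _ HN].
    by exists N => n Nn; rewrite distrC; exact: HN.
  have [N0 HN0] := choice N.
  exists (\max_(c : cell h) N0 c)%N => // n /= Hn c; apply: HN0.
  by apply: leq_trans Hn; exact: leq_bigmax.
by apply: filterS near_all => n /H; rewrite distrC.
Qed.

Theorem theorem6p4 (R : realType)
  (d : nat -> measure_display) (T : forall n, measurableType (d n))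
  (P : forall n, probability (T n) R)
  (sigma : forall n, T n -> 'S_n.+1) (root : forall n, T n -> 'I_n.+1)
  (sigma_unif : forall n, uniform_on (P n) (sigma n) (Sq n.+1))
  (root_unif : forall n, uniform_on (P n) (root n) predT)
  (root_indep : forall n, indep (P n) (sigma_discrete (sigma n))
                                      (sigma_discrete (root n)))
  (d' : measure_display) (T' : measurableType d') (Q : probability T' R)
  (L : int -> T' -> bool) (K : T' -> 'I_4) (U V : T' -> R)
  (L_unif : forall z, uniform_on Q (L z) predT)
  (L_indep : mutual_indep Q (fun z => sigma_discrete (L z)))
  (K_unif : uniform_on Q K predT)
  (KL_indep : indep Q (sigma_discrete K) (sigma_family L))
  (U_unif : uniform01 Q U) (V_unif : uniform01 Q V)
  (UV_indep : indep Q (sigma_rv U) (sigma_rv V))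
  (UVL_indep : indep Q (sigma_rv (fun w => (U w, V w))) (sigma_family L))
  (nu : T' -> wprobability R (rpspace R))
  (nu_cond : cond_law Q (sigma_rv U)
     (fun w => label_rperm (J (U w) (V w)) (L ^~ w) : rpspace R) nu) :
  quenched_cvg P sigma root Q nu /\
  annealed_cvg P sigma root Q
    (fun w => label_rperm (K w).+1 (L ^~ w) : rpspace R).
Proof.
have nu_ae := nu_mass_ae L_unif L_indep U_unif V_unif UV_indep UVL_indep nu_cond.
have m_nu := measurable_nu_mass U_unif nu_cond.
have nu_meas : measurable_fun setT (nu : T' -> borel (wprobability R (rpspace R))).
  exact: measurable_wprob.
split.
  move=> mu mu_cond; split=> //.
    by move=> n; exact: (mu_measurable (sigma_unif n) (mu_cond n)).
  move=> F cF [M FM]; rewrite expectationE_integral.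
  have -> : (fun n => 'E_(P n)[F \o mu n])%E =
      (fun n => (\sum_(s in Sq n.+1) fiber_value (sigma n) (mu n) F s / #|Sq n.+1|%:R)%:E).
    apply/funext => n; rewrite expectationE_integral -(sigma_expect (sigma_unif n)).
    apply: eq_integral => w _; congr (_%:E).
    exact: (fiber_valueE (mu_cond n) w cF).
  have mF : measurable_fun setT (F \o nu).
    by apply: (measurableT_comp (continuous_borel cF)).
  have iF : Q.-integrable setT (EFin \o (F \o nu)).
    exact: (@bounded_integrable _ T' R Q (F \o nu) M mF (fun w => FM (nu w))).
  rewrite -[X in _ --> X]fineK; last exact: integrable_fin_num iF.
  apply: cvg_EFin; first exact: nearW.
  apply: (@Sq_avg_cvg _ _ _ Q U U_unif (fun n => fiber_value (sigma n) (mu n) F) (F \o nu) M) => //.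
  - by move=> n s; exact: FM.
  - by move=> w; exact: FM.
  apply: filterS nu_ae => w [u01 Hw]; split=> // e e0.
  have cFw : F @ nu w --> F (nu w) := @cF (nu w).
  (* Near nu w, F is controlled by the masses of one level. These are [cell_limit] for nu and
     [cell_freq] for mu, so membership in [close_at] is exactly the closeness required. *)
  move/cvgrPdist_le: cFw => /(_ _ e0) /cell_filter_nbhs[h /(_ h (leqnn _))[dl dl0 Hdl]].
  exists h; exists dl => // n s sSq; rewrite inE => /forallP close.
  have [m -> mE] := fiber_value_close (sigma_unif n) (root_unif n) (root_indep n) (mu_cond n) F sSq.
  rewrite distrC; apply: Hdl => c; rewrite mE Hw; exact: close.
have mY : measurable_fun setT
    ((fun w => label_rperm (K w).+1 (L ^~ w)) : T' -> borel (rpspace R)).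
  by apply: measurable_cells => h c; exact: (measurable_K_cell L_unif K_unif).
have mX n := rooted_measurable (sigma_unif n) (root_unif n).
split=> // f cf fM.
(* Passing to the laws on the space of rooted permutations reduces the convergence to single cell
   masses. *)
have lawE dd (TT : measurableType dd) (PP : probability TT R) (X : TT -> rpspace R)
    (mX' : measurable_fun setT (X : TT -> borel (rpspace R))) :
  ('E_PP[f \o X] = (Rintegral (distribution PP (mfun_of mX')) setT f)%:E)%E.
  have [M fM'] := fM; have mf := continuous_borel cf.
  have imf : PP.-integrable setT (EFin \o (f \o X)).
    exact: (@bounded_integrable _ TT R PP (f \o X) M (measurableT_comp mf mX') (fun w => fM' (X w))).
  have ifd := @integral_distribution _ _ _ _ _ PP (mfun_of mX') (EFin \o f).
  rewrite expectationE_integral /Rintegral fineK; last first.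
    apply: integrable_fin_num => //.
    exact: (integrable_cont cf fM' (distribution PP (mfun_of mX'))).
  by rewrite ifd//; exact/measurable_EFinP.
rewrite (lawE _ _ Q _ mY).
rewrite (_ : (fun n => _) =
  (fun n => (Rintegral (distribution (P n) (mfun_of (mX n))) setT f)%:E)); last first.
  by apply/funext => n; rewrite -(lawE _ _ (P n) _ (mX n)).
apply: cvg_EFin; first exact: nearW.
apply: (integral_mass_cvg (m := fun n => distribution (P n) (mfun_of (mX n)))) => // h c.
rewrite (_ : (fun n => _) = (fun n => \sum_(s in Sq n.+1) cell_freq R s c / #|Sq n.+1|%:R)); last first.
  apply/funext => n; rewrite -(rooted_law (sigma_unif n) (root_unif n) (root_indep n)).
  by [].
(* The annealed limit is the mean of nu, so the mass of a cell is the expectation of its mass under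
   nu, and the quenched averaging applies to [cell_freq]. *)
have -> : @cell_mass R (distribution Q (mfun_of mY)) h c = Rintegral Q setT (fun w => mass (nu w) c).
  transitivity (fine (Q ((fun w => label_rperm (K w).+1 (L ^~ w)) @^-1` @cell_set R h c))).
    by [].
  rewrite (K_cell_law L_unif L_indep K_unif KL_indep).
  rewrite -(limit_cell_law L_unif L_indep U_unif V_unif UV_indep UVL_indep).
  rewrite -[X in Q X]setTI -(preimage_setT U).
  rewrite (limit_cell_slice L_unif L_indep U_unif V_unif UV_indep UVL_indep)//.
  rewrite -(nu_mass_slice L_unif L_indep U_unif V_unif UV_indep UVL_indep nu_cond)//.
apply: (@Sq_avg_cvg _ _ _ Q U U_unif (fun n s => cell_freq R s c)
  (fun w => mass (nu w) c) 1) => //.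
- move=> n s; rewrite ger0_norm ?divr_ge0// ler_pdivrMr ?ltr0n// mul1r ler_nat.
  by rewrite (leq_trans (max_card _))// card_ord.
- by move=> w; exact: mass_bound.
apply: filterS nu_ae => w [u01 Hw]; split=> // e e0.
exists h; exists e => // n s sSq; rewrite inE => /forallP close.
by rewrite Hw; exact: close.
Qed.
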